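(* Let $\Gamma$ be a compact metric graph (connected, finitely many edges, each of finite length) with first Betti number $\beta$ and set of boundary (degree-one) vertices $V_b$. Let $W:\Gamma\to\mathbb{R}$ be $C^1$ and assume $\Gamma$ is $W$-generic. Let $f_1,f_2,\dots$ be the eigenfunctions of $H_W=-\frac{\partial^2}{\partial x^2}+W$ with Dirichlet boundary conditions and Neumann–Kirchhoff vertex conditions, let $k_1<k_2<\dots<k_M$ be a strictly increasing sequence of positive integers, and let $F(x)=\sum_{i=1}^{M}a_i f_{k_i}(x)$ where every $a_i\neq 0$. Then $$k_1-1-(M-1)\left(|V_b|+2\beta-2\right)\leq N(F)\leq k_M-1+\beta+(M-1)\left(|V_b|+2\beta-2\right).$$
   Context: A metric graph $\Gamma=(V,E)$: each edge $e$ is identified with an interval $[0,l_e]$; the degree $\deg(v)$ of a vertex counts incident edges with loops counted twice. Boundary vertices $V_b$ are those of degree one; inner vertices $V_i$ those of degree at least two. The first Betti number is $\beta=|E|-|V|+1$. The operator $H_W=-\frac{d^2}{dx^2}+W$ acts edgewise on functions in $\bigoplus_e H^2(e)$ satisfying: $f(v)=0$ at boundary vertices (Dirichlet); at each inner vertex $v$, $f$ is continuous and $\sum_{e\ni v}\partial_e f(v)=0$, where $\partial_e f(v)$ is the derivative at $v$ along $e$ pointing into $e$ (Neumann–Kirchhoff). This operator is self-adjoint with eigenvalues $\lambda_1\le\lambda_2\le\dots$ (with multiplicity) and $L^2$-orthogonal eigenfunctions $f_1,f_2,\dots$, $f_k$ belonging to $\lambda_k$. $\Gamma$ is called $W$-generic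 if no eigenfunction of $H_W$ vanishes at any inner vertex (in particular all eigenvalues are simple). For a function $f$ on $\Gamma$, $N(f)$ denotes the number of zeroes of $f$ on $\Gamma$ other than the boundary vertices. *)

(* Defs.v *)
From Stdlib Require Import Reals Lra Lia ZArith Arith List Relations.
From Coquelicot Require Import Coquelicot.
Open Scope R_scope.

(** A compact metric graph: vertices 0..nV-1, edges 0..nE-1; edge e is
    identified with [0, len e], position 0 being at vertex [src e] and
    position [len e] at vertex [tgt e] (loops: src e = tgt e). *)
Record mgraph := MGraph {
  nV : nat; nE : nat;
  src : nat -> nat; tgt : nat -> nat;
  len : nat -> R }.

Definition wf_graph (G : mgraph) : Prop :=
  forall e, (e < nE G)%nat ->
    (src G e < nV G)%nat /\ (tgt G e < nV G)%nat /\ 0 < len G e.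

Definition adjacent (G : mgraph) (u w : nat) : Prop :=
  exists e, (e < nE G)%nat /\
    ((src G e = u /\ tgt G e = w) \/ (src G e = w /\ tgt G e = u)).

Definition connected (G : mgraph) : Prop :=
  forall u v, (u < nV G)%nat -> (v < nV G)%nat ->
    clos_refl_trans nat (adjacent G) u v.

Definition sumR (s : list nat) (g : nat -> R) : R :=
  fold_right (fun i acc => g i + acc) 0 s.

Definition deg (G : mgraph) (v : nat) : nat :=
  (length (filter (fun e => Nat.eqb (src G e) v) (seq 0 (nE G))) +
   length (filter (fun e => Nat.eqb (tgt G e) v) (seq 0 (nE G))))%nat.

Definition num_boundary (G : mgraph) : nat :=
  length (filter (fun v => Nat.eqb (deg G v) 1) (seq 0 (nV G))).

Definition betti (G : mgraph) : Z :=
  (Z.of_nat (nE G) - Z.of_nat (nV G) + 1)%Z.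

(** edge endpoints: (e, false) is the start (x = 0), (e, true) the end (x = len e) *)
Definition vertex_of (G : mgraph) (e : nat) (b : bool) : nat :=
  if b then tgt G e else src G e.
Definition pos (G : mgraph) (e : nat) (b : bool) : R :=
  if b then len G e else 0.

(** functions on the graph: edgewise *)
Definition gfun := nat -> R -> R.

Definition cont_within (l : R) (g : R -> R) (x : R) : Prop :=
  filterlim g (within (fun y => 0 <= y <= l) (locally x)) (locally (g x)).

Definition C1_edge (l : R) (g dg : R -> R) : Prop :=
  (forall x, 0 < x < l -> is_derive g x (dg x)) /\
  (forall x, 0 <= x <= l -> cont_within l g x /\ cont_within l dg x).

Definition C2_edge (l : R) (g dg d2g : R -> R) : Prop :=
  C1_edge l g dg /\ C1_edge l dg d2g.

Definition potential_C1 (G : mgraph) (W : gfun) : Prop :=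
  (forall e, (e < nE G)%nat -> exists dW, C1_edge (len G e) (W e) dW) /\
  (forall e1 b1 e2 b2, (e1 < nE G)%nat -> (e2 < nE G)%nat ->
     vertex_of G e1 b1 = vertex_of G e2 b2 ->
     W e1 (pos G e1 b1) = W e2 (pos G e2 b2)).

Definition solves_eigen (G : mgraph) (W : gfun) (lam : R) (f : gfun) : Prop :=
  exists df d2f : gfun,
    (forall e, (e < nE G)%nat ->
       C2_edge (len G e) (f e) (df e) (d2f e) /\
       (forall x, 0 <= x <= len G e -> - d2f e x + W e x * f e x = lam * f e x)) /\
    (forall e b, (e < nE G)%nat -> deg G (vertex_of G e b) = 1%nat ->
       f e (pos G e b) = 0) /\
    (forall e1 b1 e2 b2, (e1 < nE G)%nat -> (e2 < nE G)%nat ->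
       vertex_of G e1 b1 = vertex_of G e2 b2 ->
       (2 <= deg G (vertex_of G e1 b1))%nat ->
       f e1 (pos G e1 b1) = f e2 (pos G e2 b2)) /\
    (forall v, (2 <= deg G v)%nat ->
       sumR (seq 0 (nE G))
         (fun e => (if Nat.eqb (src G e) v then df e 0 else 0) +
                   (if Nat.eqb (tgt G e) v then - df e (len G e) else 0)) = 0).

Definition eigenfunction (G : mgraph) (W : gfun) (lam : R) (f : gfun) : Prop :=
  solves_eigen G W lam f /\
  exists e x, (e < nE G)%nat /\ 0 <= x <= len G e /\ f e x <> 0.

Definition L2_inner (G : mgraph) (f g : gfun) : R :=
  sumR (seq 0 (nE G)) (fun e => RInt (fun x => f e x * g e x) 0 (len G e)).

Definition generic (G : mgraph) (W : gfun) : Prop :=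
  forall lam g, eigenfunction G W lam g ->
    forall e b, (e < nE G)%nat -> (2 <= deg G (vertex_of G e b))%nat ->
      g e (pos G e b) <> 0.

Definition eigen_sequence (G : mgraph) (W : gfun) (lam : nat -> R) (f : nat -> gfun) : Prop :=
  (forall k, (1 <= k)%nat -> eigenfunction G W (lam k) (f k)) /\
  (forall j k, (1 <= j)%nat -> (j <= k)%nat -> lam j <= lam k) /\
  (forall j k, (1 <= j)%nat -> (1 <= k)%nat -> j <> k -> L2_inner G (f j) (f k) = 0) /\
  (forall mu g, eigenfunction G W mu g ->
     exists (n : nat) (c : nat -> R),
       (forall k, (1 <= k)%nat -> c k <> 0 -> lam k = mu) /\
       (forall e x, (e < nE G)%nat -> 0 <= x <= len G e ->
          g e x = sumR (seq 1 n) (fun k => c k * f k e x))).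

Inductive gpoint := PE (e : nat) (x : R) | PV (v : nat).

Definition is_zero (G : mgraph) (F : gfun) (p : gpoint) : Prop :=
  match p with
  | PE e x => (e < nE G)%nat /\ 0 < x < len G e /\ F e x = 0
  | PV v => (v < nV G)%nat /\ (2 <= deg G v)%nat /\
            exists e b, (e < nE G)%nat /\ vertex_of G e b = v /\ F e (pos G e b) = 0
  end.

Definition num_zeros (G : mgraph) (F : gfun) (n : nat) : Prop :=
  exists s : list gpoint, NoDup s /\ (forall p, In p s <-> is_zero G F p) /\ length s = n.

(* Main.v *)
Require Import Defs.
From Stdlib Require Import Reals ZArith List Lra Lia Arith Classical ClassicalEpsilon Relations.
From Coquelicot Require Import Coquelicot.
Open Scope R_scope.
Set Bullet Behavior "Strict Subproofs".

(** Put [H = - d²/dx² + W], choose [c] below [W] and below the spectrum, and let [F t] be the sum of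
    [a_i (lam_(k_i) - c)^(-t) f_(k_i)], so that [(H - c) F (t + 1) = F t].  Going from [U = F (t + 1)]
    to [P = F t], the maximum principle on each edge shows that [P] has at least as many zeros as
    [U], up to corrections at the end points; by Kirchhoff's condition the corrections at an inner
    vertex [v] add up to a loss of at most [deg v - 2], and only if [F s v] vanishes for some
    [s] in [[t, t + 1)].  Since [s |-> F s v] is an exponential sum with at most [M] terms, all nonzero by
    genericity, it has at most [M - 1] zeros, so the total loss is at most
    [(M - 1) * sum (deg v - 2) = (M - 1) (|V_b| + 2 beta - 2)].  As [t -> +oo] ([-oo]) the zeros of [F t] are those
    of the eigenfunction [f_(k_1)] ([f_(k_M)]), and [k - 1 <= N (f_k) <= k - 1 + beta].

    The lower nodal bound is Picone's identity applied to a combination of [f_1, ..., f_(k-1)] vanishing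
    at the zeros of [f_k].  For the upper one, if [f_k] had [k + beta] zeros there would be a function [h f_k],
    with [h] a step function jumping at these zeros, continuous and orthogonal to [f_1, ..., f_k], and of
    Rayleigh quotient [lam_k]; its existence forces an eigenvalue at most [lam_k] on the orthogonal
    complement, which contradicts the completeness of the sequence [f]. *)

(** * Finite sums and linear systems *)

(** No variational principle and no eigenfunction expansion is at hand: completeness of [f] only
    says that every eigenfunction is a finite combination of the [f k]. The upper nodal bound
    therefore cannot quote min-max; an eigenvalue has to be forced, and this is done without
    compactness, from bounded solution operators that arise by correcting edgewise ODE solutions
    through a square linear system.

    Zeros are only counted from below, since a combination of eigenfunctions is not known in advance
    to have finitely many. The upper bound and finiteness come from transporting any lower bound on
    the number of zeros towards [t -> -oo], where it collides with the nodal bound of a single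
    eigenfunction.

    Only unit time steps are taken, so the maximum principle needed is that of a second order ODE.
    Real times serve to turn a sign change at a vertex during a step into a zero of an exponential
    sum; the time intervals being half-open and disjoint, different steps yield different zeros, and
    the loss is bounded independently of the number of steps. *)

Definition lsum {A : Type} (s : list A) (g : A -> R) : R :=
  fold_right (fun i acc => g i + acc) 0 s.

Lemma lsum_ext {A} (s : list A) g h :
  (forall i, In i s -> g i = h i) -> lsum s g = lsum s h.
Proof.
  induction s as [|x s IH]; intros H; simpl; auto.
  rewrite H by (left; auto). rewrite IH; auto. intros; apply H; right; auto.
Qed.

Lemma lsum_plus {A} (s : list A) g h :
  lsum s (fun i => g i + h i) = lsum s g + lsum s h.
Proof. induction s; simpl; lra. Qed.

Lemma lsum_scal {A} (s : list A) c g : lsum s (fun i => c * g i) = c * lsum s g.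
Proof. induction s; simpl; lra. Qed.

Lemma lsum_app {A} (s t : list A) g : lsum (s ++ t) g = lsum s g + lsum t g.
Proof. induction s; simpl; lra. Qed.

Lemma lsum_zero {A} (s : list A) g : (forall i, In i s -> g i = 0) -> lsum s g = 0.
Proof.
  induction s as [|x s IH]; intros H; simpl; auto.
  rewrite H by (left; auto). rewrite IH; [lra|]. intros; apply H; right; auto.
Qed.

Lemma lsum_le {A} (s : list A) g h :
  (forall i, In i s -> g i <= h i) -> lsum s g <= lsum s h.
Proof.
  induction s as [|x s IH]; intros H; simpl; [lra|].
  apply Rplus_le_compat; [apply H; left; auto|]. apply IH; intros; apply H; right; auto.
Qed.

Lemma lsum_nonneg {A} (s : list A) g : (forall i, In i s -> 0 <= g i) -> 0 <= lsum s g.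
Proof.
  intros H. replace 0 with (lsum s (fun _ : A => 0)).
  - apply lsum_le; auto.
  - apply lsum_zero; auto.
Qed.

Lemma lsum_ge_term {A} (s : list A) g j :
  (forall i, In i s -> 0 <= g i) -> In j s -> g j <= lsum s g.
Proof.
  induction s as [|x s IH]; intros H Hj; simpl; [destruct Hj|].
  assert (0 <= lsum s g) by (apply lsum_nonneg; intros; apply H; right; auto).
  assert (0 <= g x) by (apply H; left; auto).
  destruct Hj as [->|Hj]; [lra|].
  assert (g j <= lsum s g) by (apply IH; auto; intros; apply H; right; auto). lra.
Qed.

Lemma lsum_map {A B} (p : A -> B) (s : list A) g :
  lsum (map p s) g = lsum s (fun i => g (p i)).
Proof. induction s; simpl; auto. f_equal; auto. Qed.

Lemma lsum_swap {A B} (s : list A) (t : list B) (g : A -> B -> R) :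
  lsum s (fun i => lsum t (fun j => g i j)) = lsum t (fun j => lsum s (fun i => g i j)).
Proof.
  induction s as [|x s IH]; simpl.
  - symmetry; apply lsum_zero; auto.
  - rewrite IH, lsum_plus. reflexivity.
Qed.

Lemma lsum_filter {A} (b : A -> bool) (s : list A) g :
  lsum (filter b s) g = lsum s (fun i => if b i then g i else 0).
Proof. induction s as [|x s IH]; simpl; auto. destruct (b x); simpl; rewrite IH; lra. Qed.

Lemma lsum_const {A} (s : list A) c : lsum s (fun _ => c) = INR (length s) * c.
Proof.
  induction s as [|x s IH]; [simpl; lra|].
  simpl lsum. rewrite IH. cbn [length]. rewrite S_INR. lra.
Qed.

Lemma lsum_abs {A} (s : list A) g : Rabs (lsum s g) <= lsum s (fun i => Rabs (g i)).
Proof.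
  induction s as [|x s IH]; simpl.
  - rewrite Rabs_R0; lra.
  - eapply Rle_trans; [apply Rabs_triang|]. lra.
Qed.

Lemma lsum_seq_S a n g : lsum (seq a (S n)) g = lsum (seq a n) g + g (a + n)%nat.
Proof. rewrite seq_S, lsum_app. simpl. lra. Qed.

Lemma lsum_delta n (j : nat) (g : nat -> R) :
  (j < n)%nat -> lsum (seq 0 n) (fun i => if Nat.eqb i j then g i else 0) = g j.
Proof.
  induction n as [|n IH]; intros Hj; [lia|].
  rewrite lsum_seq_S. simpl.
  destruct (Nat.eq_dec j n) as [->|Hn].
  - rewrite Nat.eqb_refl, lsum_zero; [lra|].
    intros i Hi. apply in_seq in Hi. destruct (Nat.eqb_spec i n); [lia|auto].
  - rewrite IH by lia. destruct (Nat.eqb_spec n j); [lia|lra].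
Qed.

Lemma lsum_seq_remove n j0 (g : nat -> R) :
  (j0 < S n)%nat ->
  lsum (seq 0 (S n)) g
  = g j0 + lsum (seq 0 n) (fun j => g (if Nat.ltb j j0 then j else S j)).
Proof.
  revert j0; induction n as [|n IH]; intros j0 Hj.
  - replace j0 with 0%nat by lia. simpl. lra.
  - rewrite lsum_seq_S. simpl plus.
    destruct (Nat.eq_dec j0 (S n)) as [->|Hne].
    + rewrite Rplus_comm. f_equal. apply lsum_ext. intros i Hi. apply in_seq in Hi.
      destruct (Nat.ltb_spec i (S n)); [auto|lia].
    + rewrite (IH j0) by lia. rewrite (lsum_seq_S 0 n). cbv beta. change (0 + n)%nat with n. change (0 + S n)%nat with (S n).
      destruct (Nat.ltb_spec n j0); [lia|]. lra.
Qed.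

(** Gaussian elimination on the last equation: a nonzero coefficient [a m j0] solves it for the
    unknown [j0], leaving one equation and one unknown fewer; without such a coefficient the
    equation is void. *)
Lemma homogeneous_system (m : nat) : forall (n : nat) (a : nat -> nat -> R),
  (m < n)%nat ->
  exists x : nat -> R, (exists j, (j < n)%nat /\ x j <> 0) /\
    forall i, (i < m)%nat -> lsum (seq 0 n) (fun j => a i j * x j) = 0.
Proof.
  induction m as [|m IH]; intros n a Hmn.
  - exists (fun _ => 1). split; [exists 0%nat; split; [lia|lra]|]. intros; lia.
  - destruct (classic (exists j0, (j0 < n)%nat /\ a m j0 <> 0)) as [[j0 [Hj0 Ha]]|Hno].
    + destruct n as [|n]; [lia|].
      set (sk := fun j => if Nat.ltb j j0 then j else S j).
      destruct (IH n (fun i j => a i (sk j) - a i j0 * a m (sk j) / a m j0)) as [x [[j1 [Hj1 Hx1]] Hx]];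
        [lia|].
      set (p := - lsum (seq 0 n) (fun j => a m (sk j) * x j) / a m j0).
      set (y := fun j => if Nat.eqb j j0 then p else x (if Nat.ltb j j0 then j else pred j)).
      assert (Hysk : forall j, y (sk j) = x j).
      { intros j. unfold y, sk. destruct (Nat.ltb_spec j j0).
        - destruct (Nat.eqb_spec j j0); [lia|]. destruct (Nat.ltb_spec j j0); [auto|lia].
        - destruct (Nat.eqb_spec (S j) j0); [lia|]. destruct (Nat.ltb_spec (S j) j0); [lia|auto]. }
      assert (Hy0 : y j0 = p) by (unfold y; rewrite Nat.eqb_refl; auto).
      exists y. split.
      * exists (sk j1). split; [unfold sk; destruct (Nat.ltb j1 j0); lia|]. rewrite Hysk; auto.
      * intros i Hi. rewrite (lsum_seq_remove n j0) by auto. rewrite Hy0.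
        fold sk. rewrite (lsum_ext _ _ (fun j => a i (sk j) * x j)).
        2:{ intros j _. change (if Nat.ltb j j0 then j else S j) with (sk j). rewrite Hysk. auto. }
        destruct (Nat.eq_dec i m) as [->|Him].
        -- unfold p. field. auto.
        -- assert (H := Hx i ltac:(lia)). cbv beta in H.
           rewrite (lsum_ext _ _ (fun j => a i (sk j) * x j + (- a i j0 / a m j0) * (a m (sk j) * x j))) in H.
           2:{ intros; field; auto. }
           rewrite lsum_plus, lsum_scal in H. unfold p.
           rewrite <- H. field; auto.
    + destruct (IH n a) as [x [Hx0 Hx]]; [lia|].
      exists x. split; auto. intros i Hi.
      destruct (Nat.eq_dec i m) as [->|Him]; [|apply Hx; lia].
      apply lsum_zero. intros j Hj. apply in_seq in Hj.
      destruct (Req_dec (a m j) 0) as [->|Hne]; [lra|].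
      exfalso; apply Hno. exists j. split; [lia|auto].
Qed.

(** The right-hand side becomes an extra column. The enlarged homogeneous system has a nontrivial
    solution, injectivity forces its last coordinate to be nonzero, and dividing by that coordinate
    solves the system. *)
Lemma injective_system_solvable (n : nat) (a : nat -> nat -> R) :
  (forall x : nat -> R, (forall i, (i < n)%nat -> lsum (seq 0 n) (fun j => a i j * x j) = 0) ->
     forall j, (j < n)%nat -> x j = 0) ->
  forall d : nat -> R, exists x : nat -> R,
    forall i, (i < n)%nat -> lsum (seq 0 n) (fun j => a i j * x j) = d i.
Proof.
  intros Hinj d.
  destruct (homogeneous_system n (S n) (fun i j => if Nat.eqb j n then - d i else a i j))
    as [x [[j1 [Hj1 Hx1]] Hx]]; [lia|].
  assert (Hx' : forall i, (i < n)%nat ->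
             lsum (seq 0 n) (fun j => a i j * x j) = d i * x n).
  { intros i Hi. assert (H := Hx i Hi). rewrite lsum_seq_S in H.
    change (0 + n)%nat with n in H. cbv beta in H. rewrite Nat.eqb_refl in H.
    rewrite (lsum_ext _ _ (fun j => a i j * x j)) in H.
    { cbv iota in H. lra. }
    intros j Hj. apply in_seq in Hj. destruct (Nat.eqb_spec j n); [lia|auto]. }
  assert (Hn : x n <> 0).
  { intros H0. assert (H : forall j, (j < n)%nat -> x j = 0).
    { apply Hinj. intros i Hi. rewrite Hx' by auto. rewrite H0; lra. }
    destruct (Nat.eq_dec j1 n) as [->|]; [auto|]. apply Hx1, H; lia. }
  exists (fun j => x j / x n). intros i Hi.
  rewrite (lsum_ext _ _ (fun j => / x n * (a i j * x j))) by (intros; field; auto).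
  rewrite lsum_scal, Hx' by auto. field; auto.
Qed.

(** The matrix [b] is fixed before [d]; this is what bounds solutions by a constant times the data
    in [admissible_system]. *)
Lemma injective_system_inverse (n : nat) (a : nat -> nat -> R) :
  (forall x : nat -> R, (forall i, (i < n)%nat -> lsum (seq 0 n) (fun j => a i j * x j) = 0) ->
     forall j, (j < n)%nat -> x j = 0) ->
  exists b : nat -> nat -> R, forall (d : nat -> R) i, (i < n)%nat ->
    lsum (seq 0 n) (fun j => a i j * lsum (seq 0 n) (fun m => b j m * d m)) = d i.
Proof.
  intros Hinj.
  assert (Hex : forall m : nat, exists x : nat -> R, forall i, (i < n)%nat ->
    lsum (seq 0 n) (fun j => a i j * x j) = if Nat.eqb m i then 1 else 0).
  { intros m. apply (injective_system_solvable n a Hinj). }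
  exists (fun j m => proj1_sig (constructive_indefinite_description _ (Hex m)) j).
  intros d i Hi.
  rewrite (lsum_ext _ _ (fun j => lsum (seq 0 n) (fun m =>
     d m * (a i j * proj1_sig (constructive_indefinite_description _ (Hex m)) j)))).
  2:{ intros j _. rewrite <- lsum_scal. apply lsum_ext; intros; ring. }
  rewrite lsum_swap.
  rewrite (lsum_ext _ _ (fun m => if Nat.eqb m i then d m else 0)).
  - apply lsum_delta; auto.
  - intros m _. rewrite lsum_scal.
    destruct (constructive_indefinite_description _ (Hex m)) as [x Hx]; simpl.
    rewrite Hx by auto. destruct (Nat.eqb m i); lra.
Qed.

(** * Real analysis on an interval *)

Lemma is_derive_val (f : R -> R) (x l l' : R) : is_derive f x l -> l = l' -> is_derive f x l'.
Proof. intros H <-. exact H. Qed.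

Lemma deriv_plus (f g : R -> R) x a b :
  is_derive f x a -> is_derive g x b -> is_derive (fun y => f y + g y) x (a + b).
Proof. intros; apply (is_derive_plus f g x a b); auto. Qed.

Lemma deriv_minus (f g : R -> R) x a b :
  is_derive f x a -> is_derive g x b -> is_derive (fun y => f y - g y) x (a - b).
Proof. intros; apply (is_derive_minus f g x a b); auto. Qed.

Lemma deriv_mult (f g : R -> R) x a b :
  is_derive f x a -> is_derive g x b ->
  is_derive (fun y => f y * g y) x (a * g x + f x * b).
Proof. intros; apply (is_derive_mult f g x a b); auto. intros; apply Rmult_comm. Qed.

Lemma deriv_scal (f : R -> R) x k a :
  is_derive f x a -> is_derive (fun y => k * f y) x (k * a).
Proof. intros; apply is_derive_scal; auto. Qed.

Lemma deriv_opp (f : R -> R) x a : is_derive f x a -> is_derive (fun y => - f y) x (- a).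
Proof. intros; apply (is_derive_opp f x a); auto. Qed.

Lemma deriv_const (c x : R) : is_derive (fun _ : R => c) x 0.
Proof. apply (is_derive_const (V := R_NormedModule) c x). Qed.

Lemma deriv_continuous (f : R -> R) x a : is_derive f x a -> continuous f x.
Proof. intros H. apply (ex_derive_continuous f). exists a; exact H. Qed.

Lemma deriv_reflect (f : R -> R) l x a :
  is_derive f (l - x) a -> is_derive (fun y => f (l - y)) x (- a).
Proof.
  intros H. eapply is_derive_val.
  - apply (is_derive_comp f (fun y => l - y) x a (-1)); auto.
    eapply is_derive_val; [apply deriv_minus; [apply deriv_const|apply (is_derive_id x)]|].
    unfold one; simpl; lra.
  - unfold scal; simpl; unfold mult; simpl; lra.
Qed.

Lemma cont_plus (f g : R -> R) x :
  continuous f x -> continuous g x -> continuous (fun y => f y + g y) x.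
Proof. intros; apply (continuous_plus f g x); auto. Qed.

Lemma cont_minus (f g : R -> R) x :
  continuous f x -> continuous g x -> continuous (fun y => f y - g y) x.
Proof. intros; apply (continuous_minus f g x); auto. Qed.

Lemma cont_mult (f g : R -> R) x :
  continuous f x -> continuous g x -> continuous (fun y => f y * g y) x.
Proof. intros; apply (continuous_mult f g x); auto. Qed.

Lemma cont_opp (f : R -> R) x : continuous f x -> continuous (fun y => - f y) x.
Proof. intros; apply (continuous_opp f x); auto. Qed.

Lemma cont_const (c x : R) : continuous (fun _ : R => c) x.
Proof. apply continuous_const. Qed.

Lemma cont_pt (f : R -> R) x : continuous f x -> continuity_pt f x.
Proof. intros H. apply continuity_pt_filterlim. exact H. Qed.

Lemma cont_reflect (f : R -> R) l x : continuous f (l - x) -> continuous (fun y => f (l - y)) x.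
Proof.
  intros H. apply (continuous_comp (fun y => l - y) f x); auto.
  apply cont_minus; [apply cont_const|apply continuous_id].
Qed.

Lemma locally_interval a b x : a < x < b -> locally x (fun y => a < y < b).
Proof.
  intros Hx. exists (mkposreal (Rmin (x - a) (b - x)) ltac:(apply Rmin_case; lra)).
  intros y Hy. unfold ball in Hy; simpl in Hy.
  unfold AbsRing_ball, abs, minus, plus, opp in Hy; simpl in Hy.
  assert (Rmin (x - a) (b - x) <= x - a) by apply Rmin_l.
  assert (Rmin (x - a) (b - x) <= b - x) by apply Rmin_r.
  apply Rabs_def2 in Hy. lra.
Qed.

Lemma zero_deriv_of_constant (f : R -> R) a b x d c :
  a < x < b -> (forall y, a < y < b -> f y = c) -> is_derive f x d -> d = 0.
Proof.
  intros Hx Hf Hd. rewrite <- (is_derive_unique _ _ _ Hd). apply is_derive_unique.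
  apply is_derive_ext_loc with (fun _ => c); [|apply deriv_const].
  eapply filter_imp; [|exact (locally_interval a b x Hx)]. intros y Hy. symmetry; auto.
Qed.

(** [L] will hold zeros of an eigenfunction or jumps of a step function, where only continuity is
    known. Splitting the interval at such a point removes it from the list. *)
Lemma nondecreasing_except (F dF : R -> R) (L : list R) : forall a b,
  a <= b -> (forall x, a <= x <= b -> continuous F x) ->
  (forall x, a < x < b -> ~ In x L -> is_derive F x (dF x) /\ 0 <= dF x) ->
  F a <= F b.
Proof.
  induction L as [|z L IH]; intros a b Hab Hc Hd.
  - destruct (Req_dec a b) as [->|Hne]; [lra|].
    (* [MVT_gen] may return an endpoint, where the sign of [dF] is unknown *)
    set (dG := fun x => if Rle_dec x a then 0 else if Rle_dec b x then 0 else dF x).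
    destruct (MVT_gen F a b dG) as [c [Hc1 Hc2]].
    + intros x Hx. rewrite Rmin_left, Rmax_right in Hx by lra.
      unfold dG. destruct (Rle_dec x a); [lra|]. destruct (Rle_dec b x); [lra|].
      apply Hd; auto.
    + intros x Hx. rewrite Rmin_left, Rmax_right in Hx by lra. apply cont_pt, Hc; auto.
    + rewrite Rmin_left, Rmax_right in Hc1 by lra.
      assert (0 <= dG c).
      { unfold dG. destruct (Rle_dec c a); [lra|]. destruct (Rle_dec b c); [lra|].
        apply Hd; [lra|auto]. }
      assert (0 <= dG c * (b - a)) by (apply Rmult_le_pos; lra). lra.
  - destruct (classic (a < z < b)) as [Hz|Hz].
    + apply Rle_trans with (F z).
      * apply IH; [lra|intros; apply Hc; lra|].
        intros x Hx Hn. apply Hd; [lra|]. intros [->|Hi]; [lra|auto].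
      * apply IH; [lra|intros; apply Hc; lra|].
        intros x Hx Hn. apply Hd; [lra|]. intros [->|Hi]; [lra|auto].
    + apply IH; auto. intros x Hx Hn. apply Hd; auto. intros [->|Hi]; auto.
Qed.

Lemma nondecreasing_of_deriv (F dF : R -> R) a b :
  a <= b -> (forall x, is_derive F x (dF x)) -> (forall x, a < x < b -> 0 <= dF x) -> F a <= F b.
Proof.
  intros Hab Hd Hp. apply (nondecreasing_except F dF nil a b); auto.
  intros. eapply deriv_continuous; eauto.
Qed.

(** Otherwise the nondecreasing [F] would be constant, with derivative 0 at the midpoint. *)
Lemma increasing_of_deriv (F dF : R -> R) a b :
  a < b -> (forall x, is_derive F x (dF x)) -> (forall x, a < x < b -> 0 < dF x) -> F a < F b.
Proof.
  intros Hab Hd Hp.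
  set (c := (a + b) / 2).
  assert (Hle : forall u v, a <= u -> u <= v -> v <= b -> F u <= F v).
  { intros u v H1 H2 H3. apply (nondecreasing_of_deriv F dF); auto.
    intros; apply Rlt_le, Hp; lra. }
  destruct (Rlt_or_le (F a) (F b)) as [|Hba]; auto. exfalso.
  assert (Hc : forall x, a < x < b -> F x = F a).
  { intros x Hx. apply Rle_antisym.
    - apply Rle_trans with (F b); auto. apply Hle; lra.
    - apply Hle; lra. }
  assert (Hm : a < c < b) by (unfold c; lra).
  assert (Hz := zero_deriv_of_constant F a b c (dF c) (F a) Hm Hc (Hd c)).
  specialize (Hp c Hm). lra.
Qed.

Lemma ivt_zero (f : R -> R) a b :
  (forall x, continuous f x) -> a < b -> f a * f b < 0 -> exists x, a < x < b /\ f x = 0.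
Proof.
  intros Hc Hab Hs.
  destruct (IVT_cor f a b) as [z [Hz1 Hz2]]; [intros x; apply cont_pt, Hc|lra|lra|].
  exists z. split; auto.
  destruct (Req_dec z a) as [->|]; [rewrite Hz2 in Hs; lra|].
  destruct (Req_dec z b) as [->|]; [rewrite Hz2 in Hs; lra|]. lra.
Qed.

Lemma deriv_pos_right (f : R -> R) x d :
  is_derive f x d -> 0 < d -> exists e, 0 < e /\ forall y, x < y < x + e -> f x < f y.
Proof.
  intros H Hd. apply is_derive_Reals in H. destruct (H (d / 2)) as [e He]; [lra|].
  exists e. split; [apply cond_pos|]. intros y Hy.
  specialize (He (y - x)). assert (Hne : y - x <> 0) by lra.
  specialize (He Hne). rewrite Rabs_right in He by lra.
  specialize (He ltac:(lra)). replace (x + (y - x)) with y in He by ring.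
  apply Rabs_def2 in He.
  assert (Hq : 0 < (f y - f x) / (y - x)) by lra.
  assert (f y - f x = (f y - f x) / (y - x) * (y - x)) by (field; lra).
  assert (0 < (f y - f x) / (y - x) * (y - x)) by (apply Rmult_lt_0_compat; lra). lra.
Qed.

Lemma deriv_neg_right (f : R -> R) x d :
  is_derive f x d -> d < 0 -> exists e, 0 < e /\ forall y, x < y < x + e -> f y < f x.
Proof.
  intros H Hd. destruct (deriv_pos_right (fun y => - f y) x (- d)) as [e [He H1]].
  - apply deriv_opp; auto.
  - lra.
  - exists e; split; auto. intros y Hy. specialize (H1 y Hy). lra.
Qed.

Lemma second_deriv_increasing (U dU : R -> R) a b d :
  (forall x, is_derive U x (dU x)) -> is_derive dU a d -> a < b ->
  0 <= dU a -> (dU a = 0 -> 0 < d) -> exists x, a < x < b /\ U a < U x.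
Proof.
  intros HU Hd Hab H0 Hd0.
  destruct (Req_dec (dU a) 0) as [E|E].
  - destruct (deriv_pos_right dU a d Hd (Hd0 E)) as [e [He H1]].
    set (x := Rmin (a + e) b). assert (x <= a + e) by apply Rmin_l.
    assert (x <= b) by apply Rmin_r. assert (a < x) by (apply Rmin_case; lra).
    exists ((a + x) / 2). split; [lra|].
    apply (increasing_of_deriv U dU); auto; [lra|].
    intros y Hy. rewrite <- E. apply H1; lra.
  - destruct (deriv_pos_right U a (dU a) (HU a)) as [e [He H1]]; [lra|].
    set (x := Rmin (a + e) b). assert (x <= a + e) by apply Rmin_l.
    assert (x <= b) by apply Rmin_r. assert (a < x) by (apply Rmin_case; lra).
    exists ((a + x) / 2). split; [lra|]. apply H1; lra.
Qed.

Lemma interior_max_second_deriv (U dU : R -> R) a b y d :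
  (forall x, is_derive U x (dU x)) -> is_derive dU y d ->
  a < y < b -> (forall x, a <= x <= b -> U x <= U y) -> d <= 0.
Proof.
  intros HU Hd Hy Hmax.
  destruct (Rle_or_lt d 0) as [|Hpos]; auto. exfalso.
  assert (H0 : dU y = 0).
  { destruct (Rtotal_order (dU y) 0) as [H|[H|H]]; auto; exfalso.
    - destruct (deriv_pos_right (fun x => U (y - x)) 0 (- dU y)) as [e [He H1]]; [|lra|].
      + apply deriv_reflect. rewrite Rminus_0_r. apply HU.
      + set (x := Rmin e (y - a)). assert (x <= e) by apply Rmin_l.
        assert (x <= y - a) by apply Rmin_r. assert (0 < x) by (apply Rmin_case; lra).
        specialize (H1 (x / 2) ltac:(lra)). specialize (Hmax (y - x / 2) ltac:(lra)).
        rewrite Rminus_0_r in H1. lra.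
    - destruct (deriv_pos_right U y (dU y) (HU y) ltac:(lra)) as [e [He H1]].
      set (x := Rmin e (b - y)). assert (x <= e) by apply Rmin_l.
      assert (x <= b - y) by apply Rmin_r. assert (0 < x) by (apply Rmin_case; lra).
      specialize (H1 (y + x / 2) ltac:(lra)). specialize (Hmax (y + x / 2) ltac:(lra)). lra. }
  destruct (second_deriv_increasing U dU y b d) as [x [Hx1 Hx2]]; auto; try lra.
  specialize (Hmax x ltac:(lra)). lra.
Qed.

(** * Counting zeros *)

(** At least [n] zeros in the open interval, found from left to right. Only a lower bound is
    expressed, so finiteness of the zero set is never presupposed. *)
Fixpoint nz (g : R -> R) (a b : R) (n : nat) : Prop :=
  match n with
  | O => True
  | S n => exists x, a < x < b /\ g x = 0 /\ nz g x b n
  end.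

Lemma nz_weaken g n : forall m a b a' b',
  (m <= n)%nat -> a' <= a -> b <= b' -> nz g a b n -> nz g a' b' m.
Proof.
  induction n as [|n IH]; intros m a b a' b' Hm Ha Hb H.
  - replace m with 0%nat by lia. exact I.
  - destruct m as [|m]; [exact I|]. destruct H as [x [Hx [H0 H]]].
    exists x. repeat split; auto; try lra. apply (IH m x b); auto; try lia; lra.
Qed.

Lemma nz_cat g m : forall n a b c,
  a <= b -> b <= c -> nz g a b m -> nz g b c n -> nz g a c (m + n).
Proof.
  induction m as [|m IH]; intros n a b c Hab Hbc H1 H2.
  - simpl. apply (nz_weaken g n n b c); auto; lra.
  - destruct H1 as [x [Hx [H0 H1]]]. exists x. repeat split; auto; try lra.
    apply (IH n x b c); auto; lra.
Qed.

Lemma nz_one g a b x : a < x < b -> g x = 0 -> nz g a b 1.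
Proof. intros; exists x; simpl; auto. Qed.

Lemma nz_snoc g n : forall a b x,
  nz g a x n -> a < x < b -> g x = 0 -> nz g a b (S n).
Proof.
  induction n as [|n IH]; intros a b x H Hx H0.
  - apply (nz_one g a b x); auto.
  - destruct H as [z [Hz [Hz0 H]]]. exists z. repeat split; auto; try lra.
    apply (IH z b x); auto; lra.
Qed.

Lemma nz_reflect g l n : forall a b,
  nz g a b n -> nz (fun x => g (l - x)) (l - b) (l - a) n.
Proof.
  induction n as [|n IH]; intros a b H; [exact I|].
  destruct H as [x [Hx [H0 H]]].
  apply (nz_snoc _ n (l - b) (l - a) (l - x)).
  - apply IH; auto.
  - lra.
  - replace (l - (l - x)) with x by ring. auto.
Qed.

Lemma nz_ext g h a b n :
  (forall x, a < x < b -> g x = h x) -> nz g a b n -> nz h a b n.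
Proof.
  revert a; induction n as [|n IH]; intros a E H; [exact I|].
  destruct H as [x [Hx [H0 H]]]. exists x. repeat split; try lra.
  - rewrite <- E; auto.
  - apply IH; auto. intros; apply E; lra.
Qed.

Lemma nz_opp g a b n : nz (fun x => - g x) a b n -> nz g a b n.
Proof.
  revert a; induction n as [|n IH]; intros a H; [exact I|].
  destruct H as [x [Hx [H0 H]]]. exists x. repeat split; try lra. apply IH; auto.
Qed.

Lemma nz_list g a b n : nz g a b n ->
  exists s : list R, NoDup s /\ length s = n /\ forall x, In x s -> a < x < b /\ g x = 0.
Proof.
  revert a; induction n as [|n IH]; intros a H.
  - exists nil. split; [constructor|]. split; auto. intros x [].
  - destruct H as [x [Hx [H0 H]]]. destruct (IH x H) as [s [Hs1 [Hs2 Hs3]]].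
    exists (x :: s). repeat split.
    + constructor; auto. intros Hi. apply Hs3 in Hi. lra.
    + simpl; auto.
    + destruct H1 as [->|Hi]; [lra|]. apply Hs3 in Hi. lra.
    + destruct H1 as [->|Hi]; [lra|]. apply Hs3 in Hi. lra.
    + destruct H1 as [->|Hi]; auto. apply Hs3 in Hi. apply Hi.
Qed.

Lemma exists_min (s : list R) : s <> nil -> exists m, In m s /\ forall x, In x s -> m <= x.
Proof.
  induction s as [|x s IH]; intros H; [congruence|].
  destruct s as [|y s].
  - exists x. split; [left; auto|]. intros z [->|[]]; lra.
  - destruct IH as [m [Hm1 Hm2]]; [congruence|].
    destruct (Rle_or_lt x m) as [Hx|Hx].
    + exists x. split; [left; auto|]. intros z [->|Hz]; [lra|]. specialize (Hm2 z Hz); lra.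
    + exists m. split; [right; auto|]. intros z [->|Hz]; [lra|]. auto.
Qed.

Lemma nz_of_list g n : forall (s : list R) a b,
  length s = n -> NoDup s -> (forall x, In x s -> a < x < b /\ g x = 0) -> nz g a b n.
Proof.
  induction n as [|n IH]; intros s a b Hl Hd H; [exact I|].
  destruct (exists_min s) as [m [Hm1 Hm2]]; [intros ->; discriminate|].
  exists m. destruct (H m Hm1) as [H1 H2]. repeat split; auto; try lra.
  destruct (in_split m s Hm1) as [s1 [s2 Es]]. subst s.
  assert (Hd' := NoDup_remove_1 _ _ _ Hd). assert (Hn := NoDup_remove_2 _ _ _ Hd).
  apply (IH (s1 ++ s2) m b); auto.
  - rewrite length_app in *. simpl in Hl. lia.
  - intros x Hx. assert (Hx' : In x (s1 ++ m :: s2)).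
    { apply in_app_iff in Hx. apply in_app_iff. simpl. tauto. }
    destruct (H x Hx') as [H3 H4]. split; auto. split; [|lra].
    specialize (Hm2 x Hx'). destruct (Req_dec m x) as [->|]; [contradiction|lra].
Qed.

(** * Zeros on one edge under the operator -d²/dx² + q *)

(* All functions are extended smoothly beyond the edge [0, l], so that derivatives at its
   end points are two-sided. *)
Definition edge_rel (l : R) (q U dU ddU P : R -> R) : Prop :=
  0 < l /\
  (forall x, is_derive U x (dU x)) /\ (forall x, is_derive dU x (ddU x)) /\
  (forall x, continuous P x) /\
  (forall x, 0 <= x <= l -> 0 < q x /\ ddU x = q x * U x - P x) /\
  (forall a b, 0 <= a -> a < b -> b <= l -> exists x, a < x < b /\ U x <> 0).

Lemma edge_rel_opp l q U dU ddU P : edge_rel l q U dU ddU P ->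
  edge_rel l q (fun x => - U x) (fun x => - dU x) (fun x => - ddU x) (fun x => - P x).
Proof.
  intros (Hl & H1 & H2 & H3 & H4 & H5). split; auto. split; [|split; [|split; [|split]]].
  - intros; apply deriv_opp; auto.
  - intros; apply deriv_opp; auto.
  - intros; apply cont_opp; auto.
  - intros x Hx. destruct (H4 x Hx) as [Hq E]. split; auto. rewrite E. ring.
  - intros a b Ha Hab Hb. destruct (H5 a b Ha Hab Hb) as [x [Hx Hn]]. exists x. split; auto. lra.
Qed.

Lemma edge_rel_reflect l q U dU ddU P : edge_rel l q U dU ddU P ->
  edge_rel l (fun x => q (l - x)) (fun x => U (l - x)) (fun x => - dU (l - x))
    (fun x => ddU (l - x)) (fun x => P (l - x)).
Proof.
  intros (Hl & H1 & H2 & H3 & H4 & H5). split; auto. split; [|split; [|split; [|split]]].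
  - intros; apply deriv_reflect; auto.
  - intros x. eapply is_derive_val; [apply deriv_opp, deriv_reflect, H2|]. ring.
  - intros; apply cont_reflect; auto.
  - intros x Hx. apply H4; lra.
  - intros a b Ha Hab Hb. destruct (H5 (l - b) (l - a)) as [x [Hx Hn]]; try lra.
    exists (l - x). split; [lra|]. replace (l - (l - x)) with x by ring. auto.
Qed.

(** Maximum principle: at an interior maximum with [U > 0] one has [ddU <= 0], so
    [P = q U - ddU > 0]. The points exceeding [U a] and [U b] keep the maximum off the ends. *)
Lemma edge_interior_max l q U dU ddU P a b :
  edge_rel l q U dU ddU P -> 0 <= a -> b <= l ->
  (exists x, a < x < b /\ U a < U x) -> (exists x, a < x < b /\ U b < U x) ->
  (exists x, a < x < b /\ 0 < U x) ->
  exists y, a < y < b /\ 0 < U y /\ 0 < P y.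
Proof.
  intros (Hl & H1 & H2 & H3 & H4 & H5) Ha Hb [x1 [Hx1 E1]] [x2 [Hx2 E2]] [x0 [Hx0 E0]].
  destruct (continuity_ab_maj U a b) as [y [Hy1 Hy2]]; [lra| |].
  { intros c Hc. apply cont_pt. eapply deriv_continuous; apply H1. }
  assert (U x1 <= U y) by (apply Hy1; lra). assert (U x2 <= U y) by (apply Hy1; lra).
  assert (U x0 <= U y) by (apply Hy1; lra).
  assert (Hy : a < y < b).
  { destruct (Req_dec y a) as [->|]; [lra|]. destruct (Req_dec y b) as [->|]; lra. }
  exists y. split; auto. split; [lra|].
  assert (Hd : ddU y <= 0) by (apply (interior_max_second_deriv U dU a b y); auto).
  destruct (H4 y ltac:(lra)) as [Hq E].
  assert (0 < q y * U y) by (apply Rmult_lt_0_compat; lra). lra.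
Qed.

(** Good points, where [U] and [P] have the same strict sign, carry the comparison of zeros: one
    lies between any two zeros of [U], and two of them enclosing a zero of [U] also enclose a zero
    of [P]. *)
Definition good (U P : R -> R) (y : R) : Prop := 0 < P y * U y.

Lemma good_between_zeros l q U dU ddU P a b :
  edge_rel l q U dU ddU P -> 0 <= a -> a < b -> b <= l -> U a = 0 -> U b = 0 ->
  exists y, a < y < b /\ good U P y.
Proof.
  intros HE Ha Hab Hb Ua Ub.
  assert (HE' := HE). destruct HE' as (_ & _ & _ & _ & _ & H5).
  destruct (H5 a b Ha Hab Hb) as [x [Hx Hn]].
  destruct (Rlt_or_le 0 (U x)) as [Hp|Hp].
  - destruct (edge_interior_max l q U dU ddU P a b) as [y [Hy [H1 H2]]]; auto.
    1-3: exists x; rewrite ?Ua, ?Ub; auto.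
    exists y. split; auto. apply Rmult_lt_0_compat; auto.
  - assert (HE' := edge_rel_opp _ _ _ _ _ _ HE).
    destruct (edge_interior_max l q _ _ _ _ a b HE') as [y [Hy [H1 H2]]]; auto.
    1-3: exists x; rewrite ?Ua, ?Ub; split; auto; lra.
    exists y. split; auto. unfold good.
    replace (P y * U y) with ((- P y) * (- U y)) by ring. apply Rmult_lt_0_compat; auto.
Qed.

(** The minimum of [U] is interior and at most 0, so [q U <= 0 <= ddU] there. *)
Lemma interior_min_le_zero l q U dU ddU P a b x :
  edge_rel l q U dU ddU P -> 0 <= a -> b <= l -> a < x < b ->
  0 < U a -> 0 < U b -> U x = 0 -> exists y, a < y < b /\ P y <= 0.
Proof.
  intros (Hl & H1 & H2 & H3 & H4 & H5) Ha Hb Hx Ua Ub Ux.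
  destruct (continuity_ab_min U a b) as [y [Hy1 Hy2]]; [lra| |].
  { intros c Hc. apply cont_pt. eapply deriv_continuous; apply H1. }
  assert (U y <= U x) by (apply Hy1; lra).
  assert (Hy : a < y < b).
  { destruct (Req_dec y a) as [->|]; [lra|]. destruct (Req_dec y b) as [->|]; lra. }
  exists y. split; auto.
  assert (Hd : - ddU y <= 0).
  { apply (interior_max_second_deriv (fun x => - U x) (fun x => - dU x) a b y); auto.
    - intros; apply deriv_opp; auto.
    - apply deriv_opp; auto.
    - intros z Hz. specialize (Hy1 z Hz). lra. }
  destruct (H4 y ltac:(lra)) as [Hq E].
  assert (q y * (- U y) >= 0) by (apply Rle_ge, Rmult_le_pos; lra). lra.
Qed.

(** If [P] has opposite signs at [a] and [b], this is the intermediate value theorem. If not, then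
    up to a common sign [U] and [P] are positive at both ends, while [P <= 0] at the minimum of
    [U]. *)
Lemma zero_between_good l q U dU ddU P a b x :
  edge_rel l q U dU ddU P -> 0 <= a -> b <= l -> a < x < b ->
  good U P a -> good U P b -> U x = 0 -> exists w, a < w < b /\ P w = 0.
Proof.
  intros HE Ha Hb Hx Ga Gb Ux. unfold good in *.
  assert (HE' := HE). destruct HE' as (_ & _ & _ & H3 & _ & _).
  destruct (Rlt_or_le (P a * P b) 0) as [Hs|Hs].
  - apply ivt_zero; auto; lra.
  - assert (Hsame : forall U' dU' ddU' P', edge_rel l q U' dU' ddU' P' ->
        (forall z, P z = 0 <-> P' z = 0) -> U' x = 0 -> 0 < U' a -> 0 < U' b ->
        0 < P' a -> 0 < P' b -> exists w, a < w < b /\ P w = 0).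
    { intros U' dU' ddU' P' HE' Hz U'x U'a U'b P'a P'b.
      destruct (interior_min_le_zero l q U' dU' ddU' P' a b x) as [y [Hy Py]]; auto.
      destruct (Req_dec (P' y) 0) as [E|E].
      - exists y. split; auto. apply Hz; auto.
      - destruct (ivt_zero P' a y) as [w [Hw Pw]].
        + apply HE'.
        + lra.
        + assert (0 < P' a * (- P' y)) by (apply Rmult_lt_0_compat; lra). lra.
        + exists w. split; [lra|]. apply Hz; auto. }
    assert (Pb0 : P b <> 0) by (intros E; rewrite E in Gb; lra).
    assert (Pa0 : P a <> 0) by (intros E; rewrite E in Ga; lra).
    destruct (Rlt_or_le 0 (P a)) as [Pa|Pa].
    + assert (Pb : 0 < P b) by (assert (0 <= P b) by nra; lra).
      apply (Hsame U dU ddU P); auto; try tauto; nra.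
    + assert (Pa' : P a < 0) by lra. assert (Pb : P b < 0) by (assert (P b <= 0) by nra; lra).
      apply (Hsame _ _ _ _ (edge_rel_opp _ _ _ _ _ _ HE)); try lra; try nra.
      intros z; lra.
Qed.

(* [u], [p] are the values of [U], [P] at an end of the edge and [du] is the derivative of
   [U] pointing into the edge. [endK - 1] is the gain of zeros, from [U] to [P], due to this end. *)
Definition endK (u p du : R) : nat :=
  if Req_EM_T u 0 then
    if Req_EM_T p 0 then 1%nat else if Rle_dec (du * p) 0 then 2%nat else 1%nat
  else if Rlt_dec 0 (p * u) then 1%nat
  else if Rle_dec 0 (du * u) then (if Req_EM_T p 0 then 1%nat else 2%nat) else 0%nat.

Definition left_K (U P dU : R -> R) : nat := endK (U 0) (P 0) (dU 0).
Definition right_K (l : R) (U P dU : R -> R) : nat := endK (U l) (P l) (- dU l).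

Lemma endK_opp u p du : endK (- u) (- p) (- du) = endK u p du.
Proof.
  unfold endK. replace (- du * - p) with (du * p) by ring.
  replace (- p * - u) with (p * u) by ring. replace (- du * - u) with (du * u) by ring.
  destruct (Req_EM_T (- u) 0), (Req_EM_T u 0); try lra;
  destruct (Req_EM_T (- p) 0), (Req_EM_T p 0); try lra; auto.
Qed.

Lemma zero_before l q U dU ddU P y :
  edge_rel l q U dU ddU P -> 0 < y -> P 0 < 0 -> 0 < P y -> nz P 0 y 1.
Proof.
  intros HE Hy P0 Py. assert (HE' := HE). destruct HE' as (_ & _ & _ & H3 & _ & _).
  destruct (ivt_zero P 0 y) as [w [Hw Pw]]; auto.
  - assert (0 < (- P 0) * P y) by (apply Rmult_lt_0_compat; lra). lra.
  - apply (nz_one P 0 y w); auto.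
Qed.

(** The sign conditions give [ddU 0 = q 0 * U 0 - P 0 > 0], so [U] rises from the end even if
    [dU 0 = 0]. *)
Lemma left_end_increasing l q U dU ddU P b :
  edge_rel l q U dU ddU P -> 0 < b -> 0 <= U 0 -> P 0 <= 0 -> (0 < U 0 \/ P 0 < 0) ->
  0 <= dU 0 -> exists x, 0 < x < b /\ U 0 < U x.
Proof.
  intros (Hl & H1 & H2 & H3 & H4 & H5) Hb U0 P0 Hor D0.
  destruct (H4 0 ltac:(lra)) as [Hq E].
  apply (second_deriv_increasing U dU 0 b (ddU 0)); auto.
  intros _. assert (Hq0 : 0 <= q 0 * U 0) by (apply Rmult_le_pos; lra).
  destruct Hor as [H|H]; [|lra].
  assert (0 < q 0 * U 0) by (apply Rmult_lt_0_compat; lra). lra.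
Qed.

Lemma left_end_good_pos l q U dU ddU P x :
  edge_rel l q U dU ddU P -> 0 < x -> x <= l -> U x = 0 ->
  0 <= U 0 -> P 0 <= 0 -> (0 < U 0 \/ P 0 < 0) -> 0 <= dU 0 ->
  exists y, 0 < y < x /\ good U P y /\ (P 0 <> 0 -> nz P 0 y 1).
Proof.
  intros HE Hx Hxl Ux U0 P0 Hor D0.
  destruct (left_end_increasing l q U dU ddU P x) as [z [Hz Uz]]; auto.
  destruct (edge_interior_max l q U dU ddU P 0 x) as [y [Hy [H1 H2]]]; auto; try lra.
  1-3: exists z; split; auto; lra.
  exists y. split; auto. split; [apply Rmult_lt_0_compat; auto|].
  intros Hn. apply (zero_before l q U dU ddU P); auto; lra.
Qed.

(** The good point may be the end itself, when [0 < P 0 * U 0]; hence [0 <= y]. If [endK = 2], then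
    [P 0] has the sign opposite to [P y], which gives the extra zero before [y]. *)
Lemma left_end_good l q U dU ddU P x :
  edge_rel l q U dU ddU P -> 0 < x -> x <= l -> U x = 0 ->
  (1 <= left_K U P dU)%nat ->
  exists y, 0 <= y < x /\ good U P y /\ nz P 0 y (left_K U P dU - 1)%nat.
Proof.
  intros HE Hx Hxl Ux HK.
  (* The case of nonnegative [U 0], to be applied to [(U, P)] or to [(- U, - P)]. *)
  assert (Hone : forall U' dU' ddU' P', edge_rel l q U' dU' ddU' P' ->
    (forall z, good U' P' z -> good U P z) -> (forall a b n, nz P' a b n -> nz P a b n) ->
    U' x = 0 -> 0 <= U' 0 -> P' 0 <= 0 -> (0 < U' 0 \/ P' 0 < 0) -> 0 <= dU' 0 ->
    exists y, 0 <= y < x /\ good U P y /\ (P' 0 <> 0 -> nz P 0 y 1)).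
  { intros U' dU' ddU' P' HE' Hg Hn H1 H2 H3 H4 H5.
    destruct (left_end_good_pos l q U' dU' ddU' P' x) as [y [Hy [Gy Ny]]]; auto.
    exists y. split; [lra|]. split; auto. }
  assert (Hgopp : forall z, good (fun x => - U x) (fun x => - P x) z -> good U P z).
  { intros z. unfold good. intros H. replace (P z * U z) with (- P z * - U z) by ring. auto. }
  assert (Hnopp : forall a b n, nz (fun x => - P x) a b n -> nz P a b n) by (intros; apply nz_opp; auto).
  assert (HEo := edge_rel_opp _ _ _ _ _ _ HE).
  unfold left_K, endK in *. destruct (Req_EM_T (U 0) 0) as [E0|E0].
  - assert (Hb : exists y, 0 <= y < x /\ good U P y /\ nz P 0 y 0).
    { destruct (good_between_zeros l q U dU ddU P 0 x) as [y [Hy Gy]]; auto; try lra.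
      exists y. split; [lra|]. split; simpl; auto. }
    destruct (Req_EM_T (P 0) 0) as [EP|EP]; [exact Hb|].
    destruct (Rle_dec (dU 0 * P 0) 0) as [Hf|Hf]; [|exact Hb].
    destruct (Rlt_or_le (P 0) 0) as [HP|HP].
    + destruct (Hone U dU ddU P) as [y [Hy [Gy Ny]]]; auto; try lra; [nra|].
      exists y. split; auto.
    + destruct (Hone _ _ _ _ HEo) as [y [Hy [Gy Ny]]]; auto; try lra; [nra|].
      exists y. split; auto. split; auto. apply Ny; lra.
  - destruct (Rlt_dec 0 (P 0 * U 0)) as [Hg|Hg].
    + exists 0. split; [lra|]. split; simpl; auto.
    + destruct (Rle_dec 0 (dU 0 * U 0)) as [Hf|Hf]; [|lia].
      assert (HH : exists y, 0 <= y < x /\ good U P y /\ (P 0 <> 0 -> nz P 0 y 1)).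
      { destruct (Rlt_or_le 0 (U 0)) as [HU|HU].
        - apply (Hone U dU ddU P); auto; try lra; nra.
        - destruct (Hone _ _ _ _ HEo) as [y [Hy [Gy Ny]]]; auto; try lra; try nra.
          exists y. split; auto. split; auto. intros Hn; apply Ny; lra. }
      destruct HH as [y [Hy [Gy Ny]]]. exists y. split; auto. split; auto.
      destruct (Req_EM_T (P 0) 0); simpl; auto. apply Ny; auto.
Qed.

Lemma right_end_good l q U dU ddU P x :
  edge_rel l q U dU ddU P -> 0 <= x -> x < l -> U x = 0 ->
  (1 <= right_K l U P dU)%nat ->
  exists y, x < y <= l /\ good U P y /\ nz P y l (right_K l U P dU - 1)%nat.
Proof.
  intros HE Hx Hxl Ux HK.
  destruct (left_end_good l _ _ _ _ _ (l - x) (edge_rel_reflect _ _ _ _ _ _ HE))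
    as [y [Hy [Gy Ny]]]; unfold left_K, right_K in *; cbv beta in *; rewrite ?Rminus_0_r in *; auto; try lra.
  - replace (l - (l - x)) with x by ring; auto.
  - exists (l - y). split; [lra|]. split; [exact Gy|].
    apply (nz_reflect _ l) in Ny. rewrite Rminus_0_r in Ny.
    apply (nz_ext _ P) in Ny; auto.
    intros z _. cbv beta. f_equal; ring.
Qed.

(** The current good point and one found between the next two zeros of [U] enclose a zero of [U],
    hence a zero of [P]. The last zero [x] of [U] is left beyond [y'], to be enclosed together with
    a good point near the right end. *)
Lemma good_chain l q U dU ddU P : edge_rel l q U dU ddU P ->
  forall n y b, 0 <= y -> b <= l -> good U P y -> nz U y b (S n) ->
  exists x y', y <= y' /\ y' < x < b /\ U x = 0 /\ good U P y' /\ nz P y y' n.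
Proof.
  intros HE. induction n as [|n IH]; intros y b Hy Hb Gy [x1 [Hx1 [U1 N1]]].
  - exists x1, y. repeat split; auto; try lra.
  - destruct N1 as [x2 [Hx2 [U2 N2]]].
    destruct (good_between_zeros l q U dU ddU P x1 x2) as [y1 [Hy1 Gy1]]; auto; try lra.
    destruct (zero_between_good l q U dU ddU P y y1 x1) as [w [Hw Pw]]; auto; try lra.
    destruct (IH y1 b) as [x [y' [H1 [H2 [H3 [H4 H5]]]]]]; auto; try lra.
    { exists x2. repeat split; auto; lra. }
    exists x, y'. split; [lra|]. split; auto. split; auto. split; auto.
    exists w. split; [lra|]. split; auto. apply (nz_weaken P n n y1 y'); auto; lra.
Qed.

(** With no zero of [U] inside, there is no interval from the end to a zero to work on. What
    survives of [endK >= 1] is that the end is good or that [U] exceeds its end value somewhere; two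
    ends of the latter kind force an interior maximum. *)
Lemma end_facts_pos l q U dU ddU P :
  edge_rel l q U dU ddU P -> (forall x, 0 < x < l -> 0 < U x) ->
  (1 <= left_K U P dU)%nat ->
  (good U P 0 \/ exists x, 0 < x < l /\ U 0 < U x) /\
  (left_K U P dU = 2%nat -> P 0 < 0) /\ (left_K U P dU <= 2)%nat.
Proof.
  intros HE Hpos HK.
  assert (HE' := HE). destruct HE' as (Hl & H1 & H2 & H3 & H4 & H5).
  assert (HU0 : 0 <= U 0).
  { destruct (Rle_or_lt 0 (U 0)) as [|Hneg]; auto. exfalso.
    destruct (ivt_zero U 0 (l / 2)) as [w [Hw Uw]].
    - intros; eapply deriv_continuous; apply H1.
    - lra.
    - assert (0 < U (l / 2)) by (apply Hpos; lra). nra.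
    - assert (0 < U w) by (apply Hpos; lra). lra. }
  assert (HD : U 0 = 0 -> 0 <= dU 0).
  { intros E0. destruct (Rle_or_lt 0 (dU 0)) as [|Hneg]; auto. exfalso.
    destruct (deriv_neg_right U 0 (dU 0) (H1 0) Hneg) as [e [He Hd]].
    set (m := Rmin e l). assert (m <= e) by apply Rmin_l. assert (m <= l) by apply Rmin_r.
    assert (0 < m) by (apply Rmin_case; lra).
    specialize (Hd (m / 2) ltac:(lra)). assert (0 < U (m / 2)) by (apply Hpos; lra). lra. }
  assert (HP : U 0 = 0 -> dU 0 = 0 -> P 0 <= 0).
  { intros E0 D0. destruct (Rle_or_lt (P 0) 0) as [|Hp]; auto. exfalso.
    destruct (second_deriv_increasing (fun x => - U x) (fun x => - dU x) 0 l (- ddU 0)) as [x [Hx Ux]]; auto; try lra.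
    - intros; apply deriv_opp; auto.
    - apply deriv_opp; auto.
    - intros _. destruct (H4 0 ltac:(lra)) as [_ E]. rewrite E, E0. lra.
    - specialize (Hpos x Hx). lra. }
  unfold left_K, endK in *. destruct (Req_EM_T (U 0) 0) as [E0|E0].
  - split; [|split].
    + right. exists (l / 2). split; [lra|]. rewrite E0. apply Hpos; lra.
    + destruct (Req_EM_T (P 0) 0) as [EP|EP]; [discriminate|].
      destruct (Rle_dec (dU 0 * P 0) 0) as [Hf|Hf]; [|discriminate]. intros _.
      specialize (HD E0). destruct (Req_dec (dU 0) 0) as [ED|ED].
      * specialize (HP E0 ED). lra.
      * assert (0 < dU 0) by lra. nra.
    + destruct (Req_EM_T (P 0) 0); [lia|]. destruct (Rle_dec (dU 0 * P 0) 0); lia.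
  - assert (0 < U 0) by lra. destruct (Rlt_dec 0 (P 0 * U 0)) as [Hg|Hg].
    + split; [left; exact Hg|]. split; [discriminate|lia].
    + destruct (Rle_dec 0 (dU 0 * U 0)) as [Hf|Hf]; [|lia].
      assert (P 0 <= 0) by nra.
      split; [|split].
      * right. apply (left_end_increasing l q U dU ddU P l); auto; nra.
      * destruct (Req_EM_T (P 0) 0); [discriminate|]. intros _; lra.
      * destruct (Req_EM_T (P 0) 0); lia.
Qed.

(** If one [endK] is 0, the number claimed is 0 because both are at most 2 and subtraction is
    truncated. Otherwise [P] is positive somewhere, at a good end or at an interior maximum of [U],
    and each end with [endK = 2] has [P < 0] and so contributes a sign change. *)
Lemma no_zeros_pos l q U dU ddU P :
  edge_rel l q U dU ddU P -> (forall x, 0 < x < l -> 0 < U x) ->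
  nz P 0 l (left_K U P dU + right_K l U P dU - 2)%nat.
Proof.
  intros HE Hpos.
  set (K0 := left_K U P dU). set (K1 := right_K l U P dU).
  assert (HEr := edge_rel_reflect _ _ _ _ _ _ HE).
  assert (F0 := end_facts_pos l q U dU ddU P HE Hpos). fold K0 in F0.
  assert (F1 := end_facts_pos l _ _ _ _ _ HEr). unfold left_K in F1. cbv beta in F1. rewrite !Rminus_0_r in F1.
  fold (right_K l U P dU) in F1. fold K1 in F1. specialize (F1 ltac:(intros; apply Hpos; lra)).
  assert (HK2 : forall u p du, (endK u p du <= 2)%nat).
  { intros. unfold endK. destruct (Req_EM_T u 0), (Req_EM_T p 0), (Rle_dec (du * p) 0),
      (Rlt_dec 0 (p * u)), (Rle_dec 0 (du * u)); lia. }
  assert (B0 := HK2 (U 0) (P 0) (dU 0)). assert (B1 := HK2 (U l) (P l) (- dU l)).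
  change (K0 <= 2)%nat in B0. change (K1 <= 2)%nat in B1.
  destruct (Nat.eq_dec K0 0) as [Z0|Z0]; [replace (K0 + K1 - 2)%nat with 0%nat by lia; exact I|].
  destruct (Nat.eq_dec K1 0) as [Z1|Z1]; [replace (K0 + K1 - 2)%nat with 0%nat by lia; exact I|].
  destruct F0 as [A0 [N0 _]]; [lia|]. destruct F1 as [A1 [N1 _]]; [lia|].
  assert (HE' := HE). destruct HE' as (Hl & H1 & H2 & H3 & H4 & H5).
  assert (Hnn : forall x, 0 <= x <= l -> 0 <= U x).
  { intros x Hx. destruct (Rle_or_lt 0 (U x)) as [|Hneg]; auto. exfalso.
    destruct (Rle_or_lt x (l / 2)).
    - destruct (Req_dec x (l / 2)) as [->|]; [specialize (Hpos (l / 2)); lra|].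
      destruct (ivt_zero U x (l / 2)) as [w [Hw Uw]].
      + intros; eapply deriv_continuous; apply H1.
      + lra.
      + assert (0 < U (l / 2)) by (apply Hpos; lra). nra.
      + assert (0 < U w) by (apply Hpos; lra). lra.
    - destruct (ivt_zero U (l / 2) x) as [w [Hw Uw]].
      + intros; eapply deriv_continuous; apply H1.
      + lra.
      + assert (0 < U (l / 2)) by (apply Hpos; lra). nra.
      + assert (0 < U w) by (apply Hpos; lra). lra. }
  assert (Hy : exists y, 0 <= y <= l /\ 0 < P y).
  { destruct A0 as [G|[x0 [X0 E0]]].
    - exists 0. split; [lra|]. unfold good in G. specialize (Hnn 0 ltac:(lra)). nra.
    - destruct A1 as [G|[x1 [X1 E1]]].
      + exists l. split; [lra|]. unfold good in G. rewrite Rminus_0_r in G.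
        specialize (Hnn l ltac:(lra)). nra.
      + destruct (edge_interior_max l q U dU ddU P 0 l) as [y [Y1 [Y2 Y3]]]; auto; try lra.
        * exists x0; auto.
        * exists (l - x1). split; [lra|]. auto.
        * exists (l / 2). split; [lra|]. apply Hpos; lra.
        * exists y. split; auto; lra. }
  destruct Hy as [y [Hy Py]].
  apply (nz_weaken P ((K0 - 1) + (K1 - 1))%nat _ 0 l); try lra; [lia|].
  apply (nz_cat P (K0 - 1)%nat (K1 - 1)%nat 0 y l); try lra.
  - destruct (Nat.eq_dec K0 2) as [E|E].
    + rewrite E. specialize (N0 E). assert (0 < y) by (destruct (Rle_lt_or_eq_dec 0 y) as [|E1]; try lra; rewrite <- E1 in Py; lra).
      apply (zero_before l q U dU ddU P); auto.
    + replace (K0 - 1)%nat with 0%nat by lia. exact I.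
  - destruct (Nat.eq_dec K1 2) as [E|E].
    + rewrite E. specialize (N1 E). assert (y < l) by (destruct (Rle_lt_or_eq_dec y l) as [|E1]; try lra; rewrite E1 in Py; lra).
      destruct (ivt_zero P y l) as [w [Hw Pw]]; auto; [nra|].
      apply (nz_one P y l w); auto.
    + replace (K1 - 1)%nat with 0%nat by lia. exact I.
Qed.

Lemma no_zeros_edge l q U dU ddU P :
  edge_rel l q U dU ddU P -> (forall x, 0 < x < l -> U x <> 0) ->
  nz P 0 l (left_K U P dU + right_K l U P dU - 2)%nat.
Proof.
  intros HE Hn. assert (HE' := HE). destruct HE' as (Hl & H1 & _).
  assert (Hsame : forall x y, 0 < x -> x < y -> y < l -> 0 < U x * U y).
  { intros x y Hx Hxy Hy. destruct (Rlt_or_le 0 (U x * U y)) as [|Hle]; auto. exfalso.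
    assert (Ux := Hn x ltac:(lra)). assert (Uy := Hn y ltac:(lra)).
    destruct (ivt_zero U x y) as [w [Hw Uw]]; auto.
    - intros; eapply deriv_continuous; apply H1.
    - assert (U x * U y <> 0) by (apply Rmult_integral_contrapositive; auto). lra.
    - apply (Hn w); auto; lra. }
  assert (Hm : U (l / 2) <> 0) by (apply Hn; lra).
  assert (Hs : forall x, 0 < x < l -> 0 < U x * U (l / 2)).
  { intros x Hx. destruct (Rtotal_order x (l / 2)) as [H|[->|H]].
    - apply Hsame; lra.
    - nra.
    - rewrite Rmult_comm. apply Hsame; lra. }
  destruct (Rlt_or_le 0 (U (l / 2))) as [Hp|Hp].
  - apply (no_zeros_pos l q U dU ddU P); auto. intros x Hx. specialize (Hs x Hx). nra.
  - assert (Hp' : U (l / 2) < 0) by lra.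
    apply nz_opp. unfold left_K, right_K. rewrite <- endK_opp, <- (endK_opp (U l)).
    apply (no_zeros_pos l q _ _ _ _ (edge_rel_opp _ _ _ _ _ _ HE)).
    intros x Hx. specialize (Hs x Hx). nra.
Qed.

(** The [n - 1] good points between consecutive zeros of [U] enclose [n - 2] of these zeros and so
    give [n - 2] zeros of [P]. An end with [endK >= 1] provides one more good point, hence one more
    zero, and [endK - 1] zeros beyond that point. *)
Lemma edge_zero_count l q U dU ddU P n :
  edge_rel l q U dU ddU P -> nz U 0 l n ->
  nz P 0 l (n + left_K U P dU + right_K l U P dU - 2)%nat.
Proof.
  intros HE HN. assert (HE' := HE). destruct HE' as (Hl & H1 & _).
  assert (Hpos : forall m, nz U 0 l (S m) ->
    nz P 0 l (S m + left_K U P dU + right_K l U P dU - 2)%nat).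
  { clear n HN. intros m HN.
    assert (HL := left_end_good l q U dU ddU P). assert (HR := right_end_good l q U dU ddU P).
    set (K0 := left_K U P dU) in *. set (K1 := right_K l U P dU) in *.
    assert (Hend : forall y m, 0 <= y -> good U P y -> nz U y l (S m) ->
      nz P y l (m + K1)%nat).
    { intros y m' Hy Gy N.
      destruct (good_chain l q U dU ddU P HE m' y l Hy ltac:(lra) Gy N)
        as [x [y' [Y1 [Y2 [Y3 [Y4 Y5]]]]]].
      destruct (Nat.eq_dec K1 0) as [E|E].
      - rewrite E, Nat.add_0_r. apply (nz_weaken P m' m' y y'); auto; lra.
      - destruct (HR x) as [y2 [Z1 [Z2 Z3]]]; auto; try lra; [lia|].
        destruct (zero_between_good l q U dU ddU P y' y2 x) as [w [Hw Pw]]; auto; try lra.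
        replace (m' + K1)%nat with (m' + (1 + (K1 - 1)))%nat by lia.
        apply (nz_cat P m' _ y y' l); auto; try lra.
        apply (nz_cat P 1 _ y' y2 l); auto; try lra.
        apply (nz_one P y' y2 w); auto. }
    destruct HN as [x1 [X1 [U1 N1]]].
    destruct (Nat.eq_dec K0 0) as [E|E].
    - rewrite E. destruct m as [|m].
      + destruct (Nat.eq_dec K1 0) as [E1|E1]; [rewrite E1; exact I|].
        destruct (HR x1) as [y2 [Z1 [Z2 Z3]]]; auto; try lra; [lia|].
        apply (nz_weaken P (K1 - 1)%nat _ y2 l); auto; try lra; lia.
      + destruct N1 as [x2 [X2 [U2 N2]]].
        destruct (good_between_zeros l q U dU ddU P x1 x2) as [y1 [Hy1 Gy1]]; auto; try lra.
        apply (nz_weaken P (m + K1)%nat _ y1 l); auto; try lra; [lia|].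
        apply Hend; auto; [lra|]. exists x2. repeat split; auto; lra.
    - destruct (HL x1) as [y [Y1 [Y2 Y3]]]; auto; try lra; [lia|].
      apply (nz_weaken P ((K0 - 1) + (m + K1))%nat _ 0 l); auto; try lra; [lia|].
      apply (nz_cat P _ _ 0 y l); auto; try lra.
      apply Hend; auto; [lra|]. exists x1. repeat split; auto; lra. }
  (* [n] is a mere lower bound: for [n = 0] there may still be a zero of [U], and then the count for
     [n = 1] is stronger. *)
  destruct n as [|n]; [|apply Hpos; auto].
  destruct (classic (exists x, 0 < x < l /\ U x = 0)) as [[x [Hx Ux]]|Hno].
  - apply (nz_weaken P (1 + left_K U P dU + right_K l U P dU - 2)%nat _ 0 l); try lra; [lia|].
    apply Hpos. apply (nz_one U 0 l x); auto.
  - simpl. apply (no_zeros_edge l q U dU ddU P); auto.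
    intros x Hx H0. apply Hno. exists x; auto.
Qed.

(** * Functions given on a closed interval, linear second order equations *)

(** The retraction of the line onto [[0, l]]. Composition with it turns continuity within the closed
    interval into continuity on the line. *)
Definition clamp (l x : R) : R := Rmax 0 (Rmin l x).

Lemma clamp_in l x : 0 < l -> 0 <= clamp l x <= l.
Proof. intros. unfold clamp, Rmax, Rmin. destruct (Rle_dec l x), (Rle_dec 0 _); lra. Qed.

Lemma clamp_id l x : 0 <= x <= l -> clamp l x = x.
Proof.
  intros. unfold clamp, Rmax, Rmin. destruct (Rle_dec l x), (Rle_dec 0 _); lra.
Qed.

Lemma clamp_continuous l x : continuous (clamp l) x.
Proof.
  assert (H : forall y, Rabs (clamp l y - clamp l x) <= Rabs (y - x)).
  { intros y. unfold clamp, Rmax, Rmin.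
    destruct (Rle_dec l y), (Rle_dec l x); repeat destruct (Rle_dec 0 _);
      unfold Rabs; repeat destruct Rcase_abs; lra. }
  apply continuity_pt_filterlim. intros e He. exists e. split; auto.
  intros y [_ Hy]. simpl in *. unfold Rdist in *. eapply Rle_lt_trans; [apply H|auto].
Qed.

Lemma clamp_comp_continuous l g : 0 < l ->
  (forall x, 0 <= x <= l -> cont_within l g x) -> forall x, continuous (fun y => g (clamp l y)) x.
Proof.
  intros Hl H x. unfold continuous.
  eapply filterlim_comp; [|apply (H (clamp l x)); apply clamp_in; auto].
  intros P HP. unfold within in HP.
  assert (HP' := clamp_continuous l x _ HP). unfold filtermap in *.
  eapply filter_imp; [|exact HP']. intros y Hy. apply Hy. apply clamp_in; auto.
Qed.

Lemma continuous_cont_within l (g : R -> R) x : continuous g x -> cont_within l g x.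
Proof.
  intros H P HP. specialize (H P HP). unfold filtermap, within in *.
  eapply filter_imp; [|exact H]. auto.
Qed.

Lemma ex_RInt_cont (f : R -> R) a b : (forall x, continuous f x) -> ex_RInt f a b.
Proof. intros; apply (ex_RInt_continuous (V := R_CompleteNormedModule)); auto. Qed.

Lemma deriv_RInt (f : R -> R) a x :
  (forall y, continuous f y) -> is_derive (fun y => RInt f a y) x (f x).
Proof.
  intros Hc. apply (is_derive_RInt f (fun y => RInt f a y) a x); auto.
  apply filter_forall. intros y. apply (RInt_correct f), ex_RInt_cont; auto.
Qed.

Lemma RInt_same (f : R -> R) a : RInt f a a = 0.
Proof. apply (RInt_point a f). Qed.

Lemma RInt_eq (f g : R -> R) a b :
  (forall x, Rmin a b < x < Rmax a b -> f x = g x) -> RInt f a b = RInt g a b.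
Proof. apply (RInt_ext (V := R_CompleteNormedModule)). Qed.

Lemma RInt_linear (f g : R -> R) c a b :
  (forall x, continuous f x) -> (forall x, continuous g x) ->
  RInt (fun x => f x + c * g x) a b = RInt f a b + c * RInt g a b.
Proof.
  intros Hf Hg.
  assert (Hs : RInt (fun x => c * g x) a b = c * RInt g a b)
    by apply (RInt_scal g a b c (ex_RInt_cont g a b Hg)).
  rewrite <- Hs. apply (RInt_plus f (fun x => c * g x)).
  - apply ex_RInt_cont; auto.
  - apply ex_RInt_cont. intros; apply cont_mult; auto. apply cont_const.
Qed.

Lemma constant_of_zero_deriv (f : R -> R) a b :
  a <= b -> (forall x, a <= x <= b -> continuous f x) ->
  (forall x, a < x < b -> is_derive f x 0) -> f a = f b.
Proof.
  intros Hab Hc Hd. apply Rle_antisym.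
  - apply (nondecreasing_except f (fun _ => 0) nil a b); auto. intros; split; [auto|lra].
  - assert (- f a <= - f b); [|lra].
    apply (nondecreasing_except (fun x => - f x) (fun _ => 0) nil a b); auto.
    + intros; apply cont_opp; auto.
    + intros x Hx _. split; [|lra]. replace 0 with (- 0) by ring. apply deriv_opp; auto.
Qed.

(** The extension integrates the derivative, continued by constants; its difference from [g] has
    derivative 0 on the edge. *)
Lemma C1_extend l g dg : 0 < l -> C1_edge l g dg ->
  exists G : R -> R, (forall x, is_derive G x (dg (clamp l x))) /\
    (forall x, 0 <= x <= l -> G x = g x).
Proof.
  intros Hl [Hd Hc].
  assert (Hdg : forall x, continuous (fun y => dg (clamp l y)) x)
    by (apply clamp_comp_continuous; auto; intros; apply Hc; auto).
  assert (Hg : forall x, continuous (fun y => g (clamp l y)) x)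
    by (apply clamp_comp_continuous; auto; intros; apply Hc; auto).
  set (G := fun x => g 0 + RInt (fun y => dg (clamp l y)) 0 x).
  assert (HG : forall x, is_derive G x (dg (clamp l x))).
  { intros x. eapply is_derive_val.
    - apply deriv_plus; [apply deriv_const|].
      apply (deriv_RInt (fun y => dg (clamp l y)) 0 x Hdg).
    - lra. }
  exists G. split; auto. intros x Hx.
  assert (E : G 0 - g (clamp l 0) = G x - g (clamp l x)).
  { apply (constant_of_zero_deriv (fun y => G y - g (clamp l y)) 0 x); [lra| |].
    - intros y _. apply cont_minus; [eapply deriv_continuous; apply HG|apply Hg].
    - intros y Hy. eapply is_derive_val.
      + apply deriv_minus; [apply HG|].
        apply (is_derive_ext_loc g); [|apply Hd; lra].
        eapply filter_imp; [|apply (locally_interval 0 l y); lra].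
        intros z Hz. rewrite clamp_id; auto. lra.
      + rewrite clamp_id by lra. lra. }
  rewrite !clamp_id in E by lra. unfold G at 1 in E. rewrite RInt_same in E. lra.
Qed.

Lemma C2_extend l g dg d2g : 0 < l -> C2_edge l g dg d2g ->
  exists G dG : R -> R, (forall x, is_derive G x (dG x)) /\
    (forall x, is_derive dG x (d2g (clamp l x))) /\
    (forall x, continuous (fun y => d2g (clamp l y)) x) /\
    (forall x, 0 <= x <= l -> G x = g x /\ dG x = dg x).
Proof.
  intros Hl [H1 H2].
  destruct (C1_extend l dg d2g Hl H2) as [D [HD ED]].
  destruct (C1_extend l g D Hl) as [G [HG EG]].
  { split.
    - intros x Hx. rewrite ED by lra. apply H1; auto.
    - intros x Hx. split; [apply H1; auto|].
      apply continuous_cont_within. eapply deriv_continuous; apply HD. }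
  (* [G] has derivative [D o clamp]; integrate [D] itself instead to get a C^2 function *)
  set (G' := fun x => g 0 + RInt D 0 x).
  assert (HDc' : forall x, continuous D x) by (intros; eapply deriv_continuous; apply HD).
  assert (HG' : forall x, is_derive G' x (D x)).
  { intros x. eapply is_derive_val; [apply deriv_plus; [apply deriv_const|apply (deriv_RInt D 0 x HDc')]|].
    lra. }
  exists G', D. split; auto. split; auto. split.
  - apply clamp_comp_continuous; auto. intros; apply H2; auto.
  - intros x Hx. split; [|apply ED; auto].
    rewrite <- EG by auto.
    assert (E : G' 0 - G 0 = G' x - G x).
    { apply (constant_of_zero_deriv (fun y => G' y - G y) 0 x); [lra| |].
      - intros. apply cont_minus; eapply deriv_continuous; [apply HG'|apply HG].
      - intros y Hy. eapply is_derive_val; [apply deriv_minus; [apply HG'|apply HG]|].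
        rewrite clamp_id by lra. lra. }
    unfold G' at 1 in E. rewrite RInt_same, (EG 0) in E by lra. lra.
Qed.

Lemma unif_limit_continuous (w : nat -> R -> R) (u : R -> R) (r : nat -> R) :
  (forall n x, continuous (w n) x) -> (forall n x, Rabs (u x - w n x) <= r n) ->
  is_lim_seq r 0 -> forall x, continuous u x.
Proof.
  intros Hw Hu Hr x. apply continuity_pt_filterlim. intros e He.
  apply is_lim_seq_spec in Hr. destruct (Hr (mkposreal (e / 3) ltac:(lra))) as [N HN].
  specialize (HN N ltac:(lia)). simpl in HN. rewrite Rminus_0_r in HN.
  assert (HN' : r N < e / 3) by (eapply Rle_lt_trans; [apply Rle_abs|exact HN]).
  assert (Hc := cont_pt _ _ (Hw N x)). destruct (Hc (e / 3)) as [d [Hd H]]; [lra|].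
  exists d. split; auto. intros y Hy. specialize (H y Hy). simpl in *. unfold Rdist in *.
  assert (A1 := Hu N x). assert (A2 := Hu N y).
  replace (u y - u x) with ((u y - w N y) + (w N y - w N x) - (u x - w N x)) by ring.
  unfold Rabs in *; repeat destruct Rcase_abs; lra.
Qed.

Lemma cont_bounded (f : R -> R) a b :
  a <= b -> (forall x, continuous f x) ->
  exists K, 0 < K /\ forall x, a <= x <= b -> Rabs (f x) <= K.
Proof.
  intros Hab Hc.
  destruct (continuity_ab_maj (fun x => Rabs (f x)) a b Hab) as [m [Hm _]].
  { intros c _. apply (continuity_pt_comp f Rabs); [apply cont_pt, Hc|apply Rcontinuity_abs]. }
  exists (Rabs (f m) + 1). split; [assert (H := Rabs_pos (f m)); lra|].
  intros x Hx. specialize (Hm x Hx). lra.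
Qed.

Lemma geometric_lim C : is_lim_seq (fun n => C * (/ 2) ^ n) 0.
Proof.
  replace (Finite 0) with (Rbar_mult C 0) by (simpl; f_equal; ring).
  apply is_lim_seq_scal_l, is_lim_seq_geom. rewrite Rabs_right; lra.
Qed.

(** The factor 2 is the sum of the geometric series of ratio 1/2. *)
Lemma geometric_cauchy_limit (w : nat -> R) C :
  (forall n, Rabs (w (S n) - w n) <= C * (/ 2) ^ n) ->
  exists u, forall n, Rabs (u - w n) <= 2 * C * (/ 2) ^ n.
Proof.
  intros H.
  assert (Hp : forall p n, Rabs (w (n + p)%nat - w n) <= 2 * C * (/ 2) ^ n * (1 - (/ 2) ^ p)).
  { induction p as [|p IH]; intros n.
    - rewrite Nat.add_0_r, Rminus_diag, Rabs_R0. simpl. lra.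
    - replace (w (n + S p)%nat - w n)
        with ((w (S (n + p)) - w (n + p)%nat) + (w (n + p)%nat - w n))
        by (rewrite <- plus_n_Sm; ring).
      eapply Rle_trans; [apply Rabs_triang|].
      specialize (H (n + p)%nat). specialize (IH n). rewrite pow_add in H.
      simpl. set (a := (/ 2) ^ n) in *. set (b := (/ 2) ^ p) in *. nra. }
  assert (C0 : 0 <= C).
  { specialize (H 0%nat). simpl in H. assert (X := Rabs_pos (w 1%nat - w 0%nat)). lra. }
  assert (Hp' : forall p n, Rabs (w (n + p)%nat - w n) <= 2 * C * (/ 2) ^ n).
  { intros p n. eapply Rle_trans; [apply Hp|].
    assert (0 < (/ 2) ^ n) by (apply pow_lt; lra). assert (0 < (/ 2) ^ p) by (apply pow_lt; lra).
    assert (0 <= 2 * C * (/ 2) ^ n) by (apply Rmult_le_pos; lra). nra. }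
  assert (Hl : ex_finite_lim_seq w).
  { apply ex_lim_seq_cauchy_corr. intros e.
    assert (G := geometric_lim (2 * C)). apply is_lim_seq_spec in G.
    destruct (G (mkposreal (e / 2) ltac:(destruct e; simpl; lra))) as [N HN].
    specialize (HN N ltac:(lia)). simpl in HN. rewrite Rminus_0_r in HN.
    assert (HN' : 2 * C * (/ 2) ^ N < e / 2) by (eapply Rle_lt_trans; [apply Rle_abs|exact HN]).
    exists N. intros n m Hn Hm.
    assert (A1 := Hp' (n - N)%nat N). assert (A2 := Hp' (m - N)%nat N).
    replace (N + (n - N))%nat with n in A1 by lia. replace (N + (m - N))%nat with m in A2 by lia.
    unfold Rabs in *; repeat destruct Rcase_abs; lra. }
  destruct Hl as [u Hu]. exists u. intros n.
  assert (Hs : is_lim_seq (fun p => w (n + p)%nat) u).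
  { apply is_lim_seq_ext with (fun p => w (p + n)%nat); [intros; f_equal; lia|].
    apply (is_lim_seq_incr_n w n). auto. }
  assert (U1 : Rbar_le u (w n + 2 * C * (/ 2) ^ n)).
  { apply (is_lim_seq_le (fun p => w (n + p)%nat) (fun _ => w n + 2 * C * (/ 2) ^ n)); auto.
    - intros p. assert (A := Hp' p n). unfold Rabs in A; destruct Rcase_abs; lra.
    - apply is_lim_seq_const. }
  assert (U2 : Rbar_le (w n - 2 * C * (/ 2) ^ n) u).
  { apply (is_lim_seq_le (fun _ => w n - 2 * C * (/ 2) ^ n) (fun p => w (n + p)%nat)); auto.
    - intros p. assert (A := Hp' p n). unfold Rabs in A; destruct Rcase_abs; lra.
    - apply is_lim_seq_const. }
  simpl in U1, U2. unfold Rabs; destruct Rcase_abs; lra.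
Qed.

Definition smooth2 (u du ddu : R -> R) : Prop :=
  (forall x, is_derive u x (du x)) /\ (forall x, is_derive du x (ddu x)) /\
  (forall x, continuous ddu x).

(* Picard iteration; the weight exp(kappa x) makes the iteration map a contraction. *)
Lemma ode_exists (q : R -> R) l a b : 0 < l -> (forall x, continuous q x) ->
  exists u du ddu : R -> R, smooth2 u du ddu /\ u 0 = a /\ du 0 = b /\
    forall x, 0 <= x <= l -> ddu x = q x * u x.
Proof.
  intros Hl Hq.
  destruct (cont_bounded q 0 l) as [K [HK Hb]]; auto; [lra|].
  set (J := (fun (f : R -> R) (x : R) => RInt (fun s => RInt (fun t => q t * f t) 0 s) 0 x) : (R -> R) -> R -> R).
  assert (Hqc : forall f, (forall x, continuous f x) -> forall x, continuous (fun t => q t * f t) x)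
    by (intros; apply cont_mult; auto).
  assert (HI : forall f, (forall x, continuous f x) ->
     forall x, continuous (fun s => RInt (fun t => q t * f t) 0 s) x).
  { intros f Hf x. eapply deriv_continuous. apply (deriv_RInt (fun t => q t * f t)); auto. }
  assert (HJ : forall f, (forall x, continuous f x) -> forall x, continuous (J f) x).
  { intros f Hf x. eapply deriv_continuous.
    apply (deriv_RInt (fun s => RInt (fun t => q t * f t) 0 s)). auto. }
  assert (HJlin : forall f g, (forall x, continuous f x) -> (forall x, continuous g x) ->
     forall x, J f x - J g x = J (fun y => f y - g y) x).
  { intros f g Hf Hg x. unfold J.
    replace (RInt (fun s => RInt (fun t => q t * f t) 0 s) 0 x -
             RInt (fun s => RInt (fun t => q t * g t) 0 s) 0 x)
      with (RInt (fun s => RInt (fun t => q t * f t) 0 s) 0 x + (-1) *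
             RInt (fun s => RInt (fun t => q t * g t) 0 s) 0 x) by ring.
    rewrite <- RInt_linear by (intros; apply HI; auto).
    apply RInt_eq. intros s _. rewrite <- RInt_linear by (intros; apply Hqc; auto).
    apply RInt_eq. intros t _. cbv beta. change (q t * f t + -1 * (q t * g t) = q t * (f t - g t)). ring. }
  (* Each of the two integrations in [J] gains a factor [/ kap] on functions bounded by a multiple
     of [exp (kap * x)], and [K <= kap^2 / 2]; hence [J] halves the weighted bound. *)
  set (kap := 2 * K + 2).
  assert (Hexp : forall c x, is_derive (fun y => c * exp (kap * y)) x (c * kap * exp (kap * x))).
  { intros c x. (eapply is_derive_val; [auto_derive; [auto|reflexivity]|ring]). }
  assert (Hdom : forall (f : R -> R) A x, (forall y, continuous f y) -> 0 <= A -> 0 <= x ->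
     (forall y, 0 <= y <= x -> Rabs (f y) <= A * kap * exp (kap * y)) ->
     Rabs (RInt f 0 x) <= A * exp (kap * x)).
  { intros f A x Hf HA Hx Hy.
    assert (Hm : forall s, s = 1 \/ s = -1 -> s * RInt f 0 x <= A * exp (kap * x)).
    { intros s Hs.
      assert (X : A * exp (kap * 0) - s * RInt f 0 0 <= A * exp (kap * x) - s * RInt f 0 x).
      { apply (nondecreasing_of_deriv (fun y => A * exp (kap * y) - s * RInt f 0 y)
                 (fun y => A * kap * exp (kap * y) - s * f y)); auto.
        - intros y. apply deriv_minus; [apply Hexp|]. apply deriv_scal, deriv_RInt; auto.
        - intros y Hy'. specialize (Hy y ltac:(lra)).
          unfold Rabs in Hy. destruct Rcase_abs, Hs as [->| ->]; lra. }
      rewrite RInt_same, Rmult_0_r, exp_0 in X. lra. }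
    assert (M1 := Hm 1 (or_introl eq_refl)). assert (M2 := Hm (-1) (or_intror eq_refl)).
    unfold Rabs; destruct Rcase_abs; lra. }
  assert (HJb : forall f A, (forall y, continuous f y) -> 0 <= A ->
     (forall y, 0 <= y <= l -> Rabs (f y) <= A * exp (kap * y)) ->
     forall x, 0 <= x <= l -> Rabs (J f x) <= A / 2 * exp (kap * x)).
  { intros f A Hf HA Hy x Hx. unfold J. apply Hdom; try lra; [apply HI; auto|].
    intros s Hs. replace (A / 2 * kap) with (A * (kap / 2)) by field.
    eapply Rle_trans.
    - apply (Hdom (fun t => q t * f t) (A * K / kap) s); auto; try lra.
      + apply Rmult_le_pos; [apply Rmult_le_pos; lra|]. apply Rlt_le, Rinv_0_lt_compat.
        unfold kap; lra.
      + intros t Ht. rewrite Rabs_mult.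
        replace (A * K / kap * kap * exp (kap * t)) with (K * (A * exp (kap * t)))
          by (field; unfold kap; lra).
        apply Rmult_le_compat; try apply Rabs_pos; [apply Hb; lra|apply Hy; lra].
    - assert (0 < exp (kap * s)) by apply exp_pos.
      apply Rmult_le_compat_r; [lra|].
      apply Rmult_le_reg_r with kap; [unfold kap; lra|].
      replace (A * K / kap * kap) with (A * K) by (field; unfold kap; lra).
      assert (K <= kap / 2 * kap) by (unfold kap; nra).
      replace (A * (kap / 2) * kap) with (A * (kap / 2 * kap)) by ring.
      apply Rmult_le_compat_l; auto. }
  set (t0 := fun x => a + b * x).
  assert (Ht0d : forall x, is_derive t0 x b).
  { intros x. unfold t0. (eapply is_derive_val; [auto_derive; [auto|reflexivity]|ring]). }
  assert (Ht0 : forall x, continuous t0 x) by (intros; eapply deriv_continuous; apply Ht0d).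
  set (w := fix w n := match n with O => t0 | S n => fun x => t0 x + J (w n) x end).
  assert (Hw : forall n x, continuous (w n) x).
  { induction n; intros x; simpl; auto. apply cont_plus; auto. }
  destruct (cont_bounded (J t0) 0 l) as [A [HA HAb]]; auto; [lra|].
  assert (Hdiff : forall n x, 0 <= x <= l ->
     Rabs (w (S n) x - w n x) <= A * (/ 2) ^ n * exp (kap * x)).
  { induction n as [|n IH]; intros x Hx.
    - simpl. replace (t0 x + J t0 x - t0 x) with (J t0 x) by ring.
      eapply Rle_trans; [apply HAb; auto|].
      assert (1 <= exp (kap * x)).
      { rewrite <- exp_0. destruct (Req_dec (kap * x) 0) as [->|]; [lra|].
        apply Rlt_le, exp_increasing. assert (0 <= kap * x) by (apply Rmult_le_pos; unfold kap; lra). lra. }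
      nra.
    - replace (w (S (S n)) x - w (S n) x) with (J (fun y => w (S n) y - w n y) x).
      2:{ rewrite <- HJlin by (intros; apply Hw). simpl. ring. }
      replace (A * (/ 2) ^ S n * exp (kap * x)) with (A * (/ 2) ^ n / 2 * exp (kap * x))
        by (simpl; field).
      apply HJb; auto.
      + intros; apply cont_minus; apply Hw.
      + apply Rmult_le_pos; [lra|]. apply Rlt_le, pow_lt; lra. }
  set (C := A * exp (kap * l)).
  assert (HdiffC : forall n x, 0 <= x <= l -> Rabs (w (S n) x - w n x) <= C * (/ 2) ^ n).
  { intros n x Hx. eapply Rle_trans; [apply Hdiff; auto|].
    replace (C * (/ 2) ^ n) with (A * (/ 2) ^ n * exp (kap * l)) by (unfold C; ring).
    apply Rmult_le_compat_l; [apply Rmult_le_pos; [lra|]; apply Rlt_le, pow_lt; lra|].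
    destruct (Req_dec x l) as [->|]; [lra|]. apply Rlt_le, exp_increasing.
    apply Rmult_lt_compat_l; [unfold kap; lra|lra]. }
  (* With [clamp] the convergence is uniform on the whole line, so the limit is continuous
     everywhere. *)
  assert (Hlim : forall x, exists u, forall n, Rabs (u - w n (clamp l x)) <= 2 * C * (/ 2) ^ n).
  { intros x. apply geometric_cauchy_limit. intros n. apply HdiffC, clamp_in; auto. }
  set (u := fun x => proj1_sig (constructive_indefinite_description _ (Hlim x))).
  assert (Hu : forall n x, Rabs (u x - w n (clamp l x)) <= 2 * C * (/ 2) ^ n).
  { intros n x. unfold u. destruct (constructive_indefinite_description _ (Hlim x)); simpl; auto. }
  assert (Huc : forall x, continuous u x).
  { apply (unif_limit_continuous (fun n x => w n (clamp l x)) u (fun n => 2 * C * (/ 2) ^ n)); auto.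
    - intros n x. apply (continuous_comp (clamp l) (w n)); [apply clamp_continuous|apply Hw].
    - apply geometric_lim. }
  assert (Hfix : forall x, 0 <= x <= l -> u x = t0 x + J u x).
  { intros x Hx.
    assert (Hn : forall n, Rabs (u x - (t0 x + J u x)) <= (2 * C + 2 * C * exp (kap * l)) * (/ 2) ^ n).
    { intros n.
      assert (A1 := Hu (S n) x). rewrite clamp_id in A1 by auto. simpl in A1.
      assert (A2 : Rabs (J (fun y => u y - w n y) x) <= 2 * C * (/ 2) ^ n / 2 * exp (kap * x)).
      { assert (P0 : 0 <= 2 * C * (/ 2) ^ n).
        { apply Rmult_le_pos; [|apply Rlt_le, pow_lt; lra].
          assert (0 < C) by (apply Rmult_lt_0_compat; [lra|apply exp_pos]). lra. }
        apply HJb; auto.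
        - intros; apply cont_minus; auto.
        - intros y Hy. assert (A3 := Hu n y). rewrite clamp_id in A3 by auto.
          eapply Rle_trans; [exact A3|].
          assert (1 <= exp (kap * y)).
          { rewrite <- exp_0. destruct (Req_dec (kap * y) 0) as [->|]; [lra|].
            apply Rlt_le, exp_increasing. assert (0 <= kap * y) by (apply Rmult_le_pos; unfold kap; lra). lra. }
          nra. }
      rewrite <- HJlin in A2 by (auto; intros; apply Hw).
      assert (0 < (/ 2) ^ n) by (apply pow_lt; lra).
      assert (0 < C) by (apply Rmult_lt_0_compat; [lra|apply exp_pos]).
      assert (P2 : exp (kap * x) <= exp (kap * l)).
      { destruct (Req_dec x l) as [->|]; [lra|]. apply Rlt_le, exp_increasing.
        apply Rmult_lt_compat_l; [unfold kap; lra|lra]. }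
      assert (0 < exp (kap * x)) by apply exp_pos.
      assert (0 < C * (/ 2) ^ n) by (apply Rmult_lt_0_compat; auto).
      replace (u x - (t0 x + J u x))
        with ((u x - (t0 x + J (w n) x)) - (J u x - J (w n) x)) by ring.
      assert (2 * C * (/ 2 * (/ 2) ^ n) = C * (/ 2) ^ n) by field.
      assert (2 * C * (/ 2) ^ n / 2 * exp (kap * x) <= C * (/ 2) ^ n * exp (kap * l)) by nra.
      replace ((2 * C + 2 * C * exp (kap * l)) * (/ 2) ^ n)
        with (2 * (C * (/ 2) ^ n) + 2 * (C * (/ 2) ^ n * exp (kap * l))) by ring.
      assert (0 < C * (/ 2) ^ n * exp (kap * l)) by (apply Rmult_lt_0_compat; [auto|apply exp_pos]).
      unfold Rabs in *; repeat destruct Rcase_abs; lra. }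
    assert (HL : Rbar_le (Rabs (u x - (t0 x + J u x))) 0).
    { apply (is_lim_seq_le (fun _ => Rabs (u x - (t0 x + J u x)))
        (fun n => (2 * C + 2 * C * exp (kap * l)) * (/ 2) ^ n)); auto.
      - apply is_lim_seq_const.
      - apply geometric_lim. }
    simpl in HL. assert (X := Rabs_pos (u x - (t0 x + J u x))).
    assert (E : Rabs (u x - (t0 x + J u x)) = 0) by lra.
    apply Rabs_eq_0 in E. lra. }
  (* [u] itself is only known to be continuous; [t0 + J u] agrees with it on [[0, l]] and is twice
     differentiable on the line. *)
  exists (fun x => t0 x + J u x), (fun x => b + RInt (fun t => q t * u t) 0 x), (fun x => q x * u x).
  split; [split; [|split]|split; [|split]].
  - intros x. apply deriv_plus; auto.
    apply (deriv_RInt (fun s => RInt (fun t => q t * u t) 0 s)). apply HI; auto.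
  - intros x. eapply is_derive_val; [apply deriv_plus; [apply deriv_const|]|].
    + apply (deriv_RInt (fun t => q t * u t)). apply Hqc; auto.
    + cbv beta; lra.
  - apply Hqc; auto.
  - unfold J, t0. rewrite RInt_same. lra.
  - rewrite RInt_same. lra.
  - intros x Hx. rewrite <- Hfix by auto. reflexivity.
Qed.

(** Gronwall's argument for [E = u^2 + du^2], which satisfies [|E'| <= (1 + K) E]: multiplied by
    [exp (- (1 + K) x)] it is nonincreasing, by [exp ((1 + K) x)] nondecreasing, which settles both
    sides of [x0]. *)
Lemma ode_zero_unique (q u du ddu : R -> R) l x0 :
  0 < l -> (forall x, continuous q x) -> smooth2 u du ddu ->
  (forall x, 0 <= x <= l -> ddu x = q x * u x) ->
  0 <= x0 <= l -> u x0 = 0 -> du x0 = 0 -> forall x, 0 <= x <= l -> u x = 0.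
Proof.
  intros Hl Hq (H1 & H2 & H3) He Hx0 U0 D0 x Hx.
  destruct (cont_bounded q 0 l) as [K [HK Hb]]; auto; [lra|].
  set (E := fun y => u y * u y + du y * du y).
  set (dE := fun y => 2 * u y * du y + 2 * du y * ddu y).
  assert (HE : forall y, is_derive E y (dE y)).
  { intros y. eapply is_derive_val; [apply deriv_plus; apply deriv_mult; auto|].
    unfold dE; ring. }
  assert (HB : forall y, 0 <= y <= l -> Rabs (dE y) <= (1 + K) * E y).
  { intros y Hy. unfold dE, E. rewrite He by auto. specialize (Hb y Hy).
    replace (2 * u y * du y + 2 * du y * (q y * u y)) with ((1 + q y) * (2 * u y * du y)) by ring.
    rewrite Rabs_mult. apply Rmult_le_compat; try apply Rabs_pos.
    - eapply Rle_trans; [apply Rabs_triang|]. rewrite Rabs_R1. lra.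
    - assert (0 <= (u y - du y) * (u y - du y)) by apply Rle_0_sqr.
      assert (0 <= (u y + du y) * (u y + du y)) by apply Rle_0_sqr.
      unfold Rabs; destruct Rcase_abs; lra. }
  assert (Hmain : E x = 0).
  { assert (HE0 : E x0 = 0) by (unfold E; rewrite U0, D0; ring).
    assert (Hpos : 0 <= E x) by (unfold E; assert (A := Rle_0_sqr (u x)); assert (B := Rle_0_sqr (du x)); unfold Rsqr in *; lra).
    assert (Hder : forall s y, is_derive (fun z => E z * exp (s * z)) y
              ((dE y + s * E y) * exp (s * y))).
    { intros s y.
      assert (X : is_derive (fun z => exp (s * z)) y (s * exp (s * y)))
        by (eapply is_derive_val; [auto_derive; [auto|reflexivity]|ring]).
      eapply is_derive_val; [apply deriv_mult; [apply HE|exact X]|cbv beta; ring]. }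
    destruct (Rle_or_lt x0 x) as [Hle|Hlt].
    - assert (X : - (E x0 * exp (- (1 + K) * x0)) <= - (E x * exp (- (1 + K) * x))).
      { apply (nondecreasing_of_deriv (fun z => - (E z * exp (- (1 + K) * z)))
                 (fun y => - ((dE y + - (1 + K) * E y) * exp (- (1 + K) * y)))); auto.
        - intros. apply deriv_opp, Hder.
        - intros y Hy. specialize (HB y ltac:(lra)).
          assert (0 < exp (- (1 + K) * y)) by apply exp_pos.
          assert (dE y + - (1 + K) * E y <= 0) by (unfold Rabs in HB; destruct Rcase_abs; lra). nra. }
      rewrite HE0 in X. assert (0 < exp (- (1 + K) * x)) by apply exp_pos. nra.
    - assert (X : E x * exp ((1 + K) * x) <= E x0 * exp ((1 + K) * x0)).
      { apply (nondecreasing_of_deriv (fun z => E z * exp ((1 + K) * z))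
                 (fun y => (dE y + (1 + K) * E y) * exp ((1 + K) * y))); auto; try lra.
        intros y Hy. specialize (HB y ltac:(lra)).
        assert (0 < exp ((1 + K) * y)) by apply exp_pos.
        assert (0 <= dE y + (1 + K) * E y) by (unfold Rabs in HB; destruct Rcase_abs; lra). nra. }
      rewrite HE0 in X. assert (0 < exp ((1 + K) * x)) by apply exp_pos. nra. }
  unfold E in Hmain. assert (A := Rle_0_sqr (u x)). assert (B := Rle_0_sqr (du x)). unfold Rsqr in *.
  assert (Z : u x * u x = 0) by lra. apply Rmult_integral in Z. tauto.
Qed.

(* Variation of constants: the bound on [z] is what makes resolvents bounded. *)
Lemma ode_solver (q : R -> R) l : 0 < l -> (forall x, continuous q x) ->
  exists c dc ddc s ds dds : R -> R, exists K : R,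
    smooth2 c dc ddc /\ smooth2 s ds dds /\
    c 0 = 1 /\ dc 0 = 0 /\ s 0 = 0 /\ ds 0 = 1 /\
    (forall x, 0 <= x <= l -> ddc x = q x * c x /\ dds x = q x * s x) /\ 0 <= K /\
    (forall phi : R -> R, (forall x, continuous phi x) ->
      exists z dz ddz : R -> R, smooth2 z dz ddz /\ z 0 = 0 /\ dz 0 = 0 /\
        (forall x, 0 <= x <= l -> ddz x = q x * z x + phi x) /\
        (forall x, 0 <= x <= l ->
           Rabs (z x) <= K * RInt (fun t => Rabs (phi t)) 0 l /\
           Rabs (dz x) <= K * RInt (fun t => Rabs (phi t)) 0 l)).
Proof.
  intros Hl Hq.
  destruct (ode_exists q l 1 0 Hl Hq) as (c & dc & ddc & Sc & c0 & dc0 & Ec).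
  destruct (ode_exists q l 0 1 Hl Hq) as (s & ds & dds & Ss & s0 & ds0 & Es).
  assert (Sc' := Sc). assert (Ss' := Ss).
  destruct Sc' as (C1 & C2 & C3). destruct Ss' as (S1 & S2 & S3).
  assert (cc : forall x, continuous c x) by (intros; eapply deriv_continuous; apply C1).
  assert (cdc : forall x, continuous dc x) by (intros; eapply deriv_continuous; apply C2).
  assert (cs : forall x, continuous s x) by (intros; eapply deriv_continuous; apply S1).
  assert (cds : forall x, continuous ds x) by (intros; eapply deriv_continuous; apply S2).
  destruct (cont_bounded c 0 l) as [B1 [P1 Q1]]; auto; [lra|].
  destruct (cont_bounded s 0 l) as [B2 [P2 Q2]]; auto; [lra|].
  destruct (cont_bounded dc 0 l) as [B3 [P3 Q3]]; auto; [lra|].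
  destruct (cont_bounded ds 0 l) as [B4 [P4 Q4]]; auto; [lra|].
  set (B := B1 + B2 + B3 + B4).
  exists c, dc, ddc, s, ds, dds, (2 * B * B).
  do 6 (split; auto). split; [intros; split; auto|].
  split; [unfold B; nra|].
  intros phi Hphi.
  set (p := fun x => RInt (fun t => c t * phi t) 0 x).
  set (r := fun x => RInt (fun t => s t * phi t) 0 x).
  assert (Hp : forall x, is_derive p x (c x * phi x))
    by (intros; apply (deriv_RInt (fun t => c t * phi t)); intros; apply cont_mult; auto).
  assert (Hr : forall x, is_derive r x (s x * phi x))
    by (intros; apply (deriv_RInt (fun t => s t * phi t)); intros; apply cont_mult; auto).
  assert (cp : forall x, continuous p x) by (intros; eapply deriv_continuous; apply Hp).
  assert (cr : forall x, continuous r x) by (intros; eapply deriv_continuous; apply Hr).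
  assert (HW : forall x, 0 <= x <= l -> c x * ds x - dc x * s x = 1).
  { intros x Hx.
    assert (E : c 0 * ds 0 - dc 0 * s 0 = c x * ds x - dc x * s x).
    { apply (constant_of_zero_deriv (fun y => c y * ds y - dc y * s y) 0 x); [lra| |].
      - intros; apply cont_minus; apply cont_mult; auto.
      - intros y Hy. eapply is_derive_val.
        + apply deriv_minus; apply deriv_mult; auto.
        + rewrite Ec, Es by lra. ring. }
    rewrite c0, ds0, dc0, s0 in E. lra. }
  assert (cabs : forall x, continuous (fun t => Rabs (phi t)) x).
  { intros x. apply (continuous_comp phi Rabs); auto. apply (continuous_Rabs (phi x)). }
  set (N := RInt (fun t => Rabs (phi t)) 0 l).
  assert (Hbd : forall (g : R -> R) Bg, (forall x, continuous g x) -> 0 <= Bg ->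
     (forall x, 0 <= x <= l -> Rabs (g x) <= Bg) -> forall x, 0 <= x <= l ->
     Rabs (RInt (fun t => g t * phi t) 0 x) <= Bg * N).
  { intros g Bg Hg HBg Hgb x Hx.
    assert (Hm : forall e, e = 1 \/ e = -1 -> e * RInt (fun t => g t * phi t) 0 x <= Bg * RInt (fun t => Rabs (phi t)) 0 x).
    { intros e Hee.
      assert (X : Bg * RInt (fun t => Rabs (phi t)) 0 0 - e * RInt (fun t => g t * phi t) 0 0
        <= Bg * RInt (fun t => Rabs (phi t)) 0 x - e * RInt (fun t => g t * phi t) 0 x).
      { apply (nondecreasing_of_deriv (fun y => Bg * RInt (fun t => Rabs (phi t)) 0 y - e * RInt (fun t => g t * phi t) 0 y)
           (fun y => Bg * Rabs (phi y) - e * (g y * phi y))); [lra| |].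
        - intros y. apply deriv_minus; apply deriv_scal.
          + apply (deriv_RInt (fun t => Rabs (phi t))); auto.
          + apply (deriv_RInt (fun t => g t * phi t)). intros; apply cont_mult; auto.
        - intros y Hy. assert (Rabs (g y * phi y) <= Bg * Rabs (phi y)).
          { rewrite Rabs_mult. apply Rmult_le_compat_r; [apply Rabs_pos|apply Hgb; lra]. }
          destruct Hee as [->| ->]; unfold Rabs in *; repeat destruct Rcase_abs; lra. }
      rewrite !RInt_same in X. lra. }
    assert (Hmono : RInt (fun t => Rabs (phi t)) 0 x <= N).
    { apply (nondecreasing_of_deriv (fun y => RInt (fun t => Rabs (phi t)) 0 y) (fun y => Rabs (phi y))); [lra| |].
      - intros y. apply (deriv_RInt (fun t => Rabs (phi t))); auto.
      - intros; apply Rabs_pos. }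
    assert (M1 := Hm 1 (or_introl eq_refl)). assert (M2 := Hm (-1) (or_intror eq_refl)).
    assert (Bg * RInt (fun t => Rabs (phi t)) 0 x <= Bg * N) by (apply Rmult_le_compat_l; auto).
    unfold Rabs at 1; destruct Rcase_abs; lra. }
  assert (HN : 0 <= N).
  { unfold N. apply RInt_ge_0; [lra|apply ex_RInt_cont; auto|intros; apply Rabs_pos]. }
  (* The Wronskian is kept as a factor of [phi] in the second derivative: it is known to be 1 on
     [[0, l]] only, whereas the derivative is required on the whole line. *)
  exists (fun x => s x * p x - c x * r x), (fun x => ds x * p x - dc x * r x),
    (fun x => dds x * p x - ddc x * r x + (c x * ds x - dc x * s x) * phi x).
  split; [split; [|split]|split; [|split; [|split]]].
  - intros x. eapply is_derive_val; [apply deriv_minus; apply deriv_mult; auto|]. ring.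
  - intros x. eapply is_derive_val; [apply deriv_minus; apply deriv_mult; auto|]. ring.
  - intros x. apply cont_plus; [apply cont_minus; apply cont_mult; auto|].
    apply cont_mult; auto. apply cont_minus; apply cont_mult; auto.
  - unfold p, r. rewrite !RInt_same. ring.
  - unfold p, r. rewrite !RInt_same. ring.
  - intros x Hx. rewrite HW, Ec, Es by auto. ring.
  - intros x Hx.
    assert (Rp : Rabs (p x) <= B1 * N) by (apply Hbd; auto; lra).
    assert (Rr : Rabs (r x) <= B2 * N) by (apply Hbd; auto; lra).
    assert (T : forall u1 u2 M1 M2 : R, Rabs u1 <= M1 -> Rabs u2 <= M2 ->
       Rabs (u1 * p x - u2 * r x) <= M1 * (B1 * N) + M2 * (B2 * N)).
    { intros u1 u2 M1 M2 h1 h2. unfold Rminus. eapply Rle_trans; [apply Rabs_triang|].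
      rewrite Rabs_Ropp, !Rabs_mult.
      apply Rplus_le_compat; apply Rmult_le_compat; auto; apply Rabs_pos. }
    split; (eapply Rle_trans; [apply T; [first [apply Q2|apply Q4]|first [apply Q1|apply Q3]]; auto|]).
    + replace (B2 * (B1 * N) + B1 * (B2 * N)) with ((2 * B1 * B2) * N) by ring.
      apply Rmult_le_compat_r; auto. unfold B; nra.
    + replace (B4 * (B1 * N) + B3 * (B2 * N)) with ((B4 * B1 + B3 * B2) * N) by ring.
      apply Rmult_le_compat_r; auto. unfold B; nra.
Qed.

(** * Stability of zeros, exponential sums, Picone-type inequalities *)

Lemma nz_transfer (h h' : R -> R) (d l : R) : 0 < d ->
  (forall w, 0 < w < l -> h w = 0 ->
     exists x, w - d / 2 < x < w + d / 2 /\ 0 < x < l /\ h' x = 0) ->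
  (forall w w', 0 < w -> w < w' -> w' < l -> h w = 0 -> h w' = 0 -> w + d <= w') ->
  forall n, nz h 0 l n -> nz h' 0 l n.
Proof.
  intros Hd H1 H2.
  assert (Hs : forall n w, 0 < w < l -> h w = 0 -> nz h w l n -> nz h' (w + d / 2) l n).
  { induction n as [|n IH]; intros w Hw E N; [exact I|].
    destruct N as [w1 [Hw1 [E1 N1]]].
    assert (w + d <= w1) by (apply H2; auto; lra).
    destruct (H1 w1) as [x [Hx1 [Hx2 Hx3]]]; auto; [lra|].
    exists x. split; [lra|]. split; auto.
    apply (nz_weaken h' n n (w1 + d / 2) l); auto; try lra. apply IH; auto; lra. }
  intros [|n] N; [exact I|]. destruct N as [w1 [Hw1 [E1 N1]]].
  destruct (H1 w1) as [x [Hx1 [Hx2 Hx3]]]; auto.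
  exists x. split; auto. split; auto.
  apply (nz_weaken h' n n (w1 + d / 2) l); auto; try lra.
Qed.

Lemma uniform_modulus (f : R -> R) l e : 0 < l -> (forall x, continuous f x) -> 0 < e ->
  exists d, 0 < d /\ forall x y, 0 <= x <= l -> 0 <= y <= l -> Rabs (x - y) < d ->
    Rabs (f x - f y) < e.
Proof.
  intros Hl Hc He.
  destruct (Heine f (fun x => 0 <= x <= l) (compact_P3 0 l)) with (eps := mkposreal e He) as [d Hd].
  { intros x _. apply cont_pt, Hc. }
  exists d. split; [apply cond_pos|]. intros x y Hx Hy H. apply Hd; auto.
Qed.

Lemma deriv_bound_increasing (g dg : R -> R) K a b :
  a <= b -> (forall x, is_derive g x (dg x)) -> (forall x, a < x < b -> K <= dg x) ->
  K * (b - a) <= g b - g a.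
Proof.
  intros Hab Hg HK.
  assert (g a - K * a <= g b - K * b); [|lra].
  apply (nondecreasing_of_deriv (fun x => g x - K * x) (fun x => dg x - K * 1)); auto.
  - intros x. apply deriv_minus; auto. apply deriv_scal. apply (is_derive_id x).
  - intros x Hx. specialize (HK x Hx). lra.
Qed.

(** Simplicity of the zeros gives a positive lower bound for [|f| + |df|], so the slope is bounded
    away from 0 wherever [f] is small. The conditions at 0 and [l] prevent a zero of [g] from
    entering through an end at which [f] vanishes. *)
Lemma zero_count_stable (f df : R -> R) l :
  0 < l -> (forall x, is_derive f x (df x)) -> (forall x, continuous df x) ->
  (forall x, 0 <= x <= l -> f x = 0 -> df x <> 0) ->
  exists e, 0 < e /\ forall g dg : R -> R,
    (forall x, is_derive g x (dg x)) ->
    (forall x, 0 <= x <= l -> Rabs (g x - f x) <= e /\ Rabs (dg x - df x) <= e) ->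
    (f 0 = 0 -> g 0 = 0) -> (f l = 0 -> g l = 0) ->
    forall n, nz f 0 l n <-> nz g 0 l n.
Proof.
  intros Hl Hf Hdf Hsimple.
  assert (Hcf : forall x, continuous f x) by (intros; eapply deriv_continuous; apply Hf).
  assert (HK : exists K, 0 < K /\ forall x, 0 <= x <= l -> 4 * K <= Rabs (f x) + Rabs (df x)).
  { destruct (continuity_ab_min (fun x => Rabs (f x) + Rabs (df x)) 0 l) as [m [Hm1 Hm2]]; [lra| |].
    - intros c _. apply cont_pt. apply cont_plus.
      + apply (continuous_comp f Rabs); auto. apply (continuous_Rabs (f c)).
      + apply (continuous_comp df Rabs); auto. apply (continuous_Rabs (df c)).
    - exists ((Rabs (f m) + Rabs (df m)) / 4). split.
      + assert (A := Rabs_pos (f m)). assert (B := Rabs_pos (df m)).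
        destruct (Req_dec (f m) 0) as [E|E].
        * assert (0 < Rabs (df m)) by (apply Rabs_pos_lt; auto). lra.
        * assert (0 < Rabs (f m)) by (apply Rabs_pos_lt; auto). lra.
      + intros x Hx. specialize (Hm1 x Hx). lra. }
  destruct HK as [K [HK HKb]].
  set (F0 := if Req_EM_T (f 0) 0 then 1 else Rabs (f 0)).
  set (Fl := if Req_EM_T (f l) 0 then 1 else Rabs (f l)).
  assert (HF0 : 0 < F0) by (unfold F0; destruct Req_EM_T; [lra|apply Rabs_pos_lt; auto]).
  assert (HFl : 0 < Fl).
  { unfold Fl. destruct (Req_EM_T (f l) 0); [lra|apply Rabs_pos_lt; auto]. }
  set (e0 := Rmin K (Rmin (F0 / 2) (Fl / 2))).
  assert (He0 : 0 < e0) by (unfold e0; repeat (apply Rmin_case; [lra|]); lra).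
  assert (He0K : e0 <= K) by apply Rmin_l.
  assert (He0F : e0 <= F0 / 2) by (eapply Rle_trans; [apply Rmin_r|apply Rmin_l]).
  assert (He0L : e0 <= Fl / 2) by (eapply Rle_trans; [apply Rmin_r|apply Rmin_r]).
  destruct (uniform_modulus f l e0 Hl Hcf He0) as [d1 [Hd1 M1]].
  destruct (uniform_modulus df l e0 Hl Hdf He0) as [d2 [Hd2 M2]].
  set (d := Rmin d1 d2).
  assert (Hd : 0 < d) by (apply Rmin_case; auto).
  assert (Hdd1 : d <= d1) by apply Rmin_l. assert (Hdd2 : d <= d2) by apply Rmin_r.
  (* A function with slope at least [K] in absolute value and of size at most [K d / 4] at [w]
     changes sign within distance [2 d / 5], which is less than the [d / 2] of [nz_transfer]. *)
  set (e := Rmin (e0 / 2) (K * d / 4)).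
  assert (HKd : 0 < K * d) by (apply Rmult_lt_0_compat; auto).
  assert (He : 0 < e) by (apply Rmin_case; lra).
  assert (Hee0 : e <= e0 / 2) by apply Rmin_l. assert (HeK : e <= K * d / 4) by apply Rmin_r.
  exists e. split; auto. intros g dg Hg Hclose Hg0 Hgl.
  (* near a zero of f or g both functions are strictly monotone, in the same direction *)
  assert (Hslope : forall w, 0 < w < l -> (f w = 0 \/ g w = 0) ->
     exists s, (s = 1 \/ s = -1) /\
       (forall x, 0 <= x <= l -> Rabs (x - w) < d -> K <= s * df x /\ K <= s * dg x)).
  { intros w Hw Hz.
    assert (Hfw : Rabs (f w) <= e).
    { destruct Hz as [E|E].
      - rewrite E, Rabs_R0. lra.
      - destruct (Hclose w) as [A _]; [lra|]. rewrite E in A.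
        rewrite Rminus_0_l, Rabs_Ropp in A. auto. }
    assert (A := HKb w ltac:(lra)).
    destruct (Rle_or_lt 0 (df w)) as [Hs|Hs].
    - exists 1. split; auto. intros x Hx Hxw.
      assert (B := M2 x w Hx ltac:(lra) ltac:(lra)). destruct (Hclose x Hx) as [_ C].
      rewrite (Rabs_right (df w)) in A by lra.
      apply Rabs_def2 in B. unfold Rabs in C; destruct Rcase_abs; split; lra.
    - exists (-1). split; auto. intros x Hx Hxw.
      assert (B := M2 x w Hx ltac:(lra) ltac:(lra)). destruct (Hclose x Hx) as [_ C].
      rewrite (Rabs_left (df w)) in A by lra.
      apply Rabs_def2 in B. unfold Rabs in C; destruct Rcase_abs; split; lra. }
  assert (Hgrow : forall (h dh : R -> R), (h = f /\ dh = df \/ h = g /\ dh = dg) ->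
     forall w, 0 < w < l -> (f w = 0 \/ g w = 0) -> exists s, (s = 1 \/ s = -1) /\
       forall x y, 0 <= x -> x <= y -> y <= l -> w - d <= x -> y <= w + d ->
         K * (y - x) <= s * h y - s * h x).
  { intros h dh Hh w Hw Hz. destruct (Hslope w Hw Hz) as [s [Hs HS]].
    exists s. split; auto. intros x y Hx Hxy Hy Hxd Hyd.
    apply (deriv_bound_increasing (fun x => s * h x) (fun x => s * dh x)); auto.
    - intros z. apply deriv_scal. destruct Hh as [[-> ->]|[-> ->]]; auto.
    - intros z Hz'. destruct (HS z) as [A B]; [lra| |].
      + unfold Rabs; destruct Rcase_abs; lra.
      + destruct Hh as [[-> ->]|[-> ->]]; auto. }
  assert (Hsmall : forall h, (h = f \/ h = g) -> forall w, 0 < w < l -> (f w = 0 \/ g w = 0) ->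
     Rabs (h w) <= e).
  { intros h Hh w Hw Hz. destruct (Hclose w) as [A _]; [lra|].
    destruct Hh as [-> | ->], Hz as [E|E]; rewrite E in *; try (rewrite Rabs_R0; lra).
    - rewrite Rminus_0_l, Rabs_Ropp in A. auto.
    - rewrite Rminus_0_r in A. auto. }
  assert (Hdist : forall h dh, (h = f /\ dh = df \/ h = g /\ dh = dg) ->
     forall w w', 0 <= w -> w < w' -> w' <= l -> (0 < w \/ w' < l) -> h w = 0 -> h w' = 0 -> w + d <= w').
  { intros h dh Hh w w' Hw Hww' Hw' Hor E E'.
    destruct (Rle_or_lt (w + d) w') as [|Hlt]; auto. exfalso.
    assert (Hz : forall v, h v = 0 -> f v = 0 \/ g v = 0)
      by (intros v Hv; destruct Hh as [[-> _]|[-> _]]; auto).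
    destruct Hor as [Hor|Hor].
    - destruct (Hgrow h dh Hh w) as [s [Hs HS]]; [lra|auto|].
      specialize (HS w w' ltac:(lra) ltac:(lra) ltac:(lra) ltac:(lra) ltac:(lra)).
      rewrite E, E' in HS. assert (0 < K * (w' - w)) by (apply Rmult_lt_0_compat; lra). lra.
    - destruct (Hgrow h dh Hh w') as [s [Hs HS]]; [lra|auto|].
      specialize (HS w w' ltac:(lra) ltac:(lra) ltac:(lra) ltac:(lra) ltac:(lra)).
      rewrite E, E' in HS. assert (0 < K * (w' - w)) by (apply Rmult_lt_0_compat; lra). lra. }
  assert (Hinside : forall h dh, (h = f /\ dh = df \/ h = g /\ dh = dg) ->
     forall w, 0 < w < l -> h w = 0 -> d <= w /\ w <= l - d).
  { intros h dh Hh w Hw E.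
    assert (Hz : f w = 0 \/ g w = 0) by (destruct Hh as [[-> _]|[-> _]]; auto).
    assert (Sf := Hsmall f (or_introl eq_refl) w Hw Hz).
    split.
    - destruct (Rle_or_lt d w) as [|Hlt]; auto. exfalso.
      destruct (Req_dec (f 0) 0) as [Z|Z].
      + assert (h 0 = 0) by (destruct Hh as [[-> _]|[-> _]]; auto).
        assert (X := Hdist h dh Hh 0 w (Rle_refl 0) ltac:(lra) ltac:(lra) ltac:(lra) H E). lra.
      + assert (X := M1 0 w ltac:(lra) ltac:(lra) ltac:(unfold Rabs; destruct Rcase_abs; lra)).
        unfold F0 in He0F. destruct (Req_EM_T (f 0) 0); [contradiction|].
        unfold Rabs in *; repeat destruct Rcase_abs; lra.
    - destruct (Rle_or_lt w (l - d)) as [|Hlt]; auto. exfalso.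
      destruct (Req_dec (f l) 0) as [Z|Z].
      + assert (h l = 0) by (destruct Hh as [[-> _]|[-> _]]; auto).
        assert (X := Hdist h dh Hh w l ltac:(lra) ltac:(lra) (Rle_refl l) ltac:(lra) E H). lra.
      + assert (X := M1 l w ltac:(lra) ltac:(lra) ltac:(unfold Rabs; destruct Rcase_abs; lra)).
        unfold Fl in He0L. destruct (Req_EM_T (f l) 0); [contradiction|].
        unfold Rabs in *; repeat destruct Rcase_abs; lra. }
  assert (Hboth : forall h dh h' dh', (h = f /\ dh = df \/ h = g /\ dh = dg) ->
     (h' = f /\ dh' = df \/ h' = g /\ dh' = dg) -> forall n, nz h 0 l n -> nz h' 0 l n).
  { intros h dh h' dh' Hh Hh'. apply (nz_transfer h h' d l Hd).
    - intros w Hw E.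
      destruct (Hinside h dh Hh w Hw E) as [I1 I2].
      assert (Hz : f w = 0 \/ g w = 0) by (destruct Hh as [[-> _]|[-> _]]; auto).
      destruct (Hgrow h' dh' Hh' w Hw Hz) as [s [Hs HS]].
      assert (Hsm : Rabs (h' w) <= e).
      { apply Hsmall; auto. destruct Hh' as [[-> _]|[-> _]]; auto. }
      assert (G1 := HS (w - 2 * d / 5) w ltac:(lra) ltac:(lra) ltac:(lra) ltac:(lra) ltac:(lra)).
      assert (G2 := HS w (w + 2 * d / 5) ltac:(lra) ltac:(lra) ltac:(lra) ltac:(lra) ltac:(lra)).
      replace (w - (w - 2 * d / 5)) with (2 * d / 5) in G1 by field.
      replace (w + 2 * d / 5 - w) with (2 * d / 5) in G2 by field.
      replace (K * (2 * d / 5)) with (2 * (K * d) / 5) in * by field.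
      destruct (ivt_zero h' (w - 2 * d / 5) (w + 2 * d / 5)) as [x [Hx Ex]].
      + intros; destruct Hh' as [[-> _]|[-> _]]; eapply deriv_continuous; [apply Hf|apply Hg].
      + lra.
      + assert (s * h' (w - 2 * d / 5) < 0 /\ 0 < s * h' (w + 2 * d / 5)).
        { destruct Hs as [-> | ->]; unfold Rabs in Hsm; destruct Rcase_abs; split; lra. }
        destruct H as [A B]. destruct Hs as [-> | ->]; nra.
      + exists x. split; [lra|]. split; [lra|auto].
    - intros w w' H1 H2 H3 E E'. apply (Hdist h dh Hh); auto; lra. }
  intros n. split; [apply (Hboth f df g dg)|apply (Hboth g dg f df)]; auto.
Qed.

Lemma rolle (g dg : R -> R) a b :
  (forall x, is_derive g x (dg x)) -> a < b -> g a = 0 -> g b = 0 -> exists x, a < x < b /\ dg x = 0.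
Proof.
  intros Hd Hab Ha Hb. destruct (MVT_cor2 g dg a b Hab) as [c [E Hc]].
  - intros; apply is_derive_Reals; auto.
  - exists c. split; auto. rewrite Ha, Hb in E.
    symmetry in E. replace (0 - 0) with 0 in E by ring.
    apply Rmult_integral in E. destruct E; lra.
Qed.

Lemma nz_rolle (g dg : R -> R) n : (forall x, is_derive g x (dg x)) ->
  forall a b, nz g a b (S n) -> nz dg a b n.
Proof.
  intros Hd. induction n as [|n IH]; intros a b [x [Hx [E N]]]; [exact I|].
  destruct N as [y [Hy [E' N']]].
  destruct (rolle g dg x y) as [z [Hz Ez]]; auto; [lra|].
  exists z. split; [lra|]. split; auto. apply IH. exists y. split; [lra|auto].
Qed.

Definition expsum (M : nat) (b s : nat -> R) (t : R) : R :=
  lsum (seq 0 M) (fun i => b i * exp (- t * s i)).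

Lemma expsum_deriv M b s t :
  is_derive (expsum M b s) t (expsum M (fun i => - (b i * s i)) s t).
Proof.
  unfold expsum. induction (seq 0 M) as [|i r IH]; simpl.
  - apply deriv_const.
  - apply deriv_plus; auto.
    eapply is_derive_val; [auto_derive; [auto|reflexivity]|]. cbv beta; ring.
Qed.

(** Multiplying by [exp (t * s (S M))] keeps the zeros and makes the last term constant;
    differentiation removes this term at the price of one zero, by Rolle. The new coefficients
    contain the factors [s i - s (S M)], nonzero because the exponents are distinct. *)
Lemma expsum_zeros M : forall (b s : nat -> R) n A B,
  (forall i, (i < S M)%nat -> b i <> 0) ->
  (forall i j, (i < S M)%nat -> (j < S M)%nat -> i <> j -> s i <> s j) ->
  nz (expsum (S M) b s) A B n -> (n <= M)%nat.
Proof.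
  induction M as [|M IH]; intros b s n A B Hb Hs N.
  - destruct n as [|n]; [lia|]. destruct N as [x [_ [E _]]].
    unfold expsum in E. simpl in E. exfalso.
    assert (H := Hb 0%nat ltac:(lia)). assert (P := exp_pos (- x * s 0%nat)).
    assert (Z : b 0%nat * exp (- x * s 0%nat) = 0) by lra.
    apply Rmult_integral in Z. destruct Z; lra.
  - destruct n as [|n]; [lia|]. apply le_n_S.
    set (s' := fun i => s i - s (S M)).
    assert (N' : nz (expsum (S (S M)) b s') A B (S n)).
    { clear - N. revert N. generalize (S n). intros m. revert A.
      induction m as [|m IH]; intros A N; [exact I|].
      destruct N as [x [Hx [E N]]]. exists x. split; auto. split; [|auto].
      unfold expsum in *.
      rewrite (lsum_ext _ _ (fun i => exp (x * s (S M)) * (b i * exp (- x * s i)))).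
      - rewrite lsum_scal, E. ring.
      - intros i _. unfold s'. replace (- x * (s i - s (S M))) with (- x * s i + x * s (S M)) by ring.
        rewrite exp_plus. ring. }
    apply (nz_rolle _ _ n (expsum_deriv (S (S M)) b s')) in N'.
    apply (IH (fun i => - (b i * s' i)) s' n A B).
    + intros i Hi H.
      assert (Z : b i * s' i = 0) by lra. apply Rmult_integral in Z. destruct Z as [Z|Z].
      * apply (Hb i); auto; lia.
      * unfold s' in Z. apply (Hs i (S M)); lia || lra.
    + intros i j Hi Hj Hij E. unfold s' in E. apply (Hs i j); lia || lra.
    + revert N'. apply nz_ext. intros x _. unfold expsum at 1.
      rewrite lsum_seq_S. cbv beta. change (0 + S M)%nat with (S M).
      replace (s' (S M)) with 0 by (unfold s'; ring).
      unfold expsum. ring.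
Qed.

(** Both functions are compared with [x - z]. Boundedness of the quotient suffices for Picone's
    boundary term, whose other factor vanishes at [z]. *)
Lemma quotient_bounded (F dF f df : R -> R) z :
  is_derive F z (dF z) -> is_derive f z (df z) -> F z = 0 -> f z = 0 -> df z <> 0 ->
  exists B d, 0 < d /\ forall x, Rabs (x - z) < d -> Rabs (F x * / f x) <= B.
Proof.
  intros HF Hf F0 f0 Hn.
  apply is_derive_Reals in HF. apply is_derive_Reals in Hf.
  assert (Ha : 0 < Rabs (df z)) by (apply Rabs_pos_lt; auto).
  destruct (HF 1) as [d1 H1]; [lra|]. destruct (Hf (Rabs (df z) / 2)) as [d2 H2]; [lra|].
  assert (HB : 0 <= (Rabs (dF z) + 1) * (2 / Rabs (df z))).
  { apply Rmult_le_pos; [assert (A := Rabs_pos (dF z)); lra|].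
    apply Rlt_le, Rdiv_lt_0_compat; lra. }
  exists ((Rabs (dF z) + 1) * (2 / Rabs (df z))), (Rmin d1 d2).
  split; [apply Rmin_case; apply cond_pos|]. intros x Hx.
  assert (A1 := Rmin_l d1 d2). assert (A2 := Rmin_r d1 d2).
  destruct (Req_dec x z) as [->|Hxz].
  { rewrite F0, Rmult_0_l, Rabs_R0. auto. }
  set (h := x - z) in *. assert (Hh : h <> 0) by (unfold h; lra).
  specialize (H1 h Hh ltac:(lra)). specialize (H2 h Hh ltac:(lra)).
  replace (z + h) with x in H1, H2 by (unfold h; ring).
  rewrite F0 in H1. rewrite f0 in H2. rewrite Rminus_0_r in H1, H2.
  set (p := F x / h) in *. set (r := f x / h) in *.
  assert (Hp : Rabs p <= Rabs (dF z) + 1).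
  { replace p with ((p - dF z) + dF z) by ring. eapply Rle_trans; [apply Rabs_triang|]. lra. }
  assert (Hr : Rabs (df z) / 2 <= Rabs r).
  { assert (Rabs (df z) <= Rabs (r - df z) + Rabs r); [|lra].
    replace (df z) with (- (r - df z) + r) at 1 by ring.
    eapply Rle_trans; [apply Rabs_triang|]. rewrite Rabs_Ropp. lra. }
  assert (Hr0 : r <> 0) by (intros E; rewrite E, Rabs_R0 in Hr; lra).
  replace (F x * / f x) with (p * / r).
  - rewrite Rabs_mult, Rabs_inv. apply Rmult_le_compat; try apply Rabs_pos; auto.
    + apply Rlt_le, Rinv_0_lt_compat, Rabs_pos_lt; auto.
    + replace (2 / Rabs (df z)) with (/ (Rabs (df z) / 2)) by (field; lra).
      apply Rinv_le_contravar; lra.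
  - unfold p, r. field. split; auto.
    intros E. apply Hr0. unfold r. rewrite E. unfold Rdiv. ring.
Qed.

Lemma continuous_times_bounded (g w : R -> R) z B d :
  0 < d -> (forall x, Rabs (x - z) < d -> Rabs (g x) <= B) -> continuous w z -> w z = 0 ->
  continuous (fun x => g x * w x) z.
Proof.
  intros Hd Hg Hw W0. apply continuity_pt_filterlim. intros e He.
  assert (Bp : 0 <= B).
  { eapply Rle_trans; [apply Rabs_pos|]. apply (Hg z). rewrite Rminus_diag, Rabs_R0; auto. }
  destruct (cont_pt _ _ Hw (e / (B + 1))) as [d' [Hd' H]]; [apply Rdiv_lt_0_compat; lra|].
  exists (Rmin d d'). split; [apply Rmin_case; auto|]. intros x [_ Hx]. simpl in *.
  unfold Rdist in *. rewrite W0, Rmult_0_r, Rminus_0_r.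
  assert (A1 := Rmin_l d d'). assert (A2 := Rmin_r d d').
  destruct (Req_dec x z) as [->|Hxz]; [rewrite W0, Rmult_0_r, Rabs_R0; lra|].
  assert (Hw' : Rabs (w x - w z) < e / (B + 1)).
  { apply H. split; [split; [exact I|auto]|lra]. }
  rewrite W0, Rminus_0_r in Hw'. rewrite Rabs_mult.
  apply Rle_lt_trans with (B * Rabs (w x)).
  - apply Rmult_le_compat_r; [apply Rabs_pos|apply Hg; lra].
  - assert (0 <= Rabs (w x)) by apply Rabs_pos.
    assert (Rabs (w x) * (B + 1) < e).
    { apply Rmult_lt_reg_r with (/ (B + 1)); [apply Rinv_0_lt_compat; lra|].
      rewrite Rmult_assoc, Rinv_r by lra. unfold Rdiv in Hw'. lra. }
    nra.
Qed.

(* [/ f] is [0] at the zeros of [f], where [F] vanishes too. *)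
Definition picone (F dF f df : R -> R) (x : R) : R := F x * / f x * (dF x * f x - F x * df x).

(** Away from the zeros of [f], the boundary term plus the integral up to [x] has derivative
    [(dF - F df / f)^2]. *)
Lemma picone_inequality (W F dF ddF f df ddf y : R -> R) (lam l : R) (L : list R) :
  0 < l -> smooth2 F dF ddF -> smooth2 f df ddf -> (forall x, continuous y x) ->
  (forall x, 0 <= x <= l -> ddf x = (W x - lam) * f x) ->
  (forall x, 0 <= x <= l -> ddF x = W x * F x - y x) ->
  (forall x, 0 <= x <= l -> f x = 0 -> In x L /\ F x = 0 /\ df x <> 0) ->
  picone F dF f df 0 - picone F dF f df l <= RInt (fun x => F x * (y x - lam * F x)) 0 l.
Proof.
  intros Hl (F1 & F2 & F3) (f1 & f2 & f3) Hy Ef EF Hz.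
  set (I := fun x => RInt (fun x => F x * (y x - lam * F x)) 0 x).
  assert (cF : forall x, continuous F x) by (intros; eapply deriv_continuous; apply F1).
  assert (cdF : forall x, continuous dF x) by (intros; eapply deriv_continuous; apply F2).
  assert (cf : forall x, continuous f x) by (intros; eapply deriv_continuous; apply f1).
  assert (cdf : forall x, continuous df x) by (intros; eapply deriv_continuous; apply f2).
  assert (HI : forall x, is_derive I x (F x * (y x - lam * F x))).
  { intros x. apply (deriv_RInt (fun x => F x * (y x - lam * F x))).
    intros; apply cont_mult; auto. apply cont_minus; auto. apply cont_mult; auto. apply cont_const. }
  assert (Hm : picone F dF f df 0 + I 0 <= picone F dF f df l + I l).
  2:{ unfold I at 1 in Hm. rewrite RInt_same in Hm. fold (I l). lra. }
  apply (nondecreasing_except (fun x => picone F dF f df x + I x)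
    (fun x => (dF x - F x * df x / f x) * (dF x - F x * df x / f x)) L); [lra| |].
  - intros x Hx. apply cont_plus; [|eapply deriv_continuous; apply HI].
    unfold picone. destruct (Req_dec (f x) 0) as [E|E].
    + destruct (Hz x Hx E) as [_ [Z Z']].
      destruct (quotient_bounded F dF f df x) as [B [d [Hd HB]]]; auto.
      apply (continuous_times_bounded (fun x => F x * / f x) _ x B d); auto.
      * apply cont_minus; apply cont_mult; auto.
      * rewrite E, Z. ring.
    + apply cont_mult; [|apply cont_minus; apply cont_mult; auto].
      apply cont_mult; auto. apply (continuous_comp f Rinv); auto.
      apply continuity_pt_filterlim. apply derivable_continuous_pt.
      apply derivable_pt_inv; auto. apply derivable_pt_id.
  - intros x Hx Hn.
    assert (E : f x <> 0) by (intros E; apply Hn, Hz; auto; lra).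
    split; [|apply Rle_0_sqr].
    assert (Hinv : is_derive (fun z => / f z) x (- df x / (f x) ^ 2)).
    { apply (is_derive_inv f x (df x)); auto. }
    eapply is_derive_val.
    + apply deriv_plus; [|apply HI]. unfold picone.
      apply deriv_mult; [apply deriv_mult; [apply F1|exact Hinv]|].
      apply deriv_minus; apply deriv_mult; auto.
    + cbv beta. rewrite Ef, EF by lra. field. auto.
Qed.

(* [h] is a step function; across its jumps, at zeros of [f], the boundary term [Xi] is continuous. *)
Lemma broken_inequality (W f df ddf v dv ddv h : R -> R) (lam c l : R) (L : list R) :
  0 < l -> c < lam -> (forall x, 0 <= x <= l -> c <= W x) ->
  smooth2 f df ddf -> smooth2 v dv ddv ->
  (forall x, continuous (fun y => h y * f y) x) ->
  (forall x, continuous (fun y => h y * f y * (h y * df y)) x) ->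
  (forall x, 0 < x < l -> ~ In x L -> locally x (fun y => h y = h x)) ->
  (forall x, 0 <= x <= l -> ddf x = (W x - lam) * f x) ->
  (forall x, 0 <= x <= l -> ddv x = (W x - c) * v x - h x * f x) ->
  let t := / (lam - c) in
  let Xi := fun x => v x * dv x - 2 * t * (h x * f x) * dv x + t * t * (h x * f x * (h x * df x)) in
  Xi 0 - Xi l <= t * RInt (fun x => (lam - c) * (v x * (h x * f x)) - h x * f x * (h x * f x)) 0 l.
Proof.
  intros Hl Hc HW (f1 & f2 & f3) (v1 & v2 & v3) Hg Hgg Hloc Ef Ev t Xi.
  assert (cv : forall x, continuous v x) by (intros; eapply deriv_continuous; apply v1).
  assert (cdv : forall x, continuous dv x) by (intros; eapply deriv_continuous; apply v2).
  set (J := fun x => (lam - c) * (v x * (h x * f x)) - h x * f x * (h x * f x)).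
  assert (cJ : forall x, continuous J x).
  { intros x. unfold J. apply cont_minus.
    - apply cont_mult; [apply cont_const|]. apply cont_mult; auto.
    - apply (cont_mult (fun y => h y * f y) (fun y => h y * f y)); apply Hg. }
  set (I := fun x => RInt J 0 x).
  assert (HI : forall x, is_derive I x (J x)) by (intros x; apply (deriv_RInt J); auto).
  assert (Hm : Xi 0 + t * I 0 <= Xi l + t * I l).
  2:{ unfold I at 1 in Hm. rewrite RInt_same in Hm. fold (I l). lra. }
  (* Off the jumps [w] solves [w'' = (W - c) w], and [Xi + t I] has derivative [dw^2 + (W - c) w^2].
     [Xi] differs from [w dw] so that the discontinuous [h df] occurs only multiplied by [h f]. *)
  set (w := fun x => v x - t * (h x * f x)). set (dw := fun x => dv x - t * (h x * df x)).
  apply (nondecreasing_except (fun x => Xi x + t * I x)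
    (fun x => dw x * dw x + (W x - c) * (w x * w x)) L); [lra| |].
  - intros x Hx. apply cont_plus.
    + unfold Xi. apply cont_plus; [apply cont_minus|].
      * apply cont_mult; auto.
      * apply (cont_mult (fun y => 2 * t * (h y * f y)) dv); auto.
        apply (cont_mult (fun _ => 2 * t)); [apply cont_const|apply Hg].
      * apply (cont_mult (fun _ => t * t)); [apply cont_const|apply Hgg].
    + apply cont_mult; [apply cont_const|]. eapply deriv_continuous; apply HI.
  - intros x Hx Hn. split.
    2:{ assert (0 <= dw x * dw x) by apply Rle_0_sqr. assert (0 <= w x * w x) by apply Rle_0_sqr.
        specialize (HW x ltac:(lra)). assert (0 <= (W x - c) * (w x * w x)) by (apply Rmult_le_pos; lra). lra. }
    specialize (Hloc x Hx Hn).
    set (k := h x) in *.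
    apply is_derive_ext_loc with (fun y => (v y * dv y - 2 * t * (k * f y) * dv y
        + t * t * (k * f y * (k * df y))) + t * I y).
    { eapply filter_imp; [|exact Hloc]. intros y Hy. simpl. unfold Xi. rewrite Hy. reflexivity. }
    eapply is_derive_val.
    + apply deriv_plus; [|apply deriv_scal, HI].
      apply deriv_plus; [apply deriv_minus|].
      * apply deriv_mult; auto.
      * apply (deriv_mult (fun y => 2 * t * (k * f y)) dv); auto.
        apply deriv_scal, deriv_scal, f1.
      * apply deriv_scal. apply (deriv_mult (fun y => k * f y) (fun y => k * df y)); apply deriv_scal; auto.
    + cbv beta. unfold J, w, dw. fold k. rewrite Ef, Ev by lra. fold k.
      unfold t. field. lra.
Qed.

(** * Functions on the graph *)

Lemma gfun_ext (u w : gfun) : (forall e x, u e x = w e x) -> u = w.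
Proof.
  intros H. apply FunctionalExtensionality.functional_extensionality; intros e.
  apply FunctionalExtensionality.functional_extensionality; intros x. auto.
Qed.

(** A loop is listed twice, once for each end, in agreement with [deg]. *)
Definition vends (G : mgraph) (v : nat) : list (nat * bool) :=
  map (fun e => (e, false)) (filter (fun e => Nat.eqb (src G e) v) (seq 0 (nE G))) ++
  map (fun e => (e, true)) (filter (fun e => Nat.eqb (tgt G e) v) (seq 0 (nE G))).

Lemma vends_length G v : length (vends G v) = deg G v.
Proof. unfold vends, deg. rewrite length_app, !length_map. reflexivity. Qed.

Lemma in_vends G v e b : In (e, b) (vends G v) <-> (e < nE G)%nat /\ vertex_of G e b = v.
Proof.
  unfold vends, vertex_of. rewrite in_app_iff, !in_map_iff. split.
  - intros [[x [E H]]|[x [E H]]]; injection E as <- <-; apply filter_In in H;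
      destruct H as [H1 H2]; apply in_seq in H1; apply Nat.eqb_eq in H2; split; auto; lia.
  - intros [He Hv]. destruct b; [right|left]; exists e; split; auto;
      apply filter_In; rewrite in_seq; split; try lia; apply Nat.eqb_eq; auto.
Qed.

Lemma lsum_vends G v (g : nat * bool -> R) :
  lsum (vends G v) g = lsum (seq 0 (nE G)) (fun e =>
    (if Nat.eqb (src G e) v then g (e, false) else 0) +
    (if Nat.eqb (tgt G e) v then g (e, true) else 0)).
Proof. unfold vends. rewrite lsum_app, !lsum_map, !lsum_filter, lsum_plus. reflexivity. Qed.

Lemma sum_over_vertices G (g : nat * bool -> R) : wf_graph G ->
  lsum (seq 0 (nV G)) (fun v => lsum (vends G v) g)
  = lsum (seq 0 (nE G)) (fun e => g (e, false) + g (e, true)).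
Proof.
  intros Hwf.
  rewrite (lsum_ext _ _ _ (fun v _ => lsum_vends G v g)).
  rewrite lsum_swap. apply lsum_ext. intros e He. apply in_seq in He.
  destruct (Hwf e) as [H1 [H2 _]]; [lia|].
  rewrite lsum_plus. f_equal.
  - rewrite (lsum_ext _ _ (fun v => if Nat.eqb v (src G e) then g (e, false) else 0)).
    + apply (lsum_delta (nV G) (src G e) (fun _ => g (e, false))); auto.
    + intros v _. rewrite Nat.eqb_sym. auto.
  - rewrite (lsum_ext _ _ (fun v => if Nat.eqb v (tgt G e) then g (e, true) else 0)).
    + apply (lsum_delta (nV G) (tgt G e) (fun _ => g (e, true))); auto.
    + intros v _. rewrite Nat.eqb_sym. auto.
Qed.

(** The sign makes this the derivative pointing into the edge, as in Kirchhoff's condition. *)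
Definition outd (G : mgraph) (du : gfun) (p : nat * bool) : R :=
  if snd p then - du (fst p) (len G (fst p)) else du (fst p) 0.

(** The domain of H, with derivatives and vertex values as explicit witnesses. Smoothness is asked
    for on the whole line, so that the derivatives at vertices are two-sided. *)
Definition in_dom (G : mgraph) (u du ddu : gfun) (phi : nat -> R) : Prop :=
  (forall e, (e < nE G)%nat -> smooth2 (u e) (du e) (ddu e)) /\
  (forall e b, (e < nE G)%nat -> u e (Defs.pos G e b) = phi (vertex_of G e b)) /\
  (forall v, deg G v = 1%nat -> phi v = 0) /\
  (forall v, (2 <= deg G v)%nat -> lsum (vends G v) (outd G du) = 0).

(** Grouped by vertices, the sum is [psi v] times the Kirchhoff sum at [v]. The boundary terms of
    all integrations by parts cancel through this lemma, for various weights [psi]. *)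
Lemma flux_zero G u du ddu phi psi : wf_graph G -> in_dom G u du ddu phi ->
  (forall v, deg G v = 1%nat -> psi v = 0) ->
  lsum (seq 0 (nE G)) (fun e => psi (src G e) * du e 0 - psi (tgt G e) * du e (len G e)) = 0.
Proof.
  intros Hwf (H1 & H2 & H3 & H4) Hpsi.
  transitivity (lsum (seq 0 (nV G)) (fun v => lsum (vends G v)
     (fun p => psi (vertex_of G (fst p) (snd p)) * outd G du p))).
  - rewrite sum_over_vertices by auto. apply lsum_ext. intros e _. unfold outd, vertex_of. simpl. ring.
  - apply lsum_zero. intros v _.
    rewrite (lsum_ext _ _ (fun p => psi v * outd G du p)).
    2:{ intros [e b] Hp. apply in_vends in Hp. simpl. destruct Hp as [_ ->]. auto. }
    rewrite lsum_scal.
    destruct (Nat.eq_dec (deg G v) 0) as [E|E].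
    { rewrite <- vends_length in E. destruct (vends G v); [simpl; lra|discriminate]. }
    destruct (Nat.eq_dec (deg G v) 1) as [E1|E1]; [rewrite Hpsi by auto; ring|].
    rewrite H4 by lia. ring.
Qed.

Lemma smooth2_lin u du ddu w dw ddw c : smooth2 u du ddu -> smooth2 w dw ddw ->
  smooth2 (fun x => u x + c * w x) (fun x => du x + c * dw x) (fun x => ddu x + c * ddw x).
Proof.
  intros (A1 & A2 & A3) (B1 & B2 & B3). split; [|split]; intros x.
  - apply deriv_plus; auto. apply deriv_scal; auto.
  - apply deriv_plus; auto. apply deriv_scal; auto.
  - apply cont_plus; auto. apply cont_mult; auto. apply cont_const.
Qed.

Lemma smooth2_continuous u du ddu : smooth2 u du ddu ->
  (forall x, continuous u x) /\ (forall x, continuous du x).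
Proof. intros (A1 & A2 & A3). split; intros; eapply deriv_continuous; eauto. Qed.

Lemma in_dom_lin G u du ddu phi w dw ddw psi c :
  in_dom G u du ddu phi -> in_dom G w dw ddw psi ->
  in_dom G (fun e x => u e x + c * w e x) (fun e x => du e x + c * dw e x)
    (fun e x => ddu e x + c * ddw e x) (fun v => phi v + c * psi v).
Proof.
  intros (A1 & A2 & A3 & A4) (B1 & B2 & B3 & B4). split; [|split; [|split]].
  - intros e He. apply smooth2_lin; auto.
  - intros e b He. rewrite A2, B2; auto.
  - intros v Hv. rewrite A3, B3 by auto. ring.
  - intros v Hv. rewrite (lsum_ext _ _ (fun p => outd G du p + c * outd G dw p)).
    + rewrite lsum_plus, lsum_scal, A4, B4 by auto. ring.
    + intros p _. unfold outd. destruct (snd p); ring.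
Qed.

Lemma in_dom_zero G : in_dom G (fun _ _ => 0) (fun _ _ => 0) (fun _ _ => 0) (fun _ => 0).
Proof.
  split; [|split; [|split]]; auto.
  - intros e _. split; [|split]; intros; try apply deriv_const. apply cont_const.
  - intros v _. apply lsum_zero. intros p _. unfold outd. destruct (snd p); ring.
Qed.

Lemma in_dom_lsum G (u du ddu : nat -> gfun) (phi : nat -> nat -> R) (c : nat -> R) (s : list nat) :
  (forall i, In i s -> in_dom G (u i) (du i) (ddu i) (phi i)) ->
  in_dom G (fun e x => lsum s (fun i => c i * u i e x)) (fun e x => lsum s (fun i => c i * du i e x))
    (fun e x => lsum s (fun i => c i * ddu i e x)) (fun v => lsum s (fun i => c i * phi i v)).
Proof.
  induction s as [|i s IH]; intros H.
  - apply in_dom_zero.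
  - assert (A := IH ltac:(intros; apply H; right; auto)).
    assert (B := in_dom_lin _ _ _ _ _ _ _ _ _ (c i) A (H i (or_introl eq_refl))).
    simpl.
    assert (Heq : forall (p q : gfun), (fun e x => p e x + c i * q e x) = (fun e x => c i * q e x + p e x)).
    { intros p q. apply gfun_ext; intros; ring. }
    assert (Heq' : forall (p q : nat -> R), (fun v => p v + c i * q v) = (fun v => c i * q v + p v)).
    { intros p q. apply FunctionalExtensionality.functional_extensionality; intros v. ring. }
    rewrite !Heq, Heq' in B. exact B.
Qed.

(** The equation H u = y, a relation because H has a restricted domain and because [y] matters on
    the edges only, not beyond their ends. *)
Definition Hrel (G : mgraph) (W u y : gfun) : Prop :=
  exists du ddu phi, in_dom G u du ddu phi /\
    forall e x, (e < nE G)%nat -> 0 <= x <= len G e -> ddu e x = W e x * u e x - y e x.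

Definition econt (G : mgraph) (u : gfun) : Prop :=
  forall e, (e < nE G)%nat -> forall x, continuous (u e) x.

Lemma Hrel_econt G W u y : Hrel G W u y -> econt G u.
Proof.
  intros (du & ddu & phi & (A1 & _) & _) e He x.
  apply (smooth2_continuous _ _ _ (A1 e He)).
Qed.

Lemma Hrel_ext G W u y y' : Hrel G W u y ->
  (forall e x, (e < nE G)%nat -> 0 <= x <= len G e -> y e x = y' e x) -> Hrel G W u y'.
Proof.
  intros (du & ddu & phi & A & B) E. exists du, ddu, phi. split; auto.
  intros e x He Hx. rewrite B, E; auto.
Qed.

Lemma Hrel_lin G W u y w z c : Hrel G W u y -> Hrel G W w z ->
  Hrel G W (fun e x => u e x + c * w e x) (fun e x => y e x + c * z e x).
Proof.
  intros (du & ddu & phi & A & B) (dw & ddw & psi & C & D).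
  exists (fun e x => du e x + c * dw e x), (fun e x => ddu e x + c * ddw e x), (fun v => phi v + c * psi v).
  split; [apply in_dom_lin; auto|]. intros e x He Hx. rewrite B, D by auto. ring.
Qed.

Lemma econt_lin G u w c : econt G u -> econt G w -> econt G (fun e x => u e x + c * w e x).
Proof.
  intros A B e He x. apply cont_plus; [apply A; auto|]. apply cont_mult; [apply cont_const|apply B; auto].
Qed.

Lemma econt_scal G c u : econt G u -> econt G (fun e x => c * u e x).
Proof. intros A e He x. apply cont_mult; [apply cont_const|apply A; auto]. Qed.

Lemma econt_lsum G (u : nat -> gfun) c s : (forall i, In i s -> econt G (u i)) ->
  econt G (fun e x => lsum s (fun i => c i * u i e x)).
Proof.
  induction s as [|i s IH]; intros H e He x; simpl.
  - apply cont_const.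
  - apply cont_plus.
    + apply cont_mult; [apply cont_const|]. apply H; simpl; auto.
    + apply IH; auto. intros; apply H; simpl; auto.
Qed.

Lemma L2_ext G u u' w w' : wf_graph G ->
  (forall e x, (e < nE G)%nat -> 0 <= x <= len G e -> u e x = u' e x /\ w e x = w' e x) ->
  L2_inner G u w = L2_inner G u' w'.
Proof.
  intros Hwf H. apply lsum_ext. intros e He. apply in_seq in He.
  destruct (Hwf e) as [_ [_ Hl]]; [lia|].
  apply RInt_eq. intros x Hx.
  rewrite Rmin_left, Rmax_right in Hx by lra.
  destruct (H e x) as [-> ->]; auto; [lia|lra].
Qed.

Lemma L2_sym G u w : wf_graph G -> L2_inner G u w = L2_inner G w u.
Proof.
  intros Hwf. apply lsum_ext. intros e He.
  apply RInt_eq. intros x _. apply Rmult_comm.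
Qed.

Lemma L2_lin_l G u w z c : econt G u -> econt G w -> econt G z ->
  L2_inner G (fun e x => u e x + c * w e x) z = L2_inner G u z + c * L2_inner G w z.
Proof.
  intros A B C. unfold L2_inner. change (@sumR) with (@lsum nat).
  rewrite <- lsum_scal, <- lsum_plus. apply lsum_ext. intros e He. apply in_seq in He.
  rewrite <- RInt_linear.
  - apply RInt_eq. intros x _.
    change ((u e x + c * w e x) * z e x = u e x * z e x + c * (w e x * z e x)). ring.
  - intros x. apply cont_mult; [apply A|apply C]; lia.
  - intros x. apply cont_mult; [apply B|apply C]; lia.
Qed.

Lemma L2_zero_l G z : L2_inner G (fun _ _ => 0) z = 0.
Proof.
  apply lsum_zero. intros e _. rewrite (RInt_eq _ (fun _ => 0)).
  - rewrite (RInt_const (V := R_CompleteNormedModule)). unfold scal; simpl; unfold mult; simpl. ring.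
  - intros x _. change (0 * z e x = 0). ring.
Qed.

Lemma L2_scal_l G u z c : econt G u -> econt G z ->
  L2_inner G (fun e x => c * u e x) z = c * L2_inner G u z.
Proof.
  intros A C. transitivity (L2_inner G (fun e x => (fun _ _ => 0) e x + c * u e x) z).
  - f_equal. apply gfun_ext; intros; ring.
  - rewrite L2_lin_l; auto.
    + rewrite L2_zero_l. ring.
    + intros e _ x. apply cont_const.
Qed.

Lemma L2_lsum_l G (u : nat -> gfun) c s z : (forall i, In i s -> econt G (u i)) -> econt G z ->
  L2_inner G (fun e x => lsum s (fun i => c i * u i e x)) z = lsum s (fun i => c i * L2_inner G (u i) z).
Proof.
  induction s as [|i s IH]; intros H C; simpl.
  - apply L2_zero_l.
  - rewrite <- IH by (auto; intros; apply H; simpl; auto).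
    transitivity (L2_inner G (fun e x => (fun e x => lsum s (fun i => c i * u i e x)) e x + c i * u i e x) z).
    + f_equal. apply gfun_ext; intros; ring.
    + rewrite L2_lin_l; auto.
      * ring.
      * apply econt_lsum. intros; apply H; simpl; auto.
      * apply H; simpl; auto.
Qed.

Lemma L2_nonneg G u : wf_graph G -> econt G u -> 0 <= L2_inner G u u.
Proof.
  intros Hwf A. apply lsum_nonneg. intros e He. apply in_seq in He.
  destruct (Hwf e) as [_ [_ Hl]]; [lia|].
  apply RInt_ge_0; [lra| |intros; apply Rle_0_sqr].
  apply ex_RInt_cont. intros; apply cont_mult; apply A; lia.
Qed.

Lemma RInt_pos (g : R -> R) l x0 : 0 < l -> (forall x, continuous g x) ->
  (forall x, 0 <= g x) -> 0 <= x0 <= l -> 0 < g x0 -> 0 < RInt g 0 l.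
Proof.
  intros Hl Hc Hp Hx0 Hg.
  assert (H0 : 0 <= RInt g 0 l) by (apply RInt_ge_0; [lra|apply ex_RInt_cont; auto|auto]).
  destruct H0 as [|H0]; auto. exfalso.
  set (I := fun x => RInt g 0 x).
  assert (HI : forall x, is_derive I x (g x)) by (intros; apply (deriv_RInt g); auto).
  assert (I0 : I 0 = 0) by apply RInt_same.
  assert (Hz : forall x, 0 <= x <= l -> I x = 0).
  { intros x Hx. apply Rle_antisym.
    - apply Rle_trans with (I l); [apply (nondecreasing_of_deriv I g); auto; lra|].
      unfold I. rewrite <- H0. apply Rle_refl.
    - rewrite <- I0. apply (nondecreasing_of_deriv I g); auto; lra. }
  destruct (cont_pt _ _ (Hc x0) (g x0)) as [d [Hd H]]; auto.
  assert (Hn : forall x, Rabs (x - x0) < d -> 0 < g x).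
  { intros x Hx. destruct (Req_dec x x0) as [->|Hne]; auto.
    specialize (H x). simpl in H. unfold Rdist in H.
    assert (A : Rabs (g x - g x0) < g x0) by (apply H; split; [split; [exact Logic.I|auto]|auto]).
    apply Rabs_def2 in A. lra. }
  assert (Hab : exists a b, 0 <= a /\ a < b /\ b <= l /\ (forall x, a < x < b -> Rabs (x - x0) < d)).
  { destruct (Rlt_or_le x0 l) as [Hlt|Hge].
    - exists x0, (Rmin l (x0 + d)). assert (A1 := Rmin_l l (x0 + d)). assert (A2 := Rmin_r l (x0 + d)).
      split; [lra|]. split; [apply Rmin_case; lra|]. split; [lra|].
      intros x Hx. rewrite Rabs_right; lra.
    - exists (Rmax 0 (x0 - d)), x0. assert (A1 := Rmax_l 0 (x0 - d)). assert (A2 := Rmax_r 0 (x0 - d)).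
      split; [lra|]. split; [apply Rmax_case; lra|]. split; [lra|].
      intros x Hx. rewrite Rabs_left; lra. }
  destruct Hab as (a & b & Ha & Hab & Hb & HH).
  assert (X : I a < I b) by (apply (increasing_of_deriv I g); auto).
  rewrite !Hz in X by lra. lra.
Qed.

Lemma L2_pos G u e x : wf_graph G -> econt G u -> (e < nE G)%nat -> 0 <= x <= len G e ->
  u e x <> 0 -> 0 < L2_inner G u u.
Proof.
  intros Hwf A He Hx Hn.
  destruct (Hwf e He) as [_ [_ Hl]].
  apply Rlt_le_trans with (RInt (fun x => u e x * u e x) 0 (len G e)).
  - apply (RInt_pos (fun x => u e x * u e x) (len G e) x); auto.
    + intros; apply cont_mult; apply A; auto.
    + intros; apply Rle_0_sqr.
    + assert (0 <= u e x * u e x) by apply Rle_0_sqr.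
      assert (u e x * u e x <> 0) by (apply Rmult_integral_contrapositive; auto). lra.
  - apply (lsum_ge_term (seq 0 (nE G)) (fun e => RInt (fun x => u e x * u e x) 0 (len G e))).
    + intros i Hi. apply in_seq in Hi. destruct (Hwf i) as [_ [_ Hli]]; [lia|].
      apply RInt_ge_0; [lra| |intros; apply Rle_0_sqr].
      apply ex_RInt_cont. intros; apply cont_mult; apply A; lia.
    + apply in_seq; lia.
Qed.

(** Green's formula: each edge leaves a boundary term, and these cancel by [flux_zero] for each
    function with the vertex values of the other as weight. *)
Lemma Hrel_symmetric G W u y w z : wf_graph G -> Hrel G W u y -> Hrel G W w z ->
  econt G y -> econt G z -> L2_inner G y w = L2_inner G u z.
Proof.
  intros Hwf Hu Hw Cy Cz.
  assert (Cu := Hrel_econt _ _ _ _ Hu). assert (Cw := Hrel_econt _ _ _ _ Hw).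
  destruct Hu as (du & ddu & phi & A & B). destruct Hw as (dw & ddw & psi & C & D).
  assert (E : L2_inner G y w - L2_inner G u z =
    lsum (seq 0 (nE G)) (fun e => (u e (len G e) * dw e (len G e) - du e (len G e) * w e (len G e))
      - (u e 0 * dw e 0 - du e 0 * w e 0))).
  { unfold L2_inner. change (@sumR) with (@lsum nat).
    replace (lsum (seq 0 (nE G)) (fun e => RInt (fun x => y e x * w e x) 0 (len G e)) -
             lsum (seq 0 (nE G)) (fun e => RInt (fun x => u e x * z e x) 0 (len G e)))
      with (lsum (seq 0 (nE G)) (fun e => RInt (fun x => y e x * w e x) 0 (len G e)
              + (-1) * RInt (fun x => u e x * z e x) 0 (len G e)))
      by (rewrite lsum_plus, lsum_scal; ring).
    apply lsum_ext. intros e He. apply in_seq in He.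
    destruct (Hwf e) as [_ [_ Hl]]; [lia|].
    destruct A as (A1 & _). destruct C as (C1 & _).
    destruct (A1 e) as (a1 & a2 & a3); [lia|]. destruct (C1 e) as (c1 & c2 & c3); [lia|].
    assert (cy : forall x, continuous (y e) x) by (apply Cy; lia).
    assert (cz : forall x, continuous (z e) x) by (apply Cz; lia).
    assert (cu : forall x, continuous (u e) x) by (apply Cu; lia).
    assert (cw : forall x, continuous (w e) x) by (apply Cw; lia).
    assert (h1 : forall x, continuous (fun x => y e x * w e x) x) by (intros; apply cont_mult; auto).
    assert (h2 : forall x, continuous (fun x => u e x * z e x) x) by (intros; apply cont_mult; auto).
    set (I := fun x => RInt (fun x => y e x * w e x) 0 x + (-1) * RInt (fun x => u e x * z e x) 0 x).
    change (I (len G e) = (u e (len G e) * dw e (len G e) - du e (len G e) * w e (len G e))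
      - (u e 0 * dw e 0 - du e 0 * w e 0)).
    assert (HI : forall x, is_derive I x (y e x * w e x + (-1) * (u e x * z e x))).
    { intros x. apply deriv_plus; [|apply deriv_scal].
      - apply (deriv_RInt (fun x => y e x * w e x)); auto.
      - apply (deriv_RInt (fun x => u e x * z e x)); auto. }
    assert (I0 : I 0 = 0) by (unfold I; rewrite !RInt_same; ring).
    assert (K : I 0 - (u e 0 * dw e 0 - du e 0 * w e 0)
      = I (len G e) - (u e (len G e) * dw e (len G e) - du e (len G e) * w e (len G e))).
    { apply (constant_of_zero_deriv (fun x => I x - (u e x * dw e x - du e x * w e x)) 0 (len G e)); [lra| |].
      - intros x _. apply cont_minus; [eapply deriv_continuous; apply HI|].
        apply cont_minus; apply cont_mult; auto; eapply deriv_continuous; [apply c2|apply a2].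
      - intros x Hx. eapply is_derive_val.
        + apply deriv_minus; [apply HI|]. apply deriv_minus; apply deriv_mult; auto.
        + cbv beta. rewrite B, D by (try lia; lra). ring. }
    rewrite I0 in K. lra. }
  assert (F1 := flux_zero G w dw ddw psi phi Hwf C ltac:(apply A)).
  assert (F2 := flux_zero G u du ddu phi psi Hwf A ltac:(apply C)).
  assert (Z : lsum (seq 0 (nE G)) (fun e => (u e (len G e) * dw e (len G e) - du e (len G e) * w e (len G e))
      - (u e 0 * dw e 0 - du e 0 * w e 0)) =
    lsum (seq 0 (nE G)) (fun e => (psi (src G e) * du e 0 - psi (tgt G e) * du e (len G e))
      + (-1) * (phi (src G e) * dw e 0 - phi (tgt G e) * dw e (len G e)))).
  { apply lsum_ext. intros e He. apply in_seq in He.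
    destruct A as (_ & A2 & _). destruct C as (_ & C2 & _).
    assert (p1 := A2 e false ltac:(lia)). assert (p2 := A2 e true ltac:(lia)).
    assert (p3 := C2 e false ltac:(lia)). assert (p4 := C2 e true ltac:(lia)).
    unfold Defs.pos, vertex_of in *. rewrite p1, p2, p3, p4. ring. }
  rewrite Z, lsum_plus, lsum_scal, F1, F2 in E. lra.
Qed.

(** * The zero count on the graph under H - c *)

Definition vzero (G : mgraph) (phi : nat -> R) (v : nat) : R :=
  if Nat.leb 2 (deg G v) then (if Req_EM_T (phi v) 0 then 1 else 0) else 0.

(** At least [r] zeros. The bound is a real number, possibly negative, so that losses can be
    subtracted without truncation. *)
Definition has_zeros (G : mgraph) (F : gfun) (phi : nat -> R) (r : R) : Prop :=
  exists cnt : nat -> nat,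
    (forall e, (e < nE G)%nat -> nz (F e) 0 (len G e) (cnt e)) /\
    r <= lsum (seq 0 (nE G)) (fun e => INR (cnt e)) + lsum (seq 0 (nV G)) (vzero G phi).

Definition vertex_values (G : mgraph) (F : gfun) (phi : nat -> R) : Prop :=
  forall e b, (e < nE G)%nat -> F e (Defs.pos G e b) = phi (vertex_of G e b).

Lemma vzero_of_is_zero G F phi v : vertex_values G F phi -> is_zero G F (PV v) -> vzero G phi v = 1.
Proof.
  intros HF (Hv & Hd & e & b & He & Hb & Hz). unfold vzero.
  destruct (Nat.leb_spec 2 (deg G v)); [|lia].
  rewrite HF, Hb in Hz by auto. destruct (Req_EM_T (phi v) 0); [auto|contradiction].
Qed.

Definition edge_part (e : nat) (p : gpoint) : list R :=
  match p with PE e' x => if Nat.eqb e' e then x :: nil else nil | PV _ => nil end.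

Definition vertex_part (v : nat) (p : gpoint) : R :=
  match p with PE _ _ => 0 | PV v' => if Nat.eqb v' v then 1 else 0 end.

Lemma in_edge_part e x s : In x (flat_map (edge_part e) s) <-> In (PE e x) s.
Proof.
  rewrite in_flat_map. split.
  - intros [[e' y|v] [Hp Hx]]; simpl in Hx; [|destruct Hx].
    destruct (Nat.eqb_spec e' e) as [->|]; [|destruct Hx]. destruct Hx as [->|[]]. auto.
  - intros H. exists (PE e x). split; auto. simpl. rewrite Nat.eqb_refl. left; auto.
Qed.

Lemma NoDup_edge_part e s : NoDup s -> NoDup (flat_map (edge_part e) s).
Proof.
  induction 1 as [|p s Hn Hd IH]; simpl; [constructor|].
  destruct p as [e' y|v]; simpl; auto. destruct (Nat.eqb_spec e' e) as [->|]; simpl; auto.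
  constructor; auto. rewrite in_edge_part. auto.
Qed.

Lemma vertex_part_le s v (b : R) : NoDup s -> (In (PV v) s -> b = 1) -> 0 <= b ->
  lsum s (vertex_part v) <= b.
Proof.
  intros Hd Hb Hb0.
  assert (H0 : forall s, ~ In (PV v) s -> lsum s (vertex_part v) = 0).
  { intros s' Hn. apply lsum_zero. intros [e x|w] Hi; simpl; auto.
    destruct (Nat.eqb_spec w v) as [->|]; [contradiction|auto]. }
  destruct (classic (In (PV v) s)) as [Hi|Hi]; [|rewrite H0; auto].
  rewrite (Hb Hi). clear Hb. induction Hd as [|p s Hn Hd IH]; [destruct Hi|].
  simpl. destruct (classic (In (PV v) s)) as [Hi'|Hi'].
  - specialize (IH Hi'). destruct p as [e x|w]; simpl; [lra|].
    destruct (Nat.eqb_spec w v) as [->|]; [contradiction|lra].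
  - rewrite H0 by auto. destruct p as [e x|w]; simpl; [lra|].
    destruct (Nat.eqb w v); lra.
Qed.

Lemma has_zeros_of_list G F phi s : vertex_values G F phi -> NoDup s ->
  (forall p, In p s -> is_zero G F p) -> has_zeros G F phi (INR (length s)).
Proof.
  intros HF Hd Hz. exists (fun e => length (flat_map (edge_part e) s)). split.
  - intros e He. apply (nz_of_list _ _ (flat_map (edge_part e) s)); auto.
    + apply NoDup_edge_part; auto.
    + intros x Hx. apply in_edge_part in Hx. destruct (Hz _ Hx) as [_ H]. auto.
  - assert (E : INR (length s) = lsum (seq 0 (nE G)) (fun e => INR (length (flat_map (edge_part e) s)))
       + lsum (seq 0 (nV G)) (fun v => lsum s (vertex_part v))).
    { clear Hd. induction s as [|p s IH].
      - simpl. rewrite !lsum_zero; auto. lra.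
      - cbn [length]. rewrite S_INR, IH by (intros; apply Hz; simpl; auto).
        change (lsum (seq 0 (nV G)) (fun v => lsum (p :: s) (vertex_part v)))
          with (lsum (seq 0 (nV G)) (fun v => vertex_part v p + lsum s (vertex_part v))).
        rewrite (lsum_ext _ (fun e => INR (length (flat_map (edge_part e) (p :: s))))
          (fun e => INR (length (edge_part e p)) + INR (length (flat_map (edge_part e) s))))
          by (intros; simpl; rewrite length_app, plus_INR; auto).
        rewrite (lsum_plus (seq 0 (nE G))).
        rewrite (lsum_plus (seq 0 (nV G)) (fun v => vertex_part v p) (fun v => lsum s (vertex_part v))).
        assert (Hone : lsum (seq 0 (nE G)) (fun e => INR (length (edge_part e p))) +
                  lsum (seq 0 (nV G)) (fun v => vertex_part v p) = 1); [|lra].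
        assert (Hp := Hz p (or_introl eq_refl)). destruct p as [e x|v]; simpl.
        + destruct Hp as [He _]. rewrite (lsum_zero (seq 0 (nV G))) by auto.
          rewrite (lsum_ext _ _ (fun i => if Nat.eqb i e then 1 else 0)).
          * rewrite (lsum_delta (nE G) e (fun _ => 1)) by auto. lra.
          * intros i _. rewrite (Nat.eqb_sym i e). destruct (Nat.eqb e i); simpl; auto.
        + destruct Hp as [Hv _]. rewrite (lsum_zero (seq 0 (nE G))) by auto.
          rewrite (lsum_ext _ _ (fun i => if Nat.eqb i v then 1 else 0)).
          * rewrite (lsum_delta (nV G) v (fun _ => 1)) by auto. lra.
          * intros i _. rewrite (Nat.eqb_sym i v). auto. }
    rewrite E. apply Rplus_le_compat_l. apply lsum_le. intros v _.
    apply vertex_part_le; auto.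
    + intros Hi. apply (vzero_of_is_zero G F); auto.
    + unfold vzero. destruct (Nat.leb 2 (deg G v)); [destruct (Req_EM_T (phi v) 0)|]; lra.
Qed.

Lemma NoDup_app_disjoint {A} (s t : list A) : NoDup s -> NoDup t ->
  (forall x, In x s -> ~ In x t) -> NoDup (s ++ t).
Proof.
  induction 1 as [|x s Hn Hd IH]; intros Ht Hdis; simpl; auto.
  constructor.
  - rewrite in_app_iff. intros [H|H]; [auto|]. apply (Hdis x); simpl; auto.
  - apply IH; auto. intros y Hy. apply Hdis; simpl; auto.
Qed.

Lemma NoDup_map_injective {A B} (g : A -> B) (s : list A) :
  (forall x y, g x = g y -> x = y) -> NoDup s -> NoDup (map g s).
Proof.
  intros Hg. induction 1 as [|x s Hn Hd IH]; simpl; constructor; auto.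
  rewrite in_map_iff. intros [y [E Hy]]. apply Hg in E. subst. auto.
Qed.

Lemma has_zeros_to_list G F phi r : vertex_values G F phi -> has_zeros G F phi r ->
  exists s, NoDup s /\ (forall p, In p s -> is_zero G F p) /\ r <= INR (length s).
Proof.
  intros HF [cnt [Hcnt Hr]].
  assert (HE : forall n, (n <= nE G)%nat -> exists s, NoDup s /\
     (forall p, In p s -> is_zero G F p /\ exists e x, p = PE e x /\ (e < n)%nat) /\
     INR (length s) = lsum (seq 0 n) (fun e => INR (cnt e))).
  { induction n as [|n IH]; intros Hn.
    - exists nil. split; [constructor|]. split; [intros p []|auto].
    - destruct IH as [s [H1 [H2 H3]]]; [lia|].
      destruct (nz_list _ _ _ _ (Hcnt n ltac:(lia))) as [t [T1 [T2 T3]]].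
      exists (s ++ map (PE n) t). split; [|split].
      + apply NoDup_app_disjoint; auto.
        * apply NoDup_map_injective; auto. intros x y E. injection E; auto.
        * intros p Hp Hp'. destruct (H2 p Hp) as [_ [e [x [-> He]]]].
          apply in_map_iff in Hp'. destruct Hp' as [y [E _]]. injection E as E _. lia.
      + intros p Hp. apply in_app_iff in Hp. destruct Hp as [Hp|Hp].
        * destruct (H2 p Hp) as [A [e [x [B C]]]]. split; auto. exists e, x. split; auto.
        * apply in_map_iff in Hp. destruct Hp as [x [<- Hx]]. destruct (T3 x Hx).
          split; [split; [lia|auto]|]. exists n, x. auto.
      + rewrite length_app, length_map, plus_INR, H3, lsum_seq_S, T2. auto. }
  destruct (HE (nE G) (le_n _)) as [s [H1 [H2 H3]]].
  set (isz := fun v => if Nat.leb 2 (deg G v) then (if Req_EM_T (phi v) 0 then true else false) else false).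
  set (t := filter isz (seq 0 (nV G))).
  exists (s ++ map PV t). split; [|split].
  - apply NoDup_app_disjoint; auto.
    + apply NoDup_map_injective; [intros x y E; injection E; auto|].
      apply NoDup_filter, seq_NoDup.
    + intros p Hp Hp'. destruct (H2 p Hp) as [_ [e [x [-> _]]]].
      apply in_map_iff in Hp'. destruct Hp' as [y [E _]]. discriminate.
  - intros p Hp. apply in_app_iff in Hp. destruct Hp as [Hp|Hp]; [apply H2; auto|].
    apply in_map_iff in Hp. destruct Hp as [v [<- Hv]]. apply filter_In in Hv.
    destruct Hv as [Hv Hi]. apply in_seq in Hv. unfold isz in Hi.
    destruct (Nat.leb_spec 2 (deg G v)) as [Hd|]; [|discriminate].
    destruct (Req_EM_T (phi v) 0) as [E|]; [|discriminate].
    split; [lia|]. split; auto.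
    assert (Hl := vends_length G v). destruct (vends G v) as [|[e b] l] eqn:Ev; [simpl in Hl; lia|].
    assert (Hin : In (e, b) (vends G v)) by (rewrite Ev; left; auto).
    apply in_vends in Hin. destruct Hin as [He Hb].
    exists e, b. split; auto. split; auto. rewrite HF, Hb; auto.
  - rewrite length_app, length_map, plus_INR, H3.
    replace (INR (length t)) with (lsum (seq 0 (nV G)) (vzero G phi)); auto.
    rewrite <- (Rmult_1_r (INR (length t))), <- lsum_const. unfold t.
    rewrite lsum_filter. apply lsum_ext. intros v _. unfold vzero, isz.
    destruct (Nat.leb 2 (deg G v)); auto. destruct (Req_EM_T (phi v) 0); auto.
Qed.

Lemma lsum_ge_exception {A} (s : list A) (g : A -> R) p m :
  (forall i, In i s -> m <= g i) -> In p s -> m * INR (length s) + (g p - m) <= lsum s g.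
Proof.
  intros Hm Hp.
  assert (H := lsum_ge_term s (fun i => g i + (-1) * m) p).
  rewrite (lsum_plus s g (fun _ => -1 * m)), lsum_const in H.
  assert (g p + -1 * m <= lsum s g + INR (length s) * (-1 * m)); [|lra].
  apply H; auto. intros i Hi. specialize (Hm i Hi). lra.
Qed.

Lemma exists_nonneg_term {A} (s : list A) (g : A -> R) :
  s <> nil -> lsum s g = 0 -> exists p, In p s /\ 0 <= g p.
Proof.
  intros Hs H0. apply NNPP. intros Hno.
  assert (Hneg : forall p, In p s -> g p < 0).
  { intros p Hp. destruct (Rlt_or_le (g p) 0); auto. exfalso; apply Hno; exists p; auto. }
  clear Hno. destruct s as [|x s]; [congruence|]. simpl in H0.
  assert (lsum s g <= 0).
  { replace 0 with (lsum s (fun _ : A => 0)) by (apply lsum_zero; auto).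
    apply lsum_le. intros; apply Rlt_le, Hneg; right; auto. }
  assert (g x < 0) by (apply Hneg; left; auto). lra.
Qed.

Definition excess (G : mgraph) (v : nat) : R :=
  if Nat.leb 2 (deg G v) then INR (deg G v) - 2 else 0.

(** Here [u] is the value at a vertex at time [t + 1] and [p] the one at time [t]. The loss is 1
    when they force a zero in [[t, t + 1)]; a zero at [t + 1] itself is left to the neighbouring
    step. *)
Definition loss (u p : R) : R :=
  if Req_EM_T u 0 then 0 else if Rle_dec (p * u) 0 then 1 else 0.

(* Kirchhoff's condition provides, at each vertex where [endK] depends on the sign
   of the derivative, an edge on which this sign is the favourable one. *)
Lemma vertex_balance G U dU ddU phiU P dP ddP phiP v :
  in_dom G U dU ddU phiU -> in_dom G P dP ddP phiP ->
  vzero G phiU v - vzero G phiP v - loss (phiU v) (phiP v) * excess G v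
  <= lsum (vends G v) (fun p => INR (endK (phiU v) (phiP v) (outd G dU p)) - 1).
Proof.
  intros (_ & _ & A3 & A4) (_ & _ & B3 & B4).
  unfold vzero, excess. destruct (Nat.leb_spec 2 (deg G v)) as [Hd|Hd].
  - assert (HK : lsum (vends G v) (outd G dU) = 0) by auto.
    assert (Hne : vends G v <> nil).
    { intros E. rewrite <- vends_length, E in Hd. simpl in Hd; lia. }
    assert (Hflag : forall s, exists p, In p (vends G v) /\ 0 <= outd G dU p * s).
    { intros s. destruct (exists_nonneg_term (vends G v) (fun p => s * outd G dU p) Hne) as [p [Hp Hs]].
      - rewrite lsum_scal, HK. ring.
      - exists p. split; auto. lra. }
    rewrite <- vends_length. unfold loss.
    destruct (Req_EM_T (phiU v) 0) as [EU|EU].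
    + destruct (Req_EM_T (phiP v) 0) as [EP|EP].
      * rewrite lsum_zero; [lra|]. intros p _. unfold endK.
        destruct (Req_EM_T (phiU v) 0); [|contradiction].
        destruct (Req_EM_T (phiP v) 0); [|contradiction]. simpl; lra.
      (* The zero of [U] at [v] disappears; the end with the favourable sign has [endK = 2] and
         makes up for it. *)
      * destruct (Hflag (- phiP v)) as [p [Hp Hs]].
        eapply Rle_trans; [|apply (lsum_ge_exception _ _ p 0); auto].
        { unfold endK. destruct (Req_EM_T (phiU v) 0); [|contradiction].
          destruct (Req_EM_T (phiP v) 0); [contradiction|].
          destruct (Rle_dec (outd G dU p * phiP v) 0); [simpl; lra|lra]. }
        intros i _. unfold endK. destruct (Req_EM_T (phiU v) 0); [|contradiction].
        destruct (Req_EM_T (phiP v) 0); [contradiction|].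
        destruct (Rle_dec (outd G dU i * phiP v) 0); simpl; lra.
    + destruct (Rle_dec (phiP v * phiU v) 0) as [Hs|Hs].
      (* Each of the [deg v] ends may lose one zero, but the favourable one has [endK] equal to 2,
         or to 1 if [P] vanishes at [v], and then the zero at [v] itself is gained. The net loss is
         at most [deg v - 2]. *)
      * destruct (Hflag (phiU v)) as [p [Hp Hf]].
        eapply Rle_trans; [|apply (lsum_ge_exception _ _ p (-1)); auto].
        { unfold endK. destruct (Req_EM_T (phiU v) 0); [contradiction|].
          destruct (Rlt_dec 0 (phiP v * phiU v)); [lra|].
          destruct (Rle_dec 0 (outd G dU p * phiU v)); [|lra].
          destruct (Req_EM_T (phiP v) 0); simpl; lra. }
        intros i _. assert (X := pos_INR (endK (phiU v) (phiP v) (outd G dU i))). lra.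
      * rewrite lsum_zero.
        { destruct (Req_EM_T (phiP v) 0) as [E|E]; [rewrite E in Hs; lra|lra]. }
        intros p _. unfold endK. destruct (Req_EM_T (phiU v) 0); [contradiction|].
        destruct (Rlt_dec 0 (phiP v * phiU v)); simpl; lra.
  - destruct (Nat.eq_dec (deg G v) 1) as [E|E].
    + rewrite lsum_zero; [lra|]. intros p _. rewrite A3, B3 by auto. unfold endK.
      destruct (Req_EM_T 0 0); [simpl; lra|lra].
    + assert (Hl := vends_length G v). destruct (vends G v); [simpl; lra|simpl in Hl; lia].
Qed.

Definition nowhere_zero (G : mgraph) (U : gfun) : Prop :=
  forall e, (e < nE G)%nat -> forall a b, 0 <= a -> a < b -> b <= len G e ->
    exists x, a < x < b /\ U e x <> 0.

(** [edge_zero_count] is summed over the edges, and the corrections [endK - 1] are regrouped by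
    vertices to apply [vertex_balance]. *)
Lemma zero_count_step G W c U dU ddU phiU P dP ddP phiP r : wf_graph G ->
  in_dom G U dU ddU phiU -> in_dom G P dP ddP phiP ->
  (forall e x, (e < nE G)%nat -> 0 <= x <= len G e ->
     0 < W e x - c /\ ddU e x = (W e x - c) * U e x - P e x) ->
  nowhere_zero G U -> has_zeros G U phiU r ->
  has_zeros G P phiP (r - lsum (seq 0 (nV G)) (fun v => loss (phiU v) (phiP v) * excess G v)).
Proof.
  intros Hwf HU HP Heq HN [cnt [Hcnt Hr]].
  set (K := fun p : nat * bool => endK (phiU (vertex_of G (fst p) (snd p)))
              (phiP (vertex_of G (fst p) (snd p))) (outd G dU p)).
  exists (fun e => (cnt e + K (e, false) + K (e, true) - 2)%nat). split.
  - intros e He.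
    assert (X := edge_zero_count (len G e) (fun x => W e x - c) (U e) (dU e) (ddU e) (P e) (cnt e)).
    unfold left_K, right_K in X. destruct HU as (A1 & A2 & _). destruct HP as (B1 & B2 & _).
    assert (p1 := A2 e false He). assert (p2 := A2 e true He).
    assert (p3 := B2 e false He). assert (p4 := B2 e true He).
    unfold Defs.pos in *. rewrite p1, p2, p3, p4 in X. apply X; auto.
    destruct (Hwf e He) as [_ [_ Hl]]. destruct (A1 e He) as (a1 & a2 & a3).
    split; auto. split; auto. split; auto.
    split; [apply (smooth2_continuous _ _ _ (B1 e He))|]. split; auto.
  - assert (Hge : lsum (seq 0 (nE G)) (fun e => INR (cnt e) + ((INR (K (e, false)) - 1) + (INR (K (e, true)) - 1)))
       <= lsum (seq 0 (nE G)) (fun e => INR (cnt e + K (e, false) + K (e, true) - 2))).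
    { apply lsum_le. intros e _.
      (* Where the truncated subtraction is cut off at 0, the untruncated value is negative and the
         inequality still holds. *)
      destruct (le_lt_dec 2 (cnt e + K (e, false) + K (e, true))) as [Hle|Hlt].
      - rewrite minus_INR, !plus_INR by auto. simpl. lra.
      - assert (INR (cnt e + K (e, false) + K (e, true)) <= 1) by (apply (le_INR _ 1); lia).
        rewrite !plus_INR in H. assert (X := pos_INR (cnt e + K (e, false) + K (e, true) - 2)). lra. }
    rewrite lsum_plus in Hge.
    rewrite <- (sum_over_vertices G (fun p => INR (K p) - 1) Hwf) in Hge.
    assert (Hv : lsum (seq 0 (nV G)) (fun v => vzero G phiU v + (-1) * vzero G phiP v
                   + (-1) * (loss (phiU v) (phiP v) * excess G v))
       <= lsum (seq 0 (nV G)) (fun v => lsum (vends G v) (fun p => INR (K p) - 1))).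
    { apply lsum_le. intros v _.
      eapply Rle_trans; [|eapply Rle_trans; [apply (vertex_balance G U dU ddU phiU P dP ddP phiP v HU HP)|]].
      - lra.
      - apply Req_le, lsum_ext. intros [e b] Hp. apply in_vends in Hp. destruct Hp as [_ Hp].
        unfold K. simpl. rewrite Hp. auto. }
    rewrite !lsum_plus, !lsum_scal in Hv. lra.
Qed.

(** If [U] vanishes on an interval, so do its derivatives and therefore [P]. *)
Lemma nowhere_zero_step G W c U dU ddU phiU P : wf_graph G -> in_dom G U dU ddU phiU ->
  (forall e x, (e < nE G)%nat -> 0 <= x <= len G e -> ddU e x = (W e x - c) * U e x - P e x) ->
  nowhere_zero G P -> nowhere_zero G U.
Proof.
  intros Hwf (A1 & _) Heq HP e He a b Ha Hab Hb.
  destruct (HP e He a b Ha Hab Hb) as [x [Hx Hn]].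
  apply NNPP. intros Hno. apply Hn.
  assert (HU : forall y, a < y < b -> U e y = 0).
  { intros y Hy. destruct (Req_dec (U e y) 0); auto. exfalso; apply Hno; exists y; auto. }
  destruct (A1 e He) as (a1 & a2 & a3).
  assert (Hd : forall y, a < y < b -> dU e y = 0)
    by (intros y Hy; apply (zero_deriv_of_constant (U e) a b y _ 0 Hy HU (a1 y))).
  assert (Hdd := zero_deriv_of_constant (dU e) a b x _ 0 Hx Hd (a2 x)).
  rewrite Heq, HU in Hdd by (auto; lra). lra.
Qed.

Lemma zero_count_chain G W c (u du ddu : nat -> gfun) (phi : nat -> nat -> R) : wf_graph G ->
  (forall j, in_dom G (u j) (du j) (ddu j) (phi j)) ->
  (forall j e x, (e < nE G)%nat -> 0 <= x <= len G e ->
     0 < W e x - c /\ ddu (S j) e x = (W e x - c) * u (S j) e x - u j e x) ->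
  nowhere_zero G (u 0%nat) ->
  forall J r, has_zeros G (u J) (phi J) r ->
  has_zeros G (u 0%nat) (phi 0%nat) (r - lsum (seq 0 (nV G)) (fun v =>
    lsum (seq 0 J) (fun j => loss (phi (S j) v) (phi j v)) * excess G v)).
Proof.
  intros Hwf Hdom Heq HN.
  assert (HNj : forall j, nowhere_zero G (u j)).
  { induction j as [|j IH]; auto.
    apply (nowhere_zero_step G W c (u (S j)) (du (S j)) (ddu (S j)) (phi (S j)) (u j)); auto.
    intros; apply Heq; auto. }
  induction J as [|J IH]; intros r Hr.
  - destruct Hr as [cnt [H1 H2]]. exists cnt. split; auto.
    rewrite (lsum_zero _ (fun v => lsum (seq 0 0) _ * _)); [lra|]. intros; simpl; ring.
  - apply (zero_count_step G W c (u (S J)) (du (S J)) (ddu (S J)) (phi (S J)) (u J) (du J) (ddu J) (phi J)) in Hr; auto.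
    apply IH in Hr. destruct Hr as [cnt [H1 H2]]. exists cnt. split; auto.
    eapply Rle_trans; [|exact H2]. apply Req_le.
    rewrite (lsum_ext _ (fun v => lsum (seq 0 (S J)) _ * _)
      (fun v => lsum (seq 0 J) (fun j => loss (phi (S j) v) (phi j v)) * excess G v
                + loss (phi (S J) v) (phi J v) * excess G v)).
    + rewrite lsum_plus. lra.
    + intros v _. rewrite lsum_seq_S. change (0 + J)%nat with J. ring.
Qed.

(** Each loss yields a zero of [g] in its own half-open unit interval, so different losses yield
    different zeros. The open interval starts at [t0 - 1] to make room for a zero at [t0]. *)
Lemma loss_zeros (g : R -> R) t0 J : (forall t, continuous g t) ->
  exists m, INR m = lsum (seq 0 J) (fun j => loss (g (t0 + INR (S j))) (g (t0 + INR j))) /\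
    nz g (t0 - 1) (t0 + INR J) m.
Proof.
  intros Hc. induction J as [|J [m [Hm N]]].
  - exists 0%nat. split; simpl; auto.
  - rewrite lsum_seq_S. change (0 + J)%nat with J.
    assert (P := pos_INR J). assert (S1 : INR (S J) = INR J + 1) by apply S_INR.
    set (a := t0 + INR J) in *. replace (t0 + INR (S J)) with (a + 1) by (unfold a; lra).
    unfold loss at 2. destruct (Req_EM_T (g (a + 1)) 0) as [E|E].
    { exists m. split; [lra|]. apply (nz_weaken g m m (t0 - 1) a); auto; lra. }
    destruct (Rle_dec (g a * g (a + 1)) 0) as [Hs|Hs].
    2:{ exists m. split; [lra|]. apply (nz_weaken g m m (t0 - 1) a); auto; lra. }
    assert (Hz : exists x, a <= x < a + 1 /\ g x = 0).
    { destruct (Req_dec (g a) 0) as [Ea|Ea].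
      - exists a. split; auto; lra.
      - destruct (ivt_zero g a (a + 1)) as [x [Hx Ex]]; auto; [lra| |exists x; split; auto; lra].
        assert (g a * g (a + 1) <> 0) by (apply Rmult_integral_contrapositive; auto). lra. }
    destruct Hz as [x [Hx Ex]]. exists (S m). split; [rewrite S_INR; lra|].
    apply (nz_snoc g m (t0 - 1) (a + 1) x); auto; [|unfold a in *; lra].
    apply (nz_weaken g m m (t0 - 1) a); auto; lra.
Qed.

(** * Consequences of genericity *)

Lemma choice_fun {A B : Type} (P : A -> B -> Prop) :
  (forall a, exists b, P a b) -> exists f, forall a, P a (f a).
Proof.
  intros H. exists (fun a => proj1_sig (constructive_indefinite_description _ (H a))).
  intros a. destruct (constructive_indefinite_description _ (H a)); auto.
Qed.

Lemma deg_pos_of_end G e b : (e < nE G)%nat -> (1 <= deg G (vertex_of G e b))%nat.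
Proof.
  intros He. rewrite <- vends_length.
  assert (H : In (e, b) (vends G (vertex_of G e b))) by (apply in_vends; auto).
  destruct (vends G (vertex_of G e b)); [destruct H|simpl; lia].
Qed.

Lemma unique_end G e b e' b' : (e < nE G)%nat -> (e' < nE G)%nat ->
  vertex_of G e b = vertex_of G e' b' -> deg G (vertex_of G e b) = 1%nat -> e = e'.
Proof.
  intros He He' E Hd.
  assert (H : In (e, b) (vends G (vertex_of G e b))) by (apply in_vends; auto).
  assert (H' : In (e', b') (vends G (vertex_of G e b))) by (apply in_vends; auto).
  rewrite <- vends_length in Hd.
  destruct (vends G (vertex_of G e b)) as [|p [|q l]]; simpl in Hd; try lia.
  destruct H as [->|[]]. destruct H' as [H'|[]]. injection H'; auto.
Qed.

(** A path starting at an end of [e] can only run along [e], because no other edge meets its two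
    ends. *)
Lemma isolated_edge G e : wf_graph G -> connected G -> (e < nE G)%nat ->
  (forall b, deg G (vertex_of G e b) = 1%nat) -> forall e', (e' < nE G)%nat -> e' = e.
Proof.
  intros Hwf Hc He Hd e' He'.
  destruct (Hwf e He) as [H1 [H2 _]]. destruct (Hwf e' He') as [H3 [H4 _]].
  assert (HP : forall x y, clos_refl_trans nat (adjacent G) x y ->
     (exists b, x = vertex_of G e b) -> exists b, y = vertex_of G e b).
  { induction 1 as [x y [e1 [He1 Hxy]]|x|x y z _ IH1 _ IH2]; auto.
    intros [b ->].
    assert (E : exists b1 b2, vertex_of G e1 b1 = vertex_of G e b /\ vertex_of G e1 b2 = y).
    { destruct Hxy as [[A B]|[A B]]; [exists false, true|exists true, false]; auto. }
    destruct E as (b1 & b2 & A & B).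
    assert (e = e1) by (apply (unique_end G e b e1 b1); auto). subst e1. exists b2; auto. }
  destruct (HP (src G e) (src G e') (Hc _ _ H1 H3)) as [b Hb]; [exists false; auto|].
  symmetry. apply (unique_end G e b e' false); auto.
Qed.

Lemma deg_pos G v : wf_graph G -> connected G -> (0 < nE G)%nat -> (v < nV G)%nat -> (1 <= deg G v)%nat.
Proof.
  intros Hwf Hc HE Hv.
  destruct (Hwf 0%nat HE) as [H1 _].
  assert (H := Hc v (src G 0) Hv H1). apply clos_rt_rt1n in H.
  inversion H as [E|y z [e [He Hxy]] _ E].
  - change (src G 0) with (vertex_of G 0 false). apply deg_pos_of_end; auto.
  - destruct Hxy as [[A _]|[_ A]]; rewrite <- A.
    + change (src G e) with (vertex_of G e false). apply deg_pos_of_end; auto.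
    + change (tgt G e) with (vertex_of G e true). apply deg_pos_of_end; auto.
Qed.

Definition eigen_data (G : mgraph) (W : gfun) (mu : R) (u du ddu : gfun) (phi : nat -> R) : Prop :=
  in_dom G u du ddu phi /\
  forall e x, (e < nE G)%nat -> 0 <= x <= len G e -> ddu e x = (W e x - mu) * u e x.

Lemma eigen_data_of_solves G W mu f : wf_graph G -> solves_eigen G W mu f ->
  exists u du ddu phi, eigen_data G W mu u du ddu phi /\
    forall e x, (e < nE G)%nat -> 0 <= x <= len G e -> u e x = f e x.
Proof.
  intros Hwf (df & d2f & H1 & H2 & H3 & H4).
  assert (Hex : forall e, exists t : (R -> R) * (R -> R) * (R -> R), (e < nE G)%nat ->
     smooth2 (fst (fst t)) (snd (fst t)) (snd t) /\ forall x, 0 <= x <= len G e ->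
       fst (fst t) x = f e x /\ snd (fst t) x = df e x /\ snd t x = d2f e x).
  { intros e. destruct (lt_dec e (nE G)) as [He|He].
    - destruct (Hwf e He) as [_ [_ Hl]]. destruct (H1 e He) as [HC _].
      destruct (C2_extend (len G e) (f e) (df e) (d2f e) Hl HC) as (g & dg & A & B & C & D).
      exists (g, dg, fun x => d2f e (clamp (len G e) x)). intros _. simpl. split; [split; auto|].
      intros x Hx. destruct (D x Hx). rewrite clamp_id by auto. auto.
    - exists (fun _ => 0, fun _ => 0, fun _ => 0). intros; contradiction. }
  apply choice_fun in Hex. destruct Hex as [t Ht].
  set (u := fun e => fst (fst (t e))). set (du := fun e => snd (fst (t e))).
  set (ddu := fun e => snd (t e)).
  assert (Hpos : forall e b, (e < nE G)%nat -> 0 <= Defs.pos G e b <= len G e).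
  { intros e b He. destruct (Hwf e He) as [_ [_ Hl]]. destruct b; simpl; lra. }
  assert (Hu : forall e x, (e < nE G)%nat -> 0 <= x <= len G e -> u e x = f e x).
  { intros e x He Hx. apply Ht; auto. }
  (* The value at the first end listed; the other ends agree with it by continuity at inner
     vertices, and a boundary vertex has no other end. *)
  set (phi := fun v => match vends G v with nil => 0 | p :: _ => f (fst p) (Defs.pos G (fst p) (snd p)) end).
  assert (Hphi : forall e b, (e < nE G)%nat -> f e (Defs.pos G e b) = phi (vertex_of G e b)).
  { intros e b He. unfold phi.
    assert (Hin : In (e, b) (vends G (vertex_of G e b))) by (apply in_vends; auto).
    destruct (vends G (vertex_of G e b)) as [|[e1 b1] l] eqn:Ev; [destruct Hin|]. simpl.
    assert (Hin1 : In (e1, b1) (vends G (vertex_of G e b))) by (rewrite Ev; left; auto).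
    apply in_vends in Hin1. destruct Hin1 as [He1 Hv1].
    assert (Hd := deg_pos_of_end G e b He).
    destruct (Nat.eq_dec (deg G (vertex_of G e b)) 1) as [E|E].
    - rewrite !H2; auto. rewrite Hv1; auto.
    - apply H3; auto. lia. }
  exists u, du, ddu, phi. split; [split|auto].
  - split; [|split; [|split]].
    + intros e He. apply Ht; auto.
    + intros e b He. rewrite Hu by auto. apply Hphi; auto.
    + intros v Hv. unfold phi. destruct (vends G v) as [|[e b] l] eqn:Ev; auto. simpl.
      assert (Hin : In (e, b) (vends G v)) by (rewrite Ev; left; auto).
      apply in_vends in Hin. destruct Hin as [He Hb]. apply H2; auto. rewrite Hb; auto.
    + intros v Hv. etransitivity; [|exact (H4 v Hv)]. rewrite lsum_vends.
      apply lsum_ext. intros e He. apply in_seq in He.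
      destruct (Hwf e) as [_ [_ Hl]]; [lia|]. unfold outd. simpl.
      assert (E0 : du e 0 = df e 0) by (apply Ht; [lia|lra]).
      assert (El : du e (len G e) = df e (len G e)) by (apply Ht; [lia|lra]).
      rewrite E0, El. reflexivity.
  - intros e x He Hx. destruct (H1 e He) as [_ Heq]. specialize (Heq x Hx).
    assert (E1 : ddu e x = d2f e x) by (apply Ht; auto).
    rewrite E1, Hu by auto. lra.
Qed.

Lemma solves_of_eigen_data G W mu u du ddu phi : eigen_data G W mu u du ddu phi ->
  solves_eigen G W mu u.
Proof.
  intros ((A1 & A2 & A3 & A4) & Heq). exists du, ddu. split; [|split; [|split]].
  - intros e He. destruct (A1 e He) as (a1 & a2 & a3). split; [split; split|].
    + intros; apply a1.
    + intros x _. split; apply continuous_cont_within; eapply deriv_continuous; [apply a1|apply a2].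
    + intros; apply a2.
    + intros x _. split; apply continuous_cont_within; [eapply deriv_continuous; apply a2|apply a3].
    + intros x Hx. rewrite Heq by auto. ring.
  - intros e b He Hd. rewrite A2 by auto. auto.
  - intros e1 b1 e2 b2 H1 H2 E _. rewrite !A2 by auto. rewrite E; auto.
  - intros v Hv. transitivity (lsum (vends G v) (outd G du)); [|auto]. rewrite lsum_vends. reflexivity.
Qed.

Lemma eigen_data_Hrel G W mu u du ddu phi : eigen_data G W mu u du ddu phi ->
  Hrel G W u (fun e x => mu * u e x).
Proof.
  intros (A & B). exists du, ddu, phi. split; auto. intros e x He Hx. rewrite B by auto. ring.
Qed.

Lemma Hrel_eigen_data G W mu u : Hrel G W u (fun e x => mu * u e x) ->
  exists du ddu phi, eigen_data G W mu u du ddu phi.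
Proof.
  intros (du & ddu & phi & A & B). exists du, ddu, phi. split; auto.
  intros e x He Hx. rewrite B by auto. ring.
Qed.

(** If [u] were nonzero elsewhere, it would be an eigenfunction vanishing at both ends of [e].
    Genericity then makes both ends boundary vertices, so [e] is the whole graph. *)
Lemma generic_unique_continuation G W mu u e : wf_graph G -> connected G -> generic G W ->
  Hrel G W u (fun e x => mu * u e x) -> (e < nE G)%nat ->
  (forall x, 0 <= x <= len G e -> u e x = 0) ->
  forall e' x, (e' < nE G)%nat -> 0 <= x <= len G e' -> u e' x = 0.
Proof.
  intros Hwf Hc Hg Hu He H0 e' x He' Hx.
  destruct (Req_dec (u e' x) 0) as [|Hn]; auto. exfalso.
  destruct (Hrel_eigen_data _ _ _ _ Hu) as (du & ddu & phi & HD).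
  assert (Hef : eigenfunction G W mu u).
  { split; [eapply solves_of_eigen_data; eauto|]. exists e', x. auto. }
  assert (Hd : forall b, deg G (vertex_of G e b) = 1%nat).
  { intros b. assert (A := deg_pos_of_end G e b He).
    destruct (le_lt_dec 2 (deg G (vertex_of G e b))) as [H2|]; [|lia]. exfalso.
    apply (Hg mu u Hef e b He H2). apply H0. destruct (Hwf e He) as [_ [_ Hl]]. destruct b; simpl; lra. }
  assert (e' = e) by (apply (isolated_edge G e); auto). subst e'. auto.
Qed.

(** All that is used of the spectral data, for eigenfunctions and a potential extended beyond the
    edges. [sp_complete] is the only form of completeness: no eigenfunction is orthogonal to every
    [F j] with the same eigenvalue. *)
Record spectral (G : mgraph) (W : gfun) (lam : nat -> R) (F : nat -> gfun) : Prop := {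
  sp_wf : wf_graph G;
  sp_edge : (0 < nE G)%nat;
  sp_deg : forall v, (v < nV G)%nat -> (1 <= deg G v)%nat;
  sp_cont : econt G W;
  sp_eigen : forall k, (1 <= k)%nat -> Hrel G W (F k) (fun e x => lam k * F k e x);
  sp_incr : forall j k, (1 <= j)%nat -> (j < k)%nat -> lam j < lam k;
  sp_orth : forall j k, (1 <= j)%nat -> (1 <= k)%nat -> j <> k -> L2_inner G (F j) (F k) = 0;
  sp_norm : forall k, (1 <= k)%nat -> 0 < L2_inner G (F k) (F k);
  sp_complete : forall mu u, Hrel G W u (fun e x => mu * u e x) ->
    (forall j, (1 <= j)%nat -> lam j = mu -> L2_inner G u (F j) = 0) ->
    forall e x, (e < nE G)%nat -> 0 <= x <= len G e -> u e x = 0;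
  sp_inner : forall k e b, (1 <= k)%nat -> (e < nE G)%nat ->
    (2 <= deg G (vertex_of G e b))%nat -> F k e (Defs.pos G e b) <> 0;
  sp_simple : forall k du ddu phi e x, (1 <= k)%nat -> eigen_data G W (lam k) (F k) du ddu phi ->
    (e < nE G)%nat -> 0 <= x <= len G e -> F k e x = 0 -> du e x <> 0 }.

Lemma eigen_data_ext G W W' mu u du ddu phi :
  (forall e x, (e < nE G)%nat -> 0 <= x <= len G e -> W e x = W' e x) ->
  eigen_data G W mu u du ddu phi -> eigen_data G W' mu u du ddu phi.
Proof.
  intros E (A & B). split; auto. intros e x He Hx. rewrite <- E by auto. apply B; auto.
Qed.

Lemma ode_unique_on_edge G W mu u du ddu phi e x0 : wf_graph G -> econt G W ->
  eigen_data G W mu u du ddu phi -> (e < nE G)%nat -> 0 <= x0 <= len G e ->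
  u e x0 = 0 -> du e x0 = 0 -> forall x, 0 <= x <= len G e -> u e x = 0.
Proof.
  intros Hwf Wc ((A1 & _) & B) He Hx0 U0 D0.
  destruct (Hwf e He) as [_ [_ Hl]].
  apply (ode_zero_unique (fun x => W e x - mu) (u e) (du e) (ddu e) (len G e) x0); auto.
  intros x. apply cont_minus; [apply Wc; auto|apply cont_const].
Qed.

(** Genericity is what gives simple zeros and simple eigenvalues. A double zero makes [F k] vanish
    on its edge by uniqueness for the ODE, hence everywhere by [generic_unique_continuation]. *)
Lemma spectral_of_sequence G W lam f : wf_graph G -> connected G -> potential_C1 G W ->
  generic G W -> eigen_sequence G W lam f ->
  exists W' F, spectral G W' lam F /\
    forall k e x, (1 <= k)%nat -> (e < nE G)%nat -> 0 <= x <= len G e -> F k e x = f k e x.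
Proof.
  intros Hwf Hconn [HW _] Hg (S1 & S2 & S3 & S4).
  set (W' := fun e x => W e (clamp (len G e) x)).
  assert (EW : forall e x, (e < nE G)%nat -> 0 <= x <= len G e -> W e x = W' e x).
  { intros e x _ Hx. unfold W'. rewrite clamp_id; auto. }
  assert (CW : econt G W').
  { intros e He. destruct (Hwf e He) as [_ [_ Hl]]. destruct (HW e He) as [dW [_ HC]].
    unfold W'. apply clamp_comp_continuous; auto. intros x Hx. apply HC; auto. }
  assert (Hex : forall k, exists u : gfun, (1 <= k)%nat ->
     (exists du ddu phi, eigen_data G W (lam k) u du ddu phi) /\
     forall e x, (e < nE G)%nat -> 0 <= x <= len G e -> u e x = f k e x).
  { intros k. destruct (le_lt_dec 1 k) as [Hk|Hk].
    - destruct (S1 k Hk) as [Hs _]. destruct (eigen_data_of_solves G W (lam k) (f k) Hwf Hs) as (u & du & ddu & phi & A & B).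
      exists u. intros _. split; auto. exists du, ddu, phi; auto.
    - exists (fun _ _ => 0). intros; lia. }
  apply choice_fun in Hex. destruct Hex as [F HF].
  assert (HE : (0 < nE G)%nat).
  { destruct (S1 1%nat (le_n _)) as [_ [e [x [He _]]]]. lia. }
  assert (HFd : forall k, (1 <= k)%nat -> exists du ddu phi, eigen_data G W (lam k) (F k) du ddu phi)
    by (intros k Hk; apply HF; auto).
  assert (HFh : forall k, (1 <= k)%nat -> Hrel G W (F k) (fun e x => lam k * F k e x)).
  { intros k Hk. destruct (HFd k Hk) as (du & ddu & phi & A). eapply eigen_data_Hrel; eauto. }
  assert (HFf : forall k e x, (1 <= k)%nat -> (e < nE G)%nat -> 0 <= x <= len G e -> F k e x = f k e x)
    by (intros k e x Hk; apply HF; auto).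
  assert (HFc : forall k, (1 <= k)%nat -> econt G (F k))
    by (intros k Hk; eapply Hrel_econt; apply HFh; auto).
  assert (Horth : forall j k, (1 <= j)%nat -> (1 <= k)%nat -> j <> k -> L2_inner G (F j) (F k) = 0).
  { intros j k Hj Hk Hjk. rewrite <- (S3 j k Hj Hk Hjk). apply L2_ext; auto. }
  assert (Hnorm : forall k, (1 <= k)%nat -> 0 < L2_inner G (F k) (F k)).
  { intros k Hk. destruct (S1 k Hk) as [_ [e [x [He [Hx Hn]]]]].
    apply (L2_pos G (F k) e x); auto. rewrite HFf; auto. }
  assert (Hef : forall k, (1 <= k)%nat -> eigenfunction G W (lam k) (F k)).
  { intros k Hk. destruct (HFd k Hk) as (du & ddu & phi & A).
    split; [eapply solves_of_eigen_data; eauto|].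
    destruct (S1 k Hk) as [_ [e [x [He [Hx Hn]]]]]. exists e, x. rewrite HFf; auto. }
  assert (Hnotzero : forall k e, (1 <= k)%nat -> (e < nE G)%nat ->
     ~ (forall x, 0 <= x <= len G e -> F k e x = 0)).
  { intros k e Hk He H0. specialize (Hef k Hk). destruct Hef as [_ [e' [x [He' [Hx Hn]]]]]. apply Hn.
    apply (generic_unique_continuation G W (lam k) (F k) e); auto. }
  assert (Hsimple : forall k du ddu phi e x, (1 <= k)%nat -> eigen_data G W' (lam k) (F k) du ddu phi ->
    (e < nE G)%nat -> 0 <= x <= len G e -> F k e x = 0 -> du e x <> 0).
  { intros k du ddu phi e x Hk HD He Hx E D0.
    apply (Hnotzero k e Hk He). apply (ode_unique_on_edge G W' (lam k) _ du ddu phi e x); auto. }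
  assert (Hext : forall mu u, Hrel G W u (fun e x => mu * u e x) <-> Hrel G W' u (fun e x => mu * u e x)).
  { intros mu u. split; intros H; destruct (Hrel_eigen_data _ _ _ _ H) as (du & ddu & phi & A);
      eapply eigen_data_Hrel; (eapply eigen_data_ext; [|exact A]); auto.
    intros; symmetry; auto. }
  exists W', F. split; [|exact HFf]. split; auto.
  - intros v Hv. apply deg_pos; auto.
  - intros k Hk. apply Hext; auto.
  (* Simplicity of the eigenvalues: for [lam j = lam k], a vanishing combination of [F k] and [F j]
     is constructed in which the coefficient of [F k] is nonzero, contrary to orthogonality. *)
  - intros j k Hj Hjk. assert (Hk : (1 <= k)%nat) by lia.
    destruct (Rle_lt_or_eq_dec (lam j) (lam k)) as [Hlt|Heq]; [apply S2; auto; lia|auto|]. exfalso.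
    assert (Hcomb : forall p r, Hrel G W (fun e x => p * F k e x + r * F j e x)
       (fun e x => lam k * (p * F k e x + r * F j e x))).
    { intros p r.
      assert (Z : Hrel G W (fun _ _ => 0) (fun _ _ => 0)).
      { exists (fun _ _ => 0), (fun _ _ => 0), (fun _ => 0). split; [apply in_dom_zero|intros; ring]. }
      assert (A := Hrel_lin _ _ _ _ _ _ r (Hrel_lin _ _ _ _ _ _ p Z (HFh k Hk)) (HFh j Hj)).
      destruct A as (du & ddu & phi & A & B).
      replace (fun e x => p * F k e x + r * F j e x) with (fun e x => 0 + p * F k e x + r * F j e x).
      - exists du, ddu, phi. split; auto. intros e x He Hx. rewrite B, Heq by auto. ring.
      - apply gfun_ext; intros; ring. }
    assert (Hip : forall p r, L2_inner G (fun e x => p * F k e x + r * F j e x) (F k) = p * L2_inner G (F k) (F k)).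
    { intros p r. rewrite (L2_lin_l G (fun e x => p * F k e x) (F j) (F k) r); auto; [|apply econt_scal; auto].
      rewrite L2_scal_l, (Horth j k) by (auto; lia). ring. }
    assert (Hzero : forall p r, p <> 0 ->
       ~ (forall e x, (e < nE G)%nat -> 0 <= x <= len G e -> p * F k e x + r * F j e x = 0)).
    { intros p r Hp H0. assert (N := Hnorm k Hk). specialize (Hip p r).
      rewrite (L2_ext G _ (fun _ _ => 0) _ (F k)) in Hip; auto.
      rewrite L2_zero_l in Hip. symmetry in Hip. apply Rmult_integral in Hip. destruct Hip; lra. }
    destruct (Hwf 0%nat HE) as [_ [_ Hl]].
    destruct (le_lt_dec 2 (deg G (vertex_of G 0 false))) as [Hd|Hd].
    (* Inner vertex: the coefficients are chosen so that the combination vanishes there. Were it not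
       identically zero, it would be an eigenfunction excluded by genericity. *)
    + assert (Hpj := Hg (lam j) (F j) (Hef j Hj) 0%nat false HE Hd). simpl in Hpj.
      apply (Hzero (F j 0%nat 0) (- F k 0%nat 0) Hpj). intros e x He Hx.
      destruct (Req_dec (F j 0%nat 0 * F k e x + - F k 0%nat 0 * F j e x) 0) as [|Hn]; auto. exfalso.
      assert (Hc := Hcomb (F j 0%nat 0) (- F k 0%nat 0)).
      destruct (Hrel_eigen_data _ _ _ _ Hc) as (du & ddu & phi & A).
      apply (Hg (lam k) _ (conj (solves_of_eigen_data _ _ _ _ _ _ _ A)
        (ex_intro _ e (ex_intro _ x (conj He (conj Hx Hn))))) 0%nat false HE Hd). simpl. ring.
    (* Boundary vertex: both functions vanish there, so the combination that also cancels the
       derivatives is zero on the edge by uniqueness for the ODE. *)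
    + assert (Hd1 : deg G (vertex_of G 0 false) = 1%nat) by (assert (X := deg_pos_of_end G 0 false HE); lia).
      destruct (HFd k Hk) as (duk & dduk & phik & Dk). destruct (HFd j Hj) as (duj & dduj & phij & Dj).
      assert (Zk : F k 0%nat 0 = 0).
      { destruct Dk as ((_ & B2 & B3 & _) & _). assert (X := B2 0%nat false HE). simpl in X. rewrite X. apply B3; auto. }
      assert (Zj : F j 0%nat 0 = 0).
      { destruct Dj as ((_ & B2 & B3 & _) & _). assert (X := B2 0%nat false HE). simpl in X. rewrite X. apply B3; auto. }
      assert (Hpj : duj 0%nat 0 <> 0).
      { apply (Hsimple j duj dduj phij); auto; [|lra]. eapply eigen_data_ext; eauto. }
      apply (Hzero (duj 0%nat 0) (- duk 0%nat 0) Hpj).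
      apply (generic_unique_continuation G W (lam k) (fun e x => duj 0%nat 0 * F k e x + - duk 0%nat 0 * F j e x) 0); auto.
      apply (ode_zero_unique (fun x => W' 0%nat x - lam k) _
        (fun x => duj 0%nat 0 * duk 0%nat x + - duk 0%nat 0 * duj 0%nat x)
        (fun x => duj 0%nat 0 * dduk 0%nat x + - duk 0%nat 0 * dduj 0%nat x) (len G 0) 0); auto.
      * intros x. apply cont_minus; [apply CW; auto|apply cont_const].
      * destruct Dk as ((B1 & _) & _). destruct Dj as ((C1 & _) & _).
        destruct (B1 0%nat HE) as (b1 & b2 & b3). destruct (C1 0%nat HE) as (c1 & c2 & c3).
        split; [|split]; intros x.
        -- apply deriv_plus; apply deriv_scal; auto.
        -- apply deriv_plus; apply deriv_scal; auto.
        -- apply cont_plus; apply cont_mult; auto; apply cont_const.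
      * intros x Hx. destruct Dk as (_ & B). destruct Dj as (_ & C).
        rewrite B, C, Heq, EW by auto. ring.
      * lra.
      * rewrite Zk, Zj. ring.
      * ring.
  - intros mu u Hu Ho. apply Hext in Hu. intros e x He Hx.
    destruct (Req_dec (u e x) 0) as [|Hn]; auto. exfalso.
    destruct (Hrel_eigen_data _ _ _ _ Hu) as (du & ddu & phi & A).
    destruct (S4 mu u) as (n & c & Hc & Hs).
    { split; [eapply solves_of_eigen_data; eauto|]. exists e, x. auto. }
    assert (Cu : econt G u) by (eapply Hrel_econt; eauto).
    assert (P : 0 < L2_inner G u u) by (apply (L2_pos G u e x); auto).
    rewrite (L2_ext G u (fun e x => lsum (seq 1 n) (fun i => c i * F i e x)) u u) in P; auto.
    + rewrite L2_lsum_l in P; auto.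
      * rewrite lsum_zero in P; [lra|]. intros i Hi. apply in_seq in Hi.
        destruct (Req_dec (c i) 0) as [->|Hci]; [ring|].
        rewrite (L2_sym G (F i) u Hwf), Ho; [ring|lia|apply Hc; auto; lia].
      * intros i Hi. apply in_seq in Hi. apply HFc; lia.
    + intros e' x' He' Hx'. split; auto. rewrite Hs by auto.
      apply lsum_ext. intros i Hi. apply in_seq in Hi. rewrite HFf; auto; lia.
  - intros k e b Hk He Hd. apply (Hg (lam k) (F k) (Hef k Hk) e b); auto.
Qed.

(** * Lower nodal bound *)

(** A list of elements of [P] that misses one can be prolonged, and the bound on the length stops
    this. *)
Lemma complete_list {A} (P : A -> Prop) (B : nat) :
  (forall s, NoDup s -> (forall p, In p s -> P p) -> (length s <= B)%nat) ->
  exists s, NoDup s /\ forall p, In p s <-> P p.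
Proof.
  intros HB.
  assert (H : forall n s, NoDup s -> (forall p, In p s -> P p) -> (B <= length s + n)%nat ->
    exists s', NoDup s' /\ forall p, In p s' <-> P p).
  { induction n as [|n IH]; intros s Hd Hs Hl.
    - exists s. split; auto. intros p. split; auto. intros Hp.
      apply NNPP. intros Hn.
      assert (X := HB (p :: s) ltac:(constructor; auto) ltac:(intros q [<-|Hq]; auto)). simpl in X. lia.
    - destruct (classic (exists p, P p /\ ~ In p s)) as [[p [Hp Hn]]|Hno].
      + apply (IH (p :: s)); [constructor; auto| |simpl; lia]. intros q [<-|Hq]; auto.
      + exists s. split; auto. intros p. split; auto. intros Hp.
        apply NNPP. intros Hn. apply Hno. exists p; auto. }
  apply (H B nil); [constructor|intros p []|simpl; lia].
Qed.

Lemma spectral_econt G W lam F k : spectral G W lam F -> (1 <= k)%nat -> econt G (F k).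
Proof. intros HS Hk. eapply Hrel_econt; apply (sp_eigen _ _ _ _ HS); auto. Qed.

Lemma spectral_coefficient G W lam F n b j : spectral G W lam F -> (1 <= j)%nat ->
  L2_inner G (fun e x => lsum (seq 0 n) (fun i => b i * F (S i) e x)) (F j)
  = if Nat.ltb (pred j) n then b (pred j) * L2_inner G (F j) (F j) else 0.
Proof.
  intros HS Hj. rewrite (L2_lsum_l G (fun i => F (S i))).
  - destruct (Nat.ltb_spec (pred j) n) as [H|H].
    + rewrite (lsum_ext _ _ (fun i => if Nat.eqb i (pred j) then b i * L2_inner G (F (S i)) (F j) else 0)).
      * rewrite (lsum_delta n (pred j) (fun i => b i * L2_inner G (F (S i)) (F j))) by auto.
        replace (S (pred j)) with j by lia. auto.
      * intros i _. destruct (Nat.eqb_spec i (pred j)); auto.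
        rewrite (sp_orth _ _ _ _ HS); [ring|lia|lia|lia].
    + apply lsum_zero. intros i Hi. apply in_seq in Hi.
      rewrite (sp_orth _ _ _ _ HS); [ring|lia|lia|lia].
  - intros i _. apply (spectral_econt G W lam); auto. lia.
  - apply (spectral_econt G W lam); auto.
Qed.

Lemma spectral_choice G W lam F : spectral G W lam F ->
  exists (d dd : nat -> gfun) (phi : nat -> nat -> R), forall k, (1 <= k)%nat ->
    eigen_data G W (lam k) (F k) (d k) (dd k) (phi k).
Proof.
  intros HS.
  destruct (choice_fun (fun k (t : gfun * gfun * (nat -> R)) => (1 <= k)%nat ->
    eigen_data G W (lam k) (F k) (fst (fst t)) (snd (fst t)) (snd t))) as [t Ht].
  - intros k. destruct (le_lt_dec 1 k) as [Hk|Hk].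
    + destruct (Hrel_eigen_data _ _ _ _ (sp_eigen _ _ _ _ HS k Hk)) as (du & ddu & phi & A).
      exists (du, ddu, phi). intros _. exact A.
    + exists ((fun _ _ => 0), (fun _ _ => 0), fun _ => 0). intros; lia.
  - exists (fun k => fst (fst (t k))), (fun k => snd (fst (t k))), (fun k => snd (t k)). exact Ht.
Qed.

Definition point_value (F : gfun) (p : gpoint) : R :=
  match p with PE e x => F e x | PV _ => 0 end.

Lemma vertex_value_nonzero G W lam F k u du phi v : spectral G W lam F -> (1 <= k)%nat ->
  in_dom G (F k) u du phi -> (2 <= deg G v)%nat -> phi v <> 0.
Proof.
  intros HS Hk (_ & A2 & _) Hv.
  assert (Hl := vends_length G v). destruct (vends G v) as [|[e b] l] eqn:E; [simpl in Hl; lia|].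
  assert (Hin : In (e, b) (vends G v)) by (rewrite E; left; auto).
  apply in_vends in Hin. destruct Hin as [He Hb]. rewrite <- Hb, <- A2 by auto.
  apply (sp_inner _ _ _ _ HS); auto. rewrite Hb; auto.
Qed.

(** With fewer than [k - 1] zeros, some nonzero [U] in the span of [F 1], ..., [F (k - 1)] vanishes
    at all of them. Picone's inequality summed over the edges makes the form of [H - lam k]
    nonnegative at [U], while by orthogonality its value is a sum of terms
    [c i ^ 2 * (lam (S i) - lam k)] times squared norms, hence negative. *)
Lemma nodal_lower_bound G W lam F k : spectral G W lam F -> (1 <= k)%nat ->
  exists s, NoDup s /\ (forall p, In p s -> is_zero G (F k) p) /\ (k <= S (length s))%nat.
Proof.
  intros HS Hk. apply NNPP. intros Hno.
  assert (Hwf := sp_wf _ _ _ _ HS).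
  (* A list of more than [k] zeros would already refute [Hno], so all zeros can be listed. *)
  destruct (complete_list (is_zero G (F k)) k) as [s [Hd Hs]].
  { intros s Hd Hs. destruct (le_lt_dec (length s) k); auto. exfalso. apply Hno.
    exists s. split; auto. split; auto. lia. }
  assert (Hlen : (length s < k - 1)%nat).
  { destruct (lt_dec (length s) (k - 1)); auto. exfalso. apply Hno. exists s.
    split; auto. split; [intros; apply Hs; auto|lia]. }
  destruct (spectral_choice _ _ _ _ HS) as (d & dd & phi & HD).
  set (n := (k - 1)%nat) in *.
  destruct (homogeneous_system (length s) n (fun i j => point_value (F (S j)) (nth i s (PV 0)))) as [c [[j0 [Hj0 Hc0]] Hc]]; auto.
  set (U := fun e x => lsum (seq 0 n) (fun i => c i * F (S i) e x)).
  set (dU := fun e x => lsum (seq 0 n) (fun i => c i * d (S i) e x)).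
  set (ddU := fun e x => lsum (seq 0 n) (fun i => c i * dd (S i) e x)).
  set (phiU := fun v => lsum (seq 0 n) (fun i => c i * phi (S i) v)).
  set (Y := fun e x => lsum (seq 0 n) (fun i => (c i * lam (S i)) * F (S i) e x)).
  assert (HU : in_dom G U dU ddU phiU).
  { apply (in_dom_lsum G (fun i => F (S i)) (fun i => d (S i))
      (fun i => dd (S i)) (fun i => phi (S i)) c).
    intros i _. apply HD. lia. }
  assert (CU : econt G U).
  { apply (econt_lsum G (fun i => F (S i))). intros; apply (spectral_econt G W lam); auto; lia. }
  assert (CY : econt G Y).
  { apply (econt_lsum G (fun i => F (S i)) (fun i => c i * lam (S i))).
    intros; apply (spectral_econt G W lam); auto; lia. }
  assert (EU : forall e x, (e < nE G)%nat -> 0 <= x <= len G e -> ddU e x = W e x * U e x - Y e x).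
  { intros e x He Hx. unfold ddU, U, Y.
    replace (lsum (seq 0 n) (fun i => c i * lam (S i) * F (S i) e x))
      with (- lsum (seq 0 n) (fun i => (-1) * (c i * lam (S i) * F (S i) e x)))
      by (rewrite lsum_scal; ring).
    rewrite <- lsum_scal. unfold Rminus. rewrite Ropp_involutive, <- lsum_plus.
    apply lsum_ext. intros i _. destruct (HD (S i) ltac:(lia)) as [_ B]. rewrite B by auto. ring. }
  assert (Hzero : forall e x, (e < nE G)%nat -> 0 < x < len G e -> F k e x = 0 -> In (PE e x) s /\ U e x = 0).
  { intros e x He Hx E. assert (Hin : In (PE e x) s) by (apply Hs; split; auto). split; auto.
    destruct (In_nth s (PE e x) (PV 0) Hin) as [i [Hi En]].
    specialize (Hc i Hi). rewrite En in Hc. simpl in Hc. unfold U.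
    rewrite <- Hc. apply lsum_ext. intros; ring. }
  destruct (HD k Hk) as [Dk Ek].
  assert (Hinner : forall v, (2 <= deg G v)%nat -> phi k v <> 0)
    by (intros v; apply (vertex_value_nonzero G W lam F k _ _ _ v HS Hk Dk)).
  assert (Hend : forall e b, (e < nE G)%nat -> phi k (vertex_of G e b) = 0 -> phiU (vertex_of G e b) = 0).
  { intros e b He E. assert (X := deg_pos_of_end G e b He).
    destruct (le_lt_dec 2 (deg G (vertex_of G e b))) as [H2|H2]; [exfalso; apply (Hinner _ H2 E)|].
    apply HU. lia. }
  assert (HP : forall e, (e < nE G)%nat ->
    picone (U e) (dU e) (F k e) (d k e) 0 - picone (U e) (dU e) (F k e) (d k e) (len G e)
    <= RInt (fun x => U e x * (Y e x - lam k * U e x)) 0 (len G e)).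
  { intros e He. destruct (Hwf e He) as [_ [_ Hl]].
    (* The two end points are added because [F k] vanishes at boundary vertices. *)
    apply (picone_inequality (W e) (U e) (dU e) (ddU e) (F k e) (d k e) (dd k e) (Y e) (lam k) (len G e)
       (0 :: len G e :: flat_map (edge_part e) s)); auto.
    - apply HU; auto.
    - apply Dk; auto.
    - intros x Hx E. split; [|split].
      + destruct (Req_dec x 0) as [->|]; [left; auto|]. right.
        destruct (Req_dec x (len G e)) as [->|]; [left; auto|]. right.
        apply in_edge_part. apply Hzero; auto; lra.
      + destruct HU as (_ & U2 & _). destruct Dk as (_ & D2 & _).
        destruct (Req_dec x 0) as [->|].
        { assert (A := U2 e false He). assert (B := D2 e false He). simpl in A, B.
          rewrite A. apply (Hend e false He). simpl. rewrite <- B. auto. }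
        destruct (Req_dec x (len G e)) as [->|].
        { assert (A := U2 e true He). assert (B := D2 e true He). simpl in A, B.
          rewrite A. apply (Hend e true He). simpl. rewrite <- B. auto. }
        apply Hzero; auto; lra.
      + apply (sp_simple _ _ _ _ HS k (d k) (dd k) (phi k)); auto. }
  assert (Hsum : lsum (seq 0 (nE G)) (fun e =>
      picone (U e) (dU e) (F k e) (d k e) 0 - picone (U e) (dU e) (F k e) (d k e) (len G e)) = 0).
  (* Picone's boundary term at an end is [psi * phi k] times the derivative of [U] minus
     [psi * phiU] times that of [F k], so [flux_zero] applies to both parts. *)
  { set (psi := fun v => phiU v * / phi k v).
    assert (F1 := flux_zero G U dU ddU phiU (fun v => psi v * phi k v) Hwf HU).
    assert (F2 := flux_zero G (F k) (d k) (dd k) (phi k) (fun v => psi v * phiU v) Hwf Dk).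
    rewrite (lsum_ext _ _ (fun e =>
      (psi (src G e) * phi k (src G e) * dU e 0 - psi (tgt G e) * phi k (tgt G e) * dU e (len G e))
      + (-1) * (psi (src G e) * phiU (src G e) * d k e 0 - psi (tgt G e) * phiU (tgt G e) * d k e (len G e)))).
    - rewrite lsum_plus, lsum_scal, F1, F2; [ring| |]; intros v Hv; unfold psi;
        destruct HU as (_ & _ & U3 & _); rewrite (U3 v Hv); ring.
    - intros e He. apply in_seq in He. destruct HU as (_ & U2 & _). destruct Dk as (_ & D2 & _).
      assert (A0 := U2 e false ltac:(lia)). assert (B0 := D2 e false ltac:(lia)).
      assert (A1 := U2 e true ltac:(lia)). assert (B1 := D2 e true ltac:(lia)).
      unfold Defs.pos, vertex_of in *. unfold picone. rewrite A0, A1, B0, B1. unfold psi. ring. }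
  assert (Hge : 0 <= L2_inner G U (fun e x => Y e x - lam k * U e x)).
  { rewrite <- Hsum. apply lsum_le. intros e He. apply in_seq in He. apply HP. lia. }
  assert (Hlt : L2_inner G U (fun e x => Y e x - lam k * U e x) < 0).
  { set (b := fun i => c i * (lam (S i) - lam k)).
    rewrite (L2_ext G U U _ (fun e x => lsum (seq 0 n) (fun i => b i * F (S i) e x))); auto.
    2:{ intros e x He Hx. split; auto. unfold Y, U, b.
        replace (lsum (seq 0 n) (fun i => c i * lam (S i) * F (S i) e x) -
           lam k * lsum (seq 0 n) (fun i => c i * F (S i) e x))
        with (lsum (seq 0 n) (fun i => c i * lam (S i) * F (S i) e x + (- lam k) * (c i * F (S i) e x)))
          by (rewrite lsum_plus, lsum_scal; ring).
        apply lsum_ext. intros; ring. }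
    unfold U. rewrite (L2_lsum_l G (fun i => F (S i))).
    - rewrite (lsum_ext _ _ (fun i => - (c i * c i * (lam k - lam (S i)) *
            L2_inner G (F (S i)) (F (S i))))).
      2:{ intros i Hi. apply in_seq in Hi. rewrite L2_sym by auto.
          rewrite (spectral_coefficient G W lam F n b (S i) HS) by lia. simpl pred.
          destruct (Nat.ltb_spec i n); [|lia]. unfold b. ring. }
      assert (Hpos : forall i, In i (seq 0 n) -> 0 <= c i * c i * (lam k - lam (S i)) *
            L2_inner G (F (S i)) (F (S i))).
      { intros i Hi. apply in_seq in Hi. apply Rmult_le_pos; [apply Rmult_le_pos; [apply Rle_0_sqr|]|].
        - assert (lam (S i) < lam k) by (apply (sp_incr _ _ _ _ HS); unfold n in *; lia). lra.
        - apply Rlt_le, (sp_norm _ _ _ _ HS). lia. }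
      assert (Hj : In j0 (seq 0 n)) by (apply in_seq; lia).
      assert (X := lsum_ge_term (seq 0 n) _ j0 Hpos Hj). cbv beta in X.
      rewrite (lsum_ext _ (fun i => - _) (fun i => (-1) * (c i * c i * (lam k - lam (S i)) *
            L2_inner G (F (S i)) (F (S i))))) by (intros; ring).
      rewrite lsum_scal.
      assert (0 < c j0 * c j0 * (lam k - lam (S j0)) * L2_inner G (F (S j0)) (F (S j0))); [|lra].
      apply Rmult_lt_0_compat; [apply Rmult_lt_0_compat|].
      + assert (0 <= c j0 * c j0) by apply Rle_0_sqr.
        assert (c j0 * c j0 <> 0) by (apply Rmult_integral_contrapositive; auto). lra.
      + assert (lam (S j0) < lam k) by (apply (sp_incr _ _ _ _ HS); unfold n in *; lia). lra.
      + apply (sp_norm _ _ _ _ HS). lia.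
    - intros i _. apply (spectral_econt G W lam); auto; lia.
    - apply (econt_lsum G (fun i => F (S i))). intros; apply (spectral_econt G W lam); auto; lia. }
  lra.
Qed.

(** * Bounded resolvents *)

Definition functional := gfun -> gfun -> R.

(** Vertex values, Kirchhoff sums and inner products with [F j] are treated alike, as linear
    functionals of a function together with its derivative, bounded by their sup norms on the
    edges. *)
Definition admissible (G : mgraph) (l : functional) : Prop :=
  (forall z dz w dw c, econt G z -> econt G w ->
     l (fun e x => z e x + c * w e x) (fun e x => dz e x + c * dw e x) = l z dz + c * l w dw) /\
  exists K, 0 <= K /\ forall z dz D, 0 <= D -> econt G z ->
    (forall e x, (e < nE G)%nat -> 0 <= x <= len G e -> Rabs (z e x) <= D /\ Rabs (dz e x) <= D) ->
    Rabs (l z dz) <= K * D.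

Lemma admissible_lsum G l (B dB : nat -> gfun) (x : nat -> R) s : admissible G l ->
  (forall i, In i s -> econt G (B i)) ->
  l (fun e t => lsum s (fun i => x i * B i e t)) (fun e t => lsum s (fun i => x i * dB i e t))
  = lsum s (fun i => x i * l (B i) (dB i)).
Proof.
  intros [Hl _]. induction s as [|i s IH]; intros HB.
  - simpl. assert (Z : econt G (fun _ _ => 0)) by (intros e _ t; apply cont_const).
    assert (X := Hl (fun _ _ => 0) (fun _ _ => 0) (fun _ _ => 0) (fun _ _ => 0) (-1) Z Z).
    cbv beta in X. replace (fun (_ : nat) (_ : R) => 0 + -1 * 0) with (fun (_ : nat) (_ : R) => 0) in X
      by (apply gfun_ext; intros; ring).
    simpl. lra.
  - assert (HB' : forall j, In j s -> econt G (B j)) by (intros; apply HB; right; auto).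
    simpl lsum at 3. rewrite <- IH by auto.
    rewrite Rplus_comm, <- Hl.
    + f_equal; apply gfun_ext; intros; simpl; ring.
    + apply econt_lsum; auto.
    + apply HB; left; auto.
Qed.

(** There are as many functionals as correcting functions [B i], and no nonzero combination of these
    is annihilated by all the functionals. So every [p] has a correction that satisfies all
    conditions, and the inverse matrix controls its size by that of [p] and [dp]. *)
Lemma admissible_system G (n : nat) (B dB : nat -> gfun) (L : list functional) :
  length L = n -> (forall l, In l L -> admissible G l) -> (forall i, (i < n)%nat -> econt G (B i)) ->
  (forall x : nat -> R, (forall l, In l L ->
      l (fun e t => lsum (seq 0 n) (fun i => x i * B i e t))
        (fun e t => lsum (seq 0 n) (fun i => x i * dB i e t)) = 0) ->
    forall i, (i < n)%nat -> x i = 0) ->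
  exists K, 0 <= K /\ forall p dp D, 0 <= D -> econt G p ->
    (forall e x, (e < nE G)%nat -> 0 <= x <= len G e -> Rabs (p e x) <= D /\ Rabs (dp e x) <= D) ->
    exists x : nat -> R, (forall i, (i < n)%nat -> Rabs (x i) <= K * D) /\
      forall l, In l L ->
        l (fun e t => p e t + 1 * lsum (seq 0 n) (fun i => x i * B i e t))
          (fun e t => dp e t + 1 * lsum (seq 0 n) (fun i => x i * dB i e t)) = 0.
Proof.
  intros Hlen HL HB Hinj.
  set (l0 := (fun _ _ => 0) : functional).
  set (l := fun m => nth m L l0).
  assert (Hl : forall m, (m < n)%nat -> admissible G (l m)).
  { intros m Hm. apply HL, nth_In. lia. }
  assert (Hlin : forall m x, (m < n)%nat ->
     l m (fun e t => lsum (seq 0 n) (fun i => x i * B i e t))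
         (fun e t => lsum (seq 0 n) (fun i => x i * dB i e t))
     = lsum (seq 0 n) (fun i => l m (B i) (dB i) * x i)).
  { intros m x Hm. rewrite (admissible_lsum G); [|apply Hl; auto|].
    - apply lsum_ext; intros; ring.
    - intros i Hi. apply in_seq in Hi. apply HB; lia. }
  assert (HB' : forall i, In i (seq 0 n) -> econt G (B i))
    by (intros i Hi; apply in_seq in Hi; apply HB; lia).
  destruct (injective_system_inverse n (fun m i => l m (B i) (dB i))) as [b Hb].
  { intros x Hx. apply Hinj. intros f Hf.
    destruct (In_nth L f l0 Hf) as [m [Hm <-]]. change (nth m L l0) with (l m).
    rewrite Hlin by lia. apply Hx. lia. }
  assert (HK : exists K, 0 <= K /\ forall m, (m < n)%nat -> forall z dz D, 0 <= D -> econt G z ->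
    (forall e x, (e < nE G)%nat -> 0 <= x <= len G e -> Rabs (z e x) <= D /\ Rabs (dz e x) <= D) ->
    Rabs (l m z dz) <= K * D).
  { assert (HKm : forall N, (N <= n)%nat -> exists K, 0 <= K /\ forall m, (m < N)%nat -> forall z dz D, 0 <= D -> econt G z ->
    (forall e x, (e < nE G)%nat -> 0 <= x <= len G e -> Rabs (z e x) <= D /\ Rabs (dz e x) <= D) ->
    Rabs (l m z dz) <= K * D).
    { induction N as [|N IH]; intros HN; [exists 0; split; [lra|intros; lia]|].
      destruct IH as [K1 [P1 Q1]]; [lia|]. destruct (Hl N ltac:(lia)) as [_ [K2 [P2 Q2]]].
      exists (K1 + K2). split; [lra|]. intros m Hm z dz D HD Hz Hb'.
      assert (0 <= K1 * D) by (apply Rmult_le_pos; auto).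
      assert (0 <= K2 * D) by (apply Rmult_le_pos; auto).
      destruct (Nat.eq_dec m N) as [->|].
      - assert (X := Q2 z dz D HD Hz Hb'). lra.
      - assert (X := Q1 m ltac:(lia) z dz D HD Hz Hb'). lra. }
    apply (HKm n); auto. }
  destruct HK as [K1 [HK1 HKb]].
  set (S := lsum (seq 0 n) (fun i => lsum (seq 0 n) (fun m => Rabs (b i m)))).
  assert (HS : forall i, (i < n)%nat -> lsum (seq 0 n) (fun m => Rabs (b i m)) <= S).
  { intros i Hi. apply (lsum_ge_term (seq 0 n) (fun i => lsum (seq 0 n) (fun m => Rabs (b i m)))).
    - intros j _. apply lsum_nonneg. intros; apply Rabs_pos.
    - apply in_seq; lia. }
  assert (HS0 : 0 <= S).
  { apply lsum_nonneg. intros j _. apply lsum_nonneg. intros; apply Rabs_pos. }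
  exists (S * K1). split; [apply Rmult_le_pos; auto|].
  intros p dp D HD Hp Hpb.
  exists (fun i => lsum (seq 0 n) (fun m => b i m * - l m p dp)). split.
  - intros i Hi. eapply Rle_trans; [apply lsum_abs|].
    apply Rle_trans with (lsum (seq 0 n) (fun m => (K1 * D) * Rabs (b i m))).
    + apply lsum_le. intros m Hm. apply in_seq in Hm. rewrite Rabs_mult, Rabs_Ropp, Rmult_comm.
      apply Rmult_le_compat_r; [apply Rabs_pos|]. apply HKb; auto; lia.
    + rewrite lsum_scal. replace (S * K1 * D) with ((K1 * D) * S) by ring.
      apply Rmult_le_compat_l; auto. apply Rmult_le_pos; auto.
  - intros f Hf. destruct (In_nth L f l0 Hf) as [m [Hm <-]]. change (nth m L l0) with (l m).
    destruct (Hl m ltac:(lia)) as [Hlm _]. rewrite Hlm; auto; [|apply econt_lsum; auto].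
    rewrite Hlin, (Hb (fun m => - l m p dp)) by lia. ring.
Qed.

Definition end_value (p : nat * bool) (G : mgraph) : functional :=
  fun z _ => z (fst p) (Defs.pos G (fst p) (snd p)).

(** [deg v] conditions: Dirichlet at degree one; otherwise Kirchhoff's, and equality of each value
    with the first. Over the graph they number [2 |E|], as many as the initial values on the
    edges. *)
Definition vertex_conditions (G : mgraph) (v : nat) : list functional :=
  match vends G v with
  | nil => nil
  | p0 :: nil => end_value p0 G :: nil
  | p0 :: r => (fun _ dz => lsum (vends G v) (outd G dz)) ::
      map (fun p z dz => end_value p G z dz - end_value p0 G z dz) r
  end.

Lemma vertex_conditions_length G v : length (vertex_conditions G v) = deg G v.
Proof.
  rewrite <- vends_length. unfold vertex_conditions.
  destruct (vends G v) as [|p0 [|p1 r]]; auto. simpl. rewrite length_map. auto.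
Qed.

Lemma vertex_conditions_admissible G v l : wf_graph G ->
  In l (vertex_conditions G v) -> admissible G l.
Proof.
  intros Hwf.
  assert (Hpos : forall e b, (e < nE G)%nat -> 0 <= Defs.pos G e b <= len G e).
  { intros e b He. destruct (Hwf e He) as [_ [_ Hl]]. destruct b; simpl; lra. }
  assert (Hin : forall p, In p (vends G v) -> (fst p < nE G)%nat).
  { intros [e b] Hp. apply in_vends in Hp. apply Hp. }
  assert (Hval : forall p, In p (vends G v) -> admissible G (end_value p G)).
  { intros p Hp. split; [reflexivity|].
    exists 1. split; [lra|]. intros z dz D HD _ Hb. unfold end_value.
    rewrite Rmult_1_l. apply Hb; auto. }
  unfold vertex_conditions. destruct (vends G v) as [|p0 [|p1 r]] eqn:E.
  - intros [].
  - intros [<-|[]]. apply Hval; left; auto.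
  - intros [<-|Hl].
    + split.
      * intros z dz w dw c _ _. rewrite <- lsum_scal, <- lsum_plus. apply lsum_ext.
        intros p _. unfold outd. destruct (snd p); ring.
      * exists (INR (length (p0 :: p1 :: r))). split; [apply pos_INR|].
        intros z dz D HD _ Hb. eapply Rle_trans; [apply lsum_abs|].
        rewrite <- lsum_const. apply lsum_le. intros p Hp. specialize (Hin p Hp).
        destruct (Hwf (fst p) Hin) as [_ [_ Hl]]. unfold outd.
        destruct (snd p); [rewrite Rabs_Ropp|]; apply Hb; auto; lra.
    + apply in_map_iff in Hl. destruct Hl as [p [<- Hp]].
      destruct (Hval p (or_intror Hp)) as [A1 [K1 [P1 Q1]]].
      destruct (Hval p0 (or_introl eq_refl)) as [A2 [K2 [P2 Q2]]].
      split.
      * intros z dz w dw c Hz Hw. rewrite A1, A2 by auto. ring.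
      * exists (K1 + K2). split; [lra|]. intros z dz D HD Hz Hb.
        assert (X := Q1 z dz D HD Hz Hb). assert (Y := Q2 z dz D HD Hz Hb).
        unfold Rminus. eapply Rle_trans; [apply Rabs_triang|]. rewrite Rabs_Ropp. lra.
Qed.

Lemma in_dom_of_conditions G z dz ddz :
  (forall e, (e < nE G)%nat -> smooth2 (z e) (dz e) (ddz e)) ->
  (forall v l, In l (vertex_conditions G v) -> l z dz = 0) ->
  exists phi, in_dom G z dz ddz phi.
Proof.
  intros Hs Hl.
  exists (fun v => match vends G v with nil => 0 | p :: _ => end_value p G z dz end).
  split; auto. split; [|split].
  - intros e b He.
    assert (Hin : In (e, b) (vends G (vertex_of G e b))) by (apply in_vends; auto).
    assert (Hv := Hl (vertex_of G e b)). unfold vertex_conditions in Hv.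
    destruct (vends G (vertex_of G e b)) as [|p0 [|p1 r]]; [destruct Hin| |].
    + destruct Hin as [->|[]]. reflexivity.
    + destruct Hin as [->|Hin]; [reflexivity|].
      specialize (Hv (fun z dz => end_value (e, b) G z dz - end_value p0 G z dz)).
      cbv beta in Hv. unfold end_value in *. simpl fst in Hv. simpl snd in Hv.
      assert (X : z e (Defs.pos G e b) - z (fst p0) (Defs.pos G (fst p0) (snd p0)) = 0); [|lra].
      apply Hv. right. apply in_map_iff. exists (e, b). split; auto.
  - intros v Hv. rewrite <- vends_length in Hv. specialize (Hl v). unfold vertex_conditions in Hl.
    destruct (vends G v) as [|p0 [|p1 r]]; auto; [|simpl in Hv; lia].
    apply Hl. left; auto.
  - intros v Hv. rewrite <- vends_length in Hv. specialize (Hl v). unfold vertex_conditions in Hl.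
    destruct (vends G v) as [|p0 [|p1 r]]; try (simpl in Hv; lia).
    apply (Hl (fun _ dz => lsum (p0 :: p1 :: r) (outd G dz))). left; auto.
Qed.

Lemma L2_bound G u w D : wf_graph G -> econt G u -> econt G w ->
  (forall e x, (e < nE G)%nat -> 0 <= x <= len G e -> Rabs (w e x) <= D) ->
  Rabs (L2_inner G u w) <= D * lsum (seq 0 (nE G)) (fun e => RInt (fun x => Rabs (u e x)) 0 (len G e)).
Proof.
  intros Hwf Cu Cw HD. unfold L2_inner. change (@sumR) with (@lsum nat).
  eapply Rle_trans; [apply lsum_abs|]. rewrite <- lsum_scal. apply lsum_le.
  intros e He. apply in_seq in He. assert (He' : (e < nE G)%nat) by lia.
  destruct (Hwf e He') as [_ [_ Hl]].
  assert (ca : forall x, continuous (fun x => Rabs (u e x)) x).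
  { intros x. apply (continuous_comp (u e) Rabs); [apply Cu; auto|apply (continuous_Rabs (u e x))]. }
  assert (cuw : forall x, continuous (fun x => u e x * w e x) x)
    by (intros; apply cont_mult; [apply Cu|apply Cw]; auto).
  assert (Hm : forall s, s = 1 \/ s = -1 ->
     s * RInt (fun x => u e x * w e x) 0 (len G e) <= D * RInt (fun x => Rabs (u e x)) 0 (len G e)).
  { intros s Hs.
    assert (X : D * RInt (fun x => Rabs (u e x)) 0 0 - s * RInt (fun x => u e x * w e x) 0 0
      <= D * RInt (fun x => Rabs (u e x)) 0 (len G e) - s * RInt (fun x => u e x * w e x) 0 (len G e)).
    { apply (nondecreasing_of_deriv
        (fun y => D * RInt (fun x => Rabs (u e x)) 0 y - s * RInt (fun x => u e x * w e x) 0 y)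
        (fun y => D * Rabs (u e y) - s * (u e y * w e y))); [lra| |].
      - intros y. apply deriv_minus; apply deriv_scal.
        + apply (deriv_RInt (fun x => Rabs (u e x))); auto.
        + apply (deriv_RInt (fun x => u e x * w e x)); auto.
      - intros y Hy. specialize (HD e y He' ltac:(lra)).
        assert (Rabs (u e y * w e y) <= D * Rabs (u e y)).
        { rewrite Rabs_mult, Rmult_comm. apply Rmult_le_compat_r; [apply Rabs_pos|auto]. }
        destruct Hs as [-> | ->]; unfold Rabs in *; repeat destruct Rcase_abs; lra. }
    rewrite !RInt_same in X. lra. }
  assert (M1 := Hm 1 (or_introl eq_refl)). assert (M2 := Hm (-1) (or_intror eq_refl)).
  unfold Rabs at 1; destruct Rcase_abs; lra.
Qed.

Definition total_length (G : mgraph) : R := lsum (seq 0 (nE G)) (len G).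

(** Cauchy-Schwarz against the constant 1, by integrating [(|u| - m)^2 >= 0] and choosing
    [m = N / total_length G]. For total length 0 a suitable large [m] excludes [N <> 0]. *)
Lemma L1_L2 G u : wf_graph G -> econt G u ->
  let N := lsum (seq 0 (nE G)) (fun e => RInt (fun x => Rabs (u e x)) 0 (len G e)) in
  0 <= N /\ N * N <= total_length G * L2_inner G u u.
Proof.
  intros Hwf Cu N.
  assert (ca : forall e, (e < nE G)%nat -> forall x, continuous (fun x => Rabs (u e x)) x).
  { intros e He x. apply (continuous_comp (u e) Rabs); [apply Cu; auto|apply (continuous_Rabs (u e x))]. }
  assert (cu : forall e, (e < nE G)%nat -> forall x, continuous (fun x => u e x * u e x) x)
    by (intros; apply cont_mult; apply Cu; auto).
  assert (HN : 0 <= N).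
  { apply lsum_nonneg. intros e He. apply in_seq in He. destruct (Hwf e) as [_ [_ Hl]]; [lia|].
    apply RInt_ge_0; [lra|apply ex_RInt_cont, ca; lia|intros; apply Rabs_pos]. }
  split; auto.
  assert (HL : 0 <= total_length G).
  { apply lsum_nonneg. intros e He. apply in_seq in He. destruct (Hwf e) as [_ [_ Hl]]; [lia|lra]. }
  assert (Hm : forall m, 2 * m * N <= L2_inner G u u + m * m * total_length G).
  { intros m. unfold N, total_length, L2_inner. change (@sumR) with (@lsum nat).
    rewrite <- !lsum_scal, <- lsum_plus. apply lsum_le. intros e He. apply in_seq in He.
    assert (He' : (e < nE G)%nat) by lia. destruct (Hwf e He') as [_ [_ Hl]].
    assert (X : RInt (fun x => u e x * u e x) 0 0 + m * m * 0 - 2 * m * RInt (fun x => Rabs (u e x)) 0 0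
      <= RInt (fun x => u e x * u e x) 0 (len G e) + m * m * len G e - 2 * m * RInt (fun x => Rabs (u e x)) 0 (len G e)).
    { apply (nondecreasing_of_deriv
        (fun y => RInt (fun x => u e x * u e x) 0 y + m * m * y - 2 * m * RInt (fun x => Rabs (u e x)) 0 y)
        (fun y => (u e y * u e y + m * m * 1) - 2 * m * Rabs (u e y))); [lra| |].
      - intros y. apply deriv_minus; [apply deriv_plus|apply deriv_scal].
        + apply (deriv_RInt (fun x => u e x * u e x)); auto.
        + apply deriv_scal, (is_derive_id y).
        + apply (deriv_RInt (fun x => Rabs (u e x))); auto.
      - intros y _. assert (Y : 0 <= (Rabs (u e y) - m) * (Rabs (u e y) - m)) by apply Rle_0_sqr.
        assert (Z : Rabs (u e y) * Rabs (u e y) = u e y * u e y) by (symmetry; apply (Rsqr_abs (u e y))).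
        lra. }
    rewrite !RInt_same in X. lra. }
  destruct (Req_dec (total_length G) 0) as [E|E].
  - rewrite E, Rmult_0_l. rewrite E in Hm.
    destruct (Req_dec N 0) as [->|HN0]; [lra|]. exfalso.
    specialize (Hm ((L2_inner G u u + 1) / (2 * N))).
    replace (2 * ((L2_inner G u u + 1) / (2 * N)) * N) with (L2_inner G u u + 1) in Hm by (field; auto). lra.
  - assert (0 < total_length G) by lra.
    specialize (Hm (N / total_length G)).
    assert (Y : 2 * (N / total_length G) * N = 2 * (N * N / total_length G)) by (field; auto).
    assert (Z : N / total_length G * (N / total_length G) * total_length G = N * N / total_length G) by (field; auto).
    rewrite Y, Z in Hm. replace (N * N) with (total_length G * (N * N / total_length G)) by (field; auto).
    apply Rmult_le_compat_l; lra.
Qed.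

Lemma econt_bounded G u : wf_graph G -> econt G u ->
  exists K, 0 <= K /\ forall e x, (e < nE G)%nat -> 0 <= x <= len G e -> Rabs (u e x) <= K.
Proof.
  intros Hwf Cu.
  assert (H : forall N, (N <= nE G)%nat -> exists K, 0 <= K /\
     forall e x, (e < N)%nat -> 0 <= x <= len G e -> Rabs (u e x) <= K).
  { induction N as [|N IH]; intros HN; [exists 0; split; [lra|intros; lia]|].
    destruct IH as [K1 [P1 Q1]]; [lia|]. destruct (Hwf N) as [_ [_ Hl]]; [lia|].
    destruct (cont_bounded (u N) 0 (len G N)) as [K2 [P2 Q2]]; [lra|apply Cu; lia|].
    exists (K1 + K2). split; [lra|]. intros e x He Hx.
    destruct (Nat.eq_dec e N) as [->|].
    - specialize (Q2 x Hx). lra.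
    - specialize (Q1 e x ltac:(lia) Hx). lra. }
  apply (H (nE G)); auto.
Qed.

Lemma family_bounded G (u : nat -> gfun) n : wf_graph G -> (forall i, (i < n)%nat -> econt G (u i)) ->
  exists K, 0 <= K /\ forall i e x, (i < n)%nat -> (e < nE G)%nat -> 0 <= x <= len G e ->
    Rabs (u i e x) <= K.
Proof.
  intros Hwf. induction n as [|n IH]; intros Cu; [exists 0; split; [lra|intros; lia]|].
  destruct IH as [K1 [P1 Q1]]; [intros; apply Cu; lia|].
  destruct (econt_bounded G (u n) Hwf (Cu n (le_n _))) as [K2 [P2 Q2]].
  exists (K1 + K2). split; [lra|]. intros i e x Hi He Hx.
  destruct (Nat.eq_dec i n) as [->|].
  - specialize (Q2 e x He Hx). lra.
  - specialize (Q1 i e x ltac:(lia) He Hx). lra.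
Qed.

Record fundamental := Fundamental {
  fd_c : R -> R; fd_dc : R -> R; fd_ddc : R -> R;
  fd_s : R -> R; fd_ds : R -> R; fd_dds : R -> R; fd_K : R }.

Definition L1 (G : mgraph) (u : gfun) : R :=
  lsum (seq 0 (nE G)) (fun e => RInt (fun x => Rabs (u e x)) 0 (len G e)).

Lemma edge_solutions G W mu : wf_graph G -> econt G W ->
  exists t : nat -> fundamental,
    (forall e, (e < nE G)%nat ->
       smooth2 (fd_c (t e)) (fd_dc (t e)) (fd_ddc (t e)) /\ smooth2 (fd_s (t e)) (fd_ds (t e)) (fd_dds (t e)) /\
       fd_c (t e) 0 = 1 /\ fd_dc (t e) 0 = 0 /\ fd_s (t e) 0 = 0 /\ fd_ds (t e) 0 = 1 /\
       forall x, 0 <= x <= len G e ->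
         fd_ddc (t e) x = (W e x - mu) * fd_c (t e) x /\ fd_dds (t e) x = (W e x - mu) * fd_s (t e) x) /\
    exists K, 0 <= K /\ forall phi, econt G phi ->
      exists p dp ddp : gfun, (forall e, (e < nE G)%nat ->
        smooth2 (p e) (dp e) (ddp e) /\ p e 0 = 0 /\ dp e 0 = 0 /\
        forall x, 0 <= x <= len G e -> ddp e x = (W e x - mu) * p e x + phi e x /\
          Rabs (p e x) <= K * L1 G phi /\ Rabs (dp e x) <= K * L1 G phi).
Proof.
  intros Hwf CW.
  assert (Hex : forall e, exists t : fundamental, (e < nE G)%nat ->
       (smooth2 (fd_c t) (fd_dc t) (fd_ddc t) /\ smooth2 (fd_s t) (fd_ds t) (fd_dds t) /\
       fd_c t 0 = 1 /\ fd_dc t 0 = 0 /\ fd_s t 0 = 0 /\ fd_ds t 0 = 1 /\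
       (forall x, 0 <= x <= len G e ->
         fd_ddc t x = (W e x - mu) * fd_c t x /\ fd_dds t x = (W e x - mu) * fd_s t x)) /\
       0 <= fd_K t /\ forall phi : R -> R, (forall x, continuous phi x) ->
      exists z dz ddz : R -> R, smooth2 z dz ddz /\ z 0 = 0 /\ dz 0 = 0 /\
        (forall x, 0 <= x <= len G e -> ddz x = (W e x - mu) * z x + phi x) /\
        (forall x, 0 <= x <= len G e ->
           Rabs (z x) <= fd_K t * RInt (fun t => Rabs (phi t)) 0 (len G e) /\
           Rabs (dz x) <= fd_K t * RInt (fun t => Rabs (phi t)) 0 (len G e))).
  { intros e. destruct (lt_dec e (nE G)) as [He|He].
    - destruct (Hwf e He) as [_ [_ Hl]].
      destruct (ode_solver (fun x => W e x - mu) (len G e) Hl) as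
        (c & dc & ddc & s & ds & dds & K & A1 & A2 & A3 & A4 & A5 & A6 & A7 & A8 & A9).
      { intros x. apply cont_minus; [apply CW; auto|apply cont_const]. }
      exists (Fundamental c dc ddc s ds dds K). intros _. simpl. repeat (split; auto).
    - exists (Fundamental (fun _ => 0) (fun _ => 0) (fun _ => 0) (fun _ => 0) (fun _ => 0) (fun _ => 0) 0).
      intros; contradiction. }
  apply choice_fun in Hex. destruct Hex as [t Ht].
  exists t. split; [intros e He; apply Ht; auto|].
  set (K := lsum (seq 0 (nE G)) (fun e => fd_K (t e))).
  assert (HKe : forall e, In e (seq 0 (nE G)) -> 0 <= fd_K (t e)).
  { intros e He. apply in_seq in He. apply Ht; lia. }
  exists K. split; [apply lsum_nonneg; auto|]. intros phi Cphi.
  assert (Hp : forall e, exists z : (R -> R) * (R -> R) * (R -> R), (e < nE G)%nat ->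
     smooth2 (fst (fst z)) (snd (fst z)) (snd z) /\ fst (fst z) 0 = 0 /\ snd (fst z) 0 = 0 /\
     forall x, 0 <= x <= len G e -> snd z x = (W e x - mu) * fst (fst z) x + phi e x /\
       Rabs (fst (fst z) x) <= K * L1 G phi /\ Rabs (snd (fst z) x) <= K * L1 G phi).
  { intros e. destruct (lt_dec e (nE G)) as [He|He].
    2:{ exists (fun _ => 0, fun _ => 0, fun _ => 0). intros; contradiction. }
    destruct (Ht e He) as [_ [_ Hs]].
    destruct (Hs (phi e) (Cphi e He)) as (z & dz & ddz & B1 & B2 & B3 & B4 & B5).
    assert (Hint : forall i, In i (seq 0 (nE G)) -> 0 <= RInt (fun x => Rabs (phi i x)) 0 (len G i)).
    { intros i Hi. apply in_seq in Hi. destruct (Hwf i) as [_ [_ Hl]]; [lia|].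
      apply RInt_ge_0; [lra| |intros; apply Rabs_pos]. apply ex_RInt_cont. intros x.
      apply (continuous_comp (phi i) Rabs); [apply Cphi; lia|apply (continuous_Rabs (phi i x))]. }
    assert (Hin : In e (seq 0 (nE G))) by (apply in_seq; lia).
    assert (HKN : fd_K (t e) * RInt (fun x => Rabs (phi e x)) 0 (len G e) <= K * L1 G phi).
    { apply Rmult_le_compat; auto.
      - apply (lsum_ge_term (seq 0 (nE G)) (fun e => fd_K (t e))); auto.
      - apply (lsum_ge_term (seq 0 (nE G)) (fun e => RInt (fun x => Rabs (phi e x)) 0 (len G e))); auto. }
    exists (z, dz, ddz). intros _. simpl. split; auto. split; auto. split; auto.
    intros x Hx. destruct (B5 x Hx). split; auto. split; lra. }
  apply choice_fun in Hp. destruct Hp as [z Hz].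
  exists (fun e => fst (fst (z e))), (fun e => snd (fst (z e))), (fun e => snd (z e)).
  exact Hz.
Qed.

(** By symmetry of H, testing the equation against [F k] leaves only the term with [T]. *)
Lemma Hrel_orthogonal_rhs G W lam F k mu z y T : spectral G W lam F -> (1 <= k)%nat ->
  Hrel G W z (fun e x => (y e x + mu * z e x) + (-1) * T e x) -> econt G y -> econt G T ->
  L2_inner G z (F k) = 0 -> L2_inner G y (F k) = 0 -> L2_inner G T (F k) = 0.
Proof.
  intros HS Hk HH Cy CT Hz Hy.
  assert (Cz := Hrel_econt _ _ _ _ HH). assert (CF := spectral_econt _ _ _ _ k HS Hk).
  assert (X := Hrel_symmetric G W z _ (F k) _ (sp_wf _ _ _ _ HS) HH (sp_eigen _ _ _ _ HS k Hk)).
  rewrite L2_lin_l, L2_lin_l in X; auto.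
  - rewrite (L2_sym G z (fun e x => lam k * F k e x)) in X by apply (sp_wf _ _ _ _ HS).
    rewrite L2_scal_l in X by auto.
    rewrite (L2_sym G (F k) z) in X by apply (sp_wf _ _ _ _ HS).
    rewrite Hz, Hy in X.
    enough (0 + mu * 0 + -1 * L2_inner G T (F k) = lam k * 0) by lra. apply X.
    + apply econt_lin; auto. apply econt_lin; auto.
    + apply econt_scal; auto.
  - apply econt_lin; auto.
Qed.

(** An eigenvalue [mu <= lam k] can only be one of [lam 1], ..., [lam k], so orthogonality to the
    first [k] functions is all that [sp_complete] asks for. *)
Lemma spectral_injective G W lam F k mu u : spectral G W lam F -> (1 <= k)%nat -> mu <= lam k ->
  Hrel G W u (fun e x => mu * u e x) -> (forall j, (1 <= j <= k)%nat -> L2_inner G u (F j) = 0) ->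
  forall e x, (e < nE G)%nat -> 0 <= x <= len G e -> u e x = 0.
Proof.
  intros HS Hk Hmu Hu Ho. apply (sp_complete _ _ _ _ HS mu u Hu).
  intros j Hj E. apply Ho. split; auto.
  destruct (le_lt_dec j k); auto. exfalso.
  assert (lam k < lam j) by (apply (sp_incr _ _ _ _ HS); auto). lra.
Qed.

Lemma deriv_zero_at_start (u du : R -> R) l : 0 < l -> (forall x, is_derive u x (du x)) ->
  (forall x, 0 <= x <= l -> u x = 0) -> du 0 = 0.
Proof.
  intros Hl Hd H0.
  destruct (Rtotal_order (du 0) 0) as [H|[H|H]]; auto; exfalso.
  - destruct (deriv_neg_right u 0 (du 0) (Hd 0) H) as [e [He Hx]].
    set (m := Rmin e l). assert (m <= e) by apply Rmin_l. assert (m <= l) by apply Rmin_r.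
    assert (0 < m) by (apply Rmin_case; lra).
    specialize (Hx (m / 2) ltac:(lra)). rewrite !H0 in Hx by lra. lra.
  - destruct (deriv_pos_right u 0 (du 0) (Hd 0) H) as [e [He Hx]].
    set (m := Rmin e l). assert (m <= e) by apply Rmin_l. assert (m <= l) by apply Rmin_r.
    assert (0 < m) by (apply Rmin_case; lra).
    specialize (Hx (m / 2) ltac:(lra)). rewrite !H0 in Hx by lra. lra.
Qed.

Lemma double_count G : wf_graph G ->
  list_sum (map (deg G) (seq 0 (nV G))) = (2 * nE G)%nat.
Proof.
  intros Hwf. apply INR_eq.
  assert (E : forall s, INR (list_sum (map (deg G) s)) = lsum s (fun v => INR (deg G v))).
  { induction s as [|v s IH]; simpl; auto. rewrite plus_INR, IH. auto. }
  rewrite E, mult_INR. rewrite (lsum_ext _ _ (fun v => lsum (vends G v) (fun _ => 1))).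
  - rewrite (sum_over_vertices G (fun _ => 1) Hwf). rewrite lsum_const, length_seq. simpl. ring.
  - intros v _. rewrite lsum_const, vends_length. ring.
Qed.

(* Unknowns: the values [z e 0], [z' e 0] on each edge (indices [2 e], [2 e + 1]) and multipliers
   of [F 1], ..., [F k] on the right-hand side (indices from [2 nE] on). *)
Lemma resolvent_bounded G W lam F k mu : spectral G W lam F -> (1 <= k)%nat -> mu <= lam k ->
  exists C, 0 <= C /\ forall y, econt G y ->
    (forall j, (1 <= j <= k)%nat -> L2_inner G y (F j) = 0) ->
    exists z, Hrel G W z (fun e x => y e x + mu * z e x) /\
      (forall j, (1 <= j <= k)%nat -> L2_inner G z (F j) = 0) /\
      Rabs (L2_inner G y z) <= C * L2_inner G y y.
Proof.
  intros HS Hk Hmu. assert (Hwf := sp_wf _ _ _ _ HS).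
  assert (CF : forall j, (1 <= j)%nat -> econt G (F j)) by (intros; eapply spectral_econt; eauto).
  destruct (edge_solutions G W mu Hwf (sp_cont _ _ _ _ HS)) as (t & Ht & K & HK & HP).
  assert (HG : forall j, exists p : gfun * gfun * gfun, (1 <= j)%nat -> forall e, (e < nE G)%nat ->
     smooth2 (fst (fst p) e) (snd (fst p) e) (snd p e) /\ fst (fst p) e 0 = 0 /\ snd (fst p) e 0 = 0 /\
     forall x, 0 <= x <= len G e -> snd p e x = (W e x - mu) * fst (fst p) e x + F j e x).
  { intros j. destruct (le_lt_dec 1 j) as [Hj|Hj].
    - destruct (HP (F j) (CF j Hj)) as (p & dp & ddp & H). exists (p, dp, ddp). intros _ e He. simpl.
      destruct (H e He) as (A & B & C & D). split; auto. split; auto. split; auto.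
      intros x Hx. apply D; auto.
    - exists ((fun _ _ => 0), (fun _ _ => 0), (fun _ _ => 0)). intros; lia. }
  apply choice_fun in HG. destruct HG as [g Hg].
  (* [mu] may itself be an eigenvalue, so the equation alone need not be solvable. The [k]
     multipliers answer to the [k] orthogonality conditions, and the [2 nE] initial values to the
     vertex conditions, which makes the system square. *)
  set (E2 := (2 * nE G)%nat). set (n := (E2 + k)%nat).
  set (pick := fun (c s r : nat -> R -> R) (i e : nat) (x : R) =>
     if Nat.ltb i E2 then (if Nat.eqb i (2 * e) then c e x else if Nat.eqb i (2 * e + 1) then s e x else 0)
     else r e x).
  set (B := fun i => pick (fun e => fd_c (t e)) (fun e => fd_s (t e)) (fst (fst (g (S (i - E2))))) i : gfun).
  set (dB := fun i => pick (fun e => fd_dc (t e)) (fun e => fd_ds (t e)) (snd (fst (g (S (i - E2))))) i : gfun).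
  set (ddB := fun i => pick (fun e => fd_ddc (t e)) (fun e => fd_dds (t e)) (snd (g (S (i - E2)))) i : gfun).
  set (T := fun i (e : nat) (x : R) => if Nat.ltb i E2 then 0 else F (S (i - E2)) e x).
  assert (HBs : forall i e, (e < nE G)%nat -> smooth2 (B i e) (dB i e) (ddB i e)).
  { intros i e He. unfold B, dB, ddB, pick. destruct (Nat.ltb i E2).
    - destruct (Nat.eqb i (2 * e)); [apply Ht; auto|]. destruct (Nat.eqb i (2 * e + 1)); [apply Ht; auto|].
      split; [|split]; intros; try apply deriv_const. apply cont_const.
    - apply (Hg (S (i - E2))); auto; lia. }
  assert (CB : forall i, econt G (B i)).
  { intros i e He. apply (smooth2_continuous _ _ _ (HBs i e He)). }
  assert (CT : forall i, econt G (T i)).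
  { intros i e He x. unfold T. destruct (Nat.ltb i E2); [apply cont_const|apply CF; auto; lia]. }
  assert (HBd : forall i e x, (e < nE G)%nat -> 0 <= x <= len G e ->
     ddB i e x = (W e x - mu) * B i e x + T i e x).
  { intros i e x He Hx. unfold B, dB, ddB, pick, T. destruct (Nat.ltb i E2).
    - destruct (Ht e He) as (_ & _ & _ & _ & _ & _ & H). destruct (H x Hx) as [H1 H2].
      destruct (Nat.eqb i (2 * e)); [rewrite H1; ring|]. destruct (Nat.eqb i (2 * e + 1)); [rewrite H2; ring|ring].
    - apply (Hg (S (i - E2))); auto; lia. }
  assert (HB0 : forall i e, (e < nE G)%nat -> B i e 0 = (if Nat.eqb i (2 * e) then 1 else 0) /\
                                      dB i e 0 = (if Nat.eqb i (2 * e + 1) then 1 else 0)).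
  { intros i e He. destruct (Ht e He) as (_ & _ & H1 & H2 & H3 & H4 & _).
    unfold B, dB, pick. destruct (Nat.ltb_spec i E2) as [Hi|Hi].
    - destruct (Nat.eqb_spec i (2 * e)); destruct (Nat.eqb_spec i (2 * e + 1)); try lia; auto.
    - destruct (Hg (S (i - E2)) ltac:(lia) e He) as (_ & G1 & G2 & _).
      destruct (Nat.eqb_spec i (2 * e)); [unfold E2 in *; lia|].
      destruct (Nat.eqb_spec i (2 * e + 1)); [unfold E2 in *; lia|]. auto. }
  set (L := flat_map (vertex_conditions G) (seq 0 (nV G)) ++
     map (fun j (z _ : gfun) => L2_inner G z (F j)) (seq 1 k)).
  assert (HLlen : length L = n).
  { unfold L, n, E2. rewrite length_app, length_map, length_seq, <- (double_count G Hwf). f_equal.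
    rewrite length_flat_map. f_equal. apply map_ext. intros; apply vertex_conditions_length. }
  assert (HLadm : forall l, In l L -> admissible G l).
  { intros l Hl. apply in_app_iff in Hl. destruct Hl as [Hl|Hl].
    - apply in_flat_map in Hl. destruct Hl as [v [_ Hl]]. eapply vertex_conditions_admissible; eauto.
    - apply in_map_iff in Hl. destruct Hl as [j [<- Hj]]. apply in_seq in Hj.
      assert (Cj : econt G (F j)) by (apply CF; lia). split.
      + intros z dz w dw c Hz Hw. apply L2_lin_l; auto.
      + exists (L1 G (F j)).
        split; [apply (L1_L2 G (F j) Hwf Cj)|].
        intros z dz D HD Hz Hb. rewrite (L2_sym G z) by auto. rewrite Rmult_comm.
        apply L2_bound; auto. intros; apply Hb; auto. }
  assert (Hdom : forall z dz ddz, (forall e, (e < nE G)%nat -> smooth2 (z e) (dz e) (ddz e)) ->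
     (forall l, In l L -> l z dz = 0) ->
     (exists phi, in_dom G z dz ddz phi) /\ forall j, (1 <= j <= k)%nat -> L2_inner G z (F j) = 0).
  { intros z dz ddz Hs Hl. split.
    - apply in_dom_of_conditions; auto. intros v l Hv.
      destruct (lt_dec v (nV G)) as [H|H].
      + apply Hl. apply in_app_iff. left. apply in_flat_map. exists v. split; auto. apply in_seq; lia.
      + assert (X := vertex_conditions_length G v).
        assert (Y : deg G v = 0%nat).
        { rewrite <- vends_length. destruct (vends G v) as [|[e b] r] eqn:E; auto. exfalso.
          assert (Hin : In (e, b) (vends G v)) by (rewrite E; left; auto).
          apply in_vends in Hin. destruct Hin as [He Hb]. destruct (Hwf e He) as [H1 [H2 _]].
          destruct b; simpl in Hb; lia. }
        rewrite Y in X. destruct (vertex_conditions G v); [destruct Hv|discriminate].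
    - intros j Hj. apply (Hl (fun z _ => L2_inner G z (F j))). apply in_app_iff. right.
      apply in_map_iff. exists j. split; auto. apply in_seq; lia. }
  (* Testing against [F j] isolates its multiplier, which thus vanishes when [y] and [z] are
     orthogonal to [F j]: the solution found solves the equation without multipliers. *)
  assert (Hmult : forall x z y, econt G y ->
     Hrel G W z (fun e s => (y e s + mu * z e s) + (-1) * lsum (seq 0 n) (fun i => x i * T i e s)) ->
     (forall j, (1 <= j <= k)%nat -> L2_inner G z (F j) = 0) ->
     (forall j, (1 <= j <= k)%nat -> L2_inner G y (F j) = 0) ->
     forall i, (E2 <= i < n)%nat -> x i = 0).
  { intros x z y Cy HH Hz Hy i Hi.
    set (j := S (i - E2)). assert (Hj : (1 <= j <= k)%nat) by (unfold j, n in *; lia).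
    assert (X := Hrel_orthogonal_rhs G W lam F j mu z y _ HS ltac:(lia) HH Cy
      (econt_lsum G T x (seq 0 n) (fun i _ => CT i)) (Hz j Hj) (Hy j Hj)).
    rewrite (L2_lsum_l G T) in X; auto; [|apply CF; lia].
    rewrite (lsum_ext _ _ (fun m => if Nat.eqb m i then x m * L2_inner G (F j) (F j) else 0)) in X.
    - rewrite (lsum_delta n i (fun m => x m * L2_inner G (F j) (F j))) in X by lia.
      assert (P := sp_norm _ _ _ _ HS j ltac:(lia)).
      apply Rmult_integral in X. destruct X; auto; lra.
    - intros m _. unfold T. destruct (Nat.ltb_spec m E2) as [Hm|Hm].
      + change (fun (e : nat) (x : R) => 0) with ((fun _ _ => 0) : gfun). rewrite L2_zero_l.
        destruct (Nat.eqb_spec m i); [lia|ring].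
      + destruct (Nat.eqb_spec m i) as [->|Hmi]; [reflexivity|].
        change (fun (e : nat) (x0 : R) => F (S (m - E2)) e x0) with (F (S (m - E2))).
        rewrite (sp_orth _ _ _ _ HS); [ring|lia|lia|unfold j; lia]. }
  assert (HTzero : forall x, (forall i, (E2 <= i < n)%nat -> x i = 0) ->
     forall e s, lsum (seq 0 n) (fun i => x i * T i e s) = 0).
  { intros x Hx e s. apply lsum_zero. intros i Hi. apply in_seq in Hi. unfold T.
    destruct (Nat.ltb_spec i E2); [ring|]. rewrite Hx by lia. ring. }
  assert (Hsum : forall (p dp ddp y : gfun) (x : nat -> R),
    (forall e, (e < nE G)%nat -> smooth2 (p e) (dp e) (ddp e) /\
       forall s, 0 <= s <= len G e -> ddp e s = (W e s - mu) * p e s + (-1) * y e s) ->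
    let z := fun e s => p e s + 1 * lsum (seq 0 n) (fun i => x i * B i e s) in
    let dz := fun e s => dp e s + 1 * lsum (seq 0 n) (fun i => x i * dB i e s) in
    let ddz := fun e s => ddp e s + 1 * lsum (seq 0 n) (fun i => x i * ddB i e s) in
    (forall e, (e < nE G)%nat -> smooth2 (z e) (dz e) (ddz e)) /\
    forall e s, (e < nE G)%nat -> 0 <= s <= len G e ->
      ddz e s = W e s * z e s - ((y e s + mu * z e s) + (-1) * lsum (seq 0 n) (fun i => x i * T i e s))).
  { intros p dp ddp y x Hp z dz ddz.
    split.
    - intros e He. apply smooth2_lin; [apply Hp; auto|].
      generalize (seq 0 n). induction l as [|i l IH]; simpl.
      + split; [|split]; intros; try apply deriv_const. apply cont_const.
      + destruct (HBs i e He) as (b1 & b2 & b3). destruct IH as (i1 & i2 & i3). split; [|split]; intros s.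
        * apply deriv_plus; auto. apply deriv_scal; auto.
        * apply deriv_plus; auto. apply deriv_scal; auto.
        * apply cont_plus; auto. apply cont_mult; auto. apply cont_const.
    - intros e s He Hs. unfold ddz, z. destruct (Hp e He) as [_ Hd]. rewrite Hd by auto.
      rewrite (lsum_ext _ (fun i => x i * ddB i e s) (fun i => (W e s - mu) * (x i * B i e s) + x i * T i e s)).
      + rewrite lsum_plus, lsum_scal. ring.
      + intros i _. rewrite HBd by auto. ring. }
  (* For injectivity, a homogeneous solution has zero multipliers and gives an eigenfunction for
     [mu] orthogonal to [F 1], ..., [F k], hence 0; the remaining unknowns are its initial values on
     the edges. *)
  destruct (admissible_system G n B dB L HLlen HLadm (fun i _ => CB i)) as [K2 [HK2 Hsolve]].
  { intros x Hx.
    destruct (Hsum (fun _ _ => 0) (fun _ _ => 0) (fun _ _ => 0) (fun _ _ => 0) x) as [Hs Heq].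
    { intros e He. split; [|intros; ring]. split; [|split]; intros; try apply deriv_const. apply cont_const. }
    cbv zeta in Hs, Heq.
    assert (Ez : forall D : nat -> gfun, (fun e s => 0 + 1 * lsum (seq 0 n) (fun i => x i * D i e s))
       = (fun e s => lsum (seq 0 n) (fun i => x i * D i e s))) by (intros; apply gfun_ext; intros; ring).
    set (z := fun e s => lsum (seq 0 n) (fun i => x i * B i e s)) in *.
    set (dz := fun e s => lsum (seq 0 n) (fun i => x i * dB i e s)) in *.
    destruct (Hdom (fun e s => 0 + 1 * z e s) (fun e s => 0 + 1 * dz e s) _ Hs) as [[phi Hphi] Hz].
    { intros l Hl. unfold z, dz. rewrite !Ez. apply Hx; auto. }
    assert (HH : Hrel G W (fun e s => 0 + 1 * z e s) (fun e s => (0 + mu * (0 + 1 * z e s)) +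
              (-1) * lsum (seq 0 n) (fun i => x i * T i e s))).
    { eexists _, _, phi. split; [exact Hphi|]. exact Heq. }
    assert (Hm : forall i, (E2 <= i < n)%nat -> x i = 0).
    { apply (Hmult x _ (fun _ _ => 0) ltac:(intros e He s; apply cont_const) HH Hz).
      intros; apply L2_zero_l. }
    assert (HH' : Hrel G W (fun e s => 0 + 1 * z e s) (fun e s => mu * (0 + 1 * z e s))).
    { eapply Hrel_ext; [exact HH|]. intros e s _ _. cbv beta. rewrite (HTzero x Hm). ring. }
    assert (Hz0 : forall e s, (e < nE G)%nat -> 0 <= s <= len G e -> 0 + 1 * z e s = 0).
    { apply (spectral_injective G W lam F k mu); auto. }
    intros i Hi. destruct (le_lt_dec E2 i) as [Hi2|Hi2]; [apply Hm; lia|].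
    set (e := Nat.div2 i).
    assert (Hie : (i = 2 * e \/ i = 2 * e + 1)%nat).
    { unfold e. assert (X := Nat.div2_odd i). destruct (Nat.odd i); simpl in X; lia. }
    assert (He : (e < nE G)%nat) by (unfold E2 in *; lia).
    destruct (Hwf e He) as [_ [_ Hl]].
    assert (V0 : z e 0 = x (2 * e)%nat).
    { unfold z. rewrite (lsum_ext _ _ (fun i => if Nat.eqb i (2 * e) then x i else 0)).
      - apply (lsum_delta n (2 * e) x). unfold n, E2. lia.
      - intros m _. destruct (HB0 m e He) as [-> _]. destruct (Nat.eqb m (2 * e)); ring. }
    assert (V1 : dz e 0 = x (2 * e + 1)%nat).
    { unfold dz. rewrite (lsum_ext _ _ (fun i => if Nat.eqb i (2 * e + 1) then x i else 0)).
      - apply (lsum_delta n (2 * e + 1) x). unfold n, E2. lia.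
      - intros m _. destruct (HB0 m e He) as [_ ->]. destruct (Nat.eqb m (2 * e + 1)); ring. }
    destruct Hie as [Ei | Ei]; rewrite Ei.
    - rewrite <- V0. specialize (Hz0 e 0 He ltac:(lra)). lra.
    - rewrite <- V1. destruct (Hs e He) as (s1 & _ & _).
      assert (X := deriv_zero_at_start _ _ (len G e) Hl s1 (fun s Hs' => Hz0 e s He Hs')).
      change (0 + 1 * dz e 0 = 0) in X. lra. }
  destruct (family_bounded G B n Hwf (fun i _ => CB i)) as [KB [HKB HBb]].
  (* [K * L1 G y] bounds the particular solution, and each of the [n] corrections has a coefficient
     at most [K2 * (K * L1 G y)] and a function bounded by [KB]. *)
  set (D1 := K + INR n * (K2 * K * KB)).
  assert (HD1 : 0 <= D1).
  { unfold D1. assert (0 <= INR n) by apply pos_INR.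
    assert (0 <= K2 * K * KB) by (apply Rmult_le_pos; auto; apply Rmult_le_pos; auto).
    assert (0 <= INR n * (K2 * K * KB)) by (apply Rmult_le_pos; auto). lra. }
  assert (HTL : 0 <= total_length G).
  { apply lsum_nonneg. intros e He. apply in_seq in He. destruct (Hwf e) as [_ [_ Hl]]; [lia|lra]. }
  exists (D1 * total_length G). split; [apply Rmult_le_pos; auto|].
  intros y Cy Hy.
  destruct (L1_L2 G y Hwf Cy) as [HN HNN]. fold (L1 G y) in HN, HNN.
  destruct (HP (fun e x => -1 * y e x)) as (p & dp & ddp & Hp).
  { apply econt_scal; auto. }
  assert (HL1 : L1 G (fun e x => -1 * y e x) = L1 G y).
  { apply lsum_ext. intros e _. apply RInt_eq. intros x _.
    rewrite Rabs_mult, Rabs_left by lra. change (- -1 * Rabs (y e x) = Rabs (y e x)). ring. }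
  rewrite HL1 in Hp.
  assert (Cp : econt G p).
  { intros e He. apply (smooth2_continuous _ (dp e) (ddp e)). apply Hp; auto. }
  destruct (Hsolve p dp (K * L1 G y)) as [x [Hxb Hx]]; auto.
  { apply Rmult_le_pos; auto. }
  { intros e s He Hs. destruct (Hp e He) as (_ & _ & _ & H). destruct (H s Hs) as (_ & H1 & H2). auto. }
  destruct (Hsum p dp ddp y x) as [Hs Heq].
  { intros e He. destruct (Hp e He) as (H1 & _ & _ & H2). split; auto. intros s Hs'. apply H2; auto. }
  cbv zeta in Hs, Heq.
  set (z := fun e s => p e s + 1 * lsum (seq 0 n) (fun i => x i * B i e s)) in *.
  destruct (Hdom z _ _ Hs Hx) as [[phi Hphi] Hz].
  assert (HH : Hrel G W z (fun e s => (y e s + mu * z e s) + (-1) * lsum (seq 0 n) (fun i => x i * T i e s))).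
  { eexists _, _, phi. split; [exact Hphi|exact Heq]. }
  assert (Hm := Hmult x z y Cy HH Hz Hy).
  exists z. split; [|split; auto].
  - eapply Hrel_ext; [exact HH|]. intros e s _ _. cbv beta. rewrite (HTzero x Hm). ring.
  - eapply Rle_trans; [apply (L2_bound G y z (D1 * L1 G y)); auto|].
    + eapply Hrel_econt; eauto.
    + intros e s He Hs'. unfold z. eapply Rle_trans; [apply Rabs_triang|]. rewrite Rmult_1_l.
      destruct (Hp e He) as (_ & _ & _ & Hp'). destruct (Hp' s Hs') as (_ & Hp1 & _).
      assert (Hq : Rabs (lsum (seq 0 n) (fun i => x i * B i e s)) <= INR n * (K2 * K * KB) * L1 G y).
      { eapply Rle_trans; [apply lsum_abs|].
        apply Rle_trans with (lsum (seq 0 n) (fun _ => K2 * K * KB * L1 G y)).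
        - apply lsum_le. intros i Hi. apply in_seq in Hi. rewrite Rabs_mult.
          replace (K2 * K * KB * L1 G y) with (K2 * (K * L1 G y) * KB) by ring.
          apply Rmult_le_compat; try apply Rabs_pos; [apply Hxb; lia|apply HBb; auto; lia].
        - rewrite lsum_const, length_seq. apply Req_le. ring. }
      unfold D1. lra.
    + fold (L1 G y). replace (D1 * L1 G y * L1 G y) with (D1 * (L1 G y * L1 G y)) by ring.
      rewrite Rmult_assoc. apply Rmult_le_compat_l; auto.
Qed.

(** * Upper nodal bound *)

(** The difference of the two solutions would belong to the eigenvalue [c], which is below the
    spectrum. *)
Lemma resolvent_unique G W lam F c u z z' : spectral G W lam F -> c < lam 1%nat ->
  Hrel G W z (fun e x => u e x + c * z e x) -> Hrel G W z' (fun e x => u e x + c * z' e x) ->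
  forall e x, (e < nE G)%nat -> 0 <= x <= len G e -> z e x = z' e x.
Proof.
  intros HS Hc Hz Hz' e x He Hx.
  assert (H := Hrel_lin _ _ _ _ _ _ (-1) Hz Hz').
  assert (E : z e x + -1 * z' e x = 0); [|lra].
  apply (sp_complete _ _ _ _ HS c (fun e x => z e x + -1 * z' e x)); auto.
  - eapply Hrel_ext; [exact H|]. intros e' x' _ _. cbv beta. ring.
  - intros j Hj E. exfalso. destruct (Nat.eq_dec j 1) as [->|]; [lra|].
    assert (lam 1%nat < lam j) by (apply (sp_incr _ _ _ _ HS); lia). lra.
Qed.

(* If the resolvent R = (H - c)^{-1} had Rayleigh quotients >= 1 / (lam k - c) on the complement of
   F 1, ..., F k, their supremum rho would be an eigenvalue of R there: otherwise
   (rho - R)^{-1} is bounded and Cauchy-Schwarz for the form rho - R lowers the supremum. *)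
Lemma spectral_gap G W lam F k c g v : spectral G W lam F -> (1 <= k)%nat -> c < lam 1%nat ->
  econt G g -> (forall j, (1 <= j <= k)%nat -> L2_inner G g (F j) = 0) -> 0 < L2_inner G g g ->
  Hrel G W v (fun e x => g e x + c * v e x) ->
  L2_inner G g g <= (lam k - c) * L2_inner G g v -> False.
Proof.
  intros HS Hk Hc Cg Hg Pg Hv Hgv. assert (Hwf := sp_wf _ _ _ _ HS).
  assert (Hck : c < lam k).
  { destruct (Nat.eq_dec k 1) as [->|]; auto.
    assert (lam 1%nat < lam k) by (apply (sp_incr _ _ _ _ HS); lia). lra. }
  destruct (resolvent_bounded G W lam F k c HS Hk ltac:(lra)) as [C0 [HC0 HR]].
  set (Sk := fun u => econt G u /\ forall j, (1 <= j <= k)%nat -> L2_inner G u (F j) = 0).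
  set (RR := fun u z => Hrel G W z (fun e x => u e x + c * z e x)).
  assert (Hb : forall u z, Sk u -> RR u z -> L2_inner G u z <= C0 * L2_inner G u u).
  { intros u z [Cu Hu] Hz. destruct (HR u Cu Hu) as [z' [Hz' [_ Hbd]]].
    rewrite (L2_ext G u u z z'); auto.
    - eapply Rle_trans; [apply Rle_abs|exact Hbd].
    - intros e x He Hx. split; auto. apply (resolvent_unique G W lam F c u z z' HS Hc Hz Hz'); auto. }
  set (E := fun r => exists u z, Sk u /\ RR u z /\ 0 < L2_inner G u u /\ r * L2_inner G u u = L2_inner G u z).
  destruct (completeness E) as [rho [Hub Hlub]].
  { exists C0. intros r (u & z & Hu & Hz & Pu & Er). specialize (Hb u z Hu Hz).
    rewrite <- Er in Hb. apply Rmult_le_reg_r in Hb; auto. }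
  { exists (L2_inner G g v / L2_inner G g g). exists g, v. split; [split; auto|]. split; auto.
    split; auto. field. lra. }
  assert (Hrho : / (lam k - c) <= rho).
  { apply Rle_trans with (L2_inner G g v / L2_inner G g g).
    - apply Rmult_le_reg_r with ((lam k - c) * L2_inner G g g); [apply Rmult_lt_0_compat; lra|].
      replace (/ (lam k - c) * ((lam k - c) * L2_inner G g g)) with (L2_inner G g g) by (field; lra).
      replace (L2_inner G g v / L2_inner G g g * ((lam k - c) * L2_inner G g g))
        with ((lam k - c) * L2_inner G g v) by (field; lra). auto.
    - apply Hub. exists g, v. split; [split; auto|]. split; auto. split; auto. field. lra. }
  assert (Hinv : 0 < / (lam k - c)) by (apply Rinv_0_lt_compat; lra).
  assert (Hrho0 : 0 < rho) by lra.
  (* The value [rho] for R corresponds to [mu] for H, and [rho >= / (lam k - c)] puts [mu] in the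
     range of [resolvent_bounded]. *)
  set (mu := c + / rho).
  assert (Hmu : mu <= lam k).
  { unfold mu. assert (/ rho <= lam k - c); [|lra].
    rewrite <- (Rinv_inv (lam k - c)). apply Rinv_le_contravar; auto. }
  destruct (resolvent_bounded G W lam F k mu HS Hk Hmu) as [C1 [HC1 HR1]].
  set (C' := rho + C1). assert (HC' : 0 < C') by (unfold C'; lra).
  assert (Hpos : forall w zw, Sk w -> RR w zw -> L2_inner G w zw <= rho * L2_inner G w w).
  { intros w zw Hw Hzw. destruct (L2_nonneg G w Hwf (proj1 Hw)) as [Hp|Hz].
    - assert (X : L2_inner G w zw / L2_inner G w w <= rho).
      { apply Hub. exists w, zw. split; auto. split; auto. split; auto. field. lra. }
      apply Rmult_le_reg_r with (/ L2_inner G w w); [apply Rinv_0_lt_compat; auto|].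
      rewrite Rmult_assoc, Rinv_r by lra. unfold Rdiv in X. lra.
    - specialize (Hb w zw Hw Hzw). rewrite <- Hz in *. lra. }
  assert (Hlow : rho <= rho - rho * rho / C').
  { apply Hlub. intros r (u & z0 & [Cu Hu] & Hz0 & Pu & Er).
    destruct (HR1 u Cu Hu) as [z [Hz [Hzo Hzb]]].
    assert (Cz := Hrel_econt _ _ _ _ Hz). assert (Cz0 := Hrel_econt _ _ _ _ Hz0).
    (* Here [z = R x], so [(rho - R) x = rho u]: [x] is [rho] times the image of [u] under the
       inverse of [rho - R]. *)
    set (x := fun e s => u e s + / rho * z e s).
    assert (Cx : econt G x) by (apply econt_lin; auto).
    assert (Hxz : RR x z).
    { eapply Hrel_ext; [exact Hz|]. intros e s _ _. unfold x, mu. ring. }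
    assert (Hxo : forall j, (1 <= j <= k)%nat -> L2_inner G x (F j) = 0).
    { intros j Hj. unfold x. rewrite L2_lin_l; auto.
      - rewrite Hu, Hzo by auto. ring.
      - apply (spectral_econt _ _ _ _ _ HS); lia. }
    assert (Exu : L2_inner G x u = L2_inner G u u + / rho * L2_inner G u z).
    { unfold x. rewrite L2_lin_l, (L2_sym G z u) by auto. auto. }
    assert (Exz : L2_inner G x z = rho * (L2_inner G x x - L2_inner G x u)).
    { assert (A : L2_inner G x x = L2_inner G u x + / rho * L2_inner G z x)
        by (unfold x at 1; apply L2_lin_l; auto).
      rewrite A, (L2_sym G u x), (L2_sym G z x) by auto. field. lra. }
    assert (Hsym : L2_inner G u z = L2_inner G x z0).
    { assert (X := Hrel_symmetric G W z0 _ z _ Hwf Hz0 Hxz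
        (econt_lin G u z0 c Cu Cz0) (econt_lin G x z c Cx Cz)).
      rewrite L2_lin_l in X by auto.
      rewrite (L2_sym G z0 (fun e y => x e y + c * z e y)) in X by auto.
      rewrite L2_lin_l in X by auto. rewrite (L2_sym G z z0) in X by auto. lra. }
    (* Expanding the nonnegative form of [rho - R] at [u + s x] produces at most [2 s rho + s^2 C'],
       times [uu], beyond its value at [u]; this [s] minimizes it, with minimum [- rho^2 / C']. *)
    set (s := - (rho / C')).
    assert (Q := Hpos (fun e y => u e y + s * x e y) (fun e y => z0 e y + s * z e y)).
    assert (Q' : L2_inner G (fun e y => u e y + s * x e y) (fun e y => z0 e y + s * z e y)
      <= rho * L2_inner G (fun e y => u e y + s * x e y) (fun e y => u e y + s * x e y)).
    { apply Q.
      - split; [apply econt_lin; auto|]. intros j Hj. rewrite L2_lin_l; auto.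
        + rewrite Hu, Hxo by auto. ring.
        + apply (spectral_econt _ _ _ _ _ HS); lia.
      - eapply Hrel_ext; [exact (Hrel_lin _ _ _ _ _ _ s Hz0 Hxz)|]. intros e y _ _. cbv beta. ring. }
    clear Q.
    assert (Hexp : forall p q : gfun, econt G p -> econt G q ->
       L2_inner G (fun e y => u e y + s * x e y) (fun e y => p e y + s * q e y) =
       L2_inner G u p + s * L2_inner G u q + s * (L2_inner G x p + s * L2_inner G x q)).
    { intros p q Cp Cq. assert (Cpq := econt_lin G p q s Cp Cq).
      rewrite L2_lin_l by auto. rewrite (L2_sym G u), (L2_sym G x (fun e y => p e y + s * q e y)) by auto.
      rewrite !L2_lin_l by auto.
      rewrite (L2_sym G p u), (L2_sym G q u), (L2_sym G p x), (L2_sym G q x) by auto. ring. }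
    rewrite !Hexp in Q' by auto.
    rewrite (L2_sym G u x), <- Hsym in Q' by auto. clear Hexp.
    set (uu := L2_inner G u u) in *. set (uz := L2_inner G u z) in *.
    set (xu := L2_inner G x u) in *. set (xx := L2_inner G x x) in *.
    set (xz := L2_inner G x z) in *. set (uz0 := L2_inner G u z0) in *.
    assert (Ex1 : rho * xu = rho * uu + uz) by (rewrite Exu; field; lra).
    assert (Huz : uz <= C1 * uu) by (eapply Rle_trans; [apply Rle_abs|exact Hzb]).
    assert (Q1 : 0 <= (rho * uu - uz0) + 2 * s * (rho * uu) + s * s * (rho * xu)).
    { assert (Hx : rho * xx - xz = rho * xu) by (rewrite Exz; ring).
      rewrite <- Hx. replace (2 * s * (rho * uu)) with (2 * s * (rho * xu - uz)) by (rewrite Ex1; ring).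
      nra. }
    assert (Q2 : s * s * (rho * xu) <= s * s * (C' * uu)).
    { apply Rmult_le_compat_l; [apply Rle_0_sqr|]. rewrite Ex1. unfold C'. lra. }
    assert (Q3 : 2 * s * (rho * uu) + s * s * (C' * uu) = - (rho * rho / C') * uu)
      by (unfold s; field; lra).
    apply Rmult_le_reg_r with uu; auto. rewrite Er. lra. }
  assert (0 < rho * rho / C') by (apply Rdiv_lt_0_compat; auto; apply Rmult_lt_0_compat; auto).
  lra.
Qed.

(** * Step functions with jumps at given points of the edges *)

Definition step (z x : R) : R := if Rlt_dec z x then 1 else 0.

Lemma step_locally_constant z x : x <> z -> locally x (fun y => step z y = step z x).
Proof.
  intros Hn. unfold step. destruct (Rlt_dec z x) as [H|H].
  - eapply filter_imp; [|apply (locally_interval z (x + 1) x); lra].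
    intros y Hy. destruct (Rlt_dec z y); [auto|lra].
  - eapply filter_imp; [|apply (locally_interval (x - 1) z x); lra].
    intros y Hy. destruct (Rlt_dec z y); [lra|auto].
Qed.

(** The jump at [z] does no harm since [f] vanishes there. *)
Lemma step_mult_continuous (f : R -> R) z :
  (forall x, continuous f x) -> f z = 0 -> forall x, continuous (fun y => step z y * f y) x.
Proof.
  intros Hf Hz x. destruct (Req_dec x z) as [->|Hn].
  - apply (continuous_times_bounded (step z) f z 1 1); auto; [lra|].
    intros y _. unfold step. destruct (Rlt_dec z y); rewrite ?Rabs_R0, ?Rabs_R1; lra.
  - apply cont_mult; auto.
    apply continuous_ext_loc with (fun _ => step z x); [|apply cont_const].
    eapply filter_imp; [|exact (step_locally_constant z x Hn)]. intros y Hy. symmetry; exact Hy.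
Qed.

(* The step functions on the graph jumping at the points of [s]: one constant per edge
   (indices below [nE G]) and one jump per point. *)
Definition step_basis (G : mgraph) (s : list gpoint) (i e : nat) (x : R) : R :=
  if Nat.ltb i (nE G) then (if Nat.eqb i e then 1 else 0)
  else match nth (i - nE G) s (PV 0) with
       | PE e' z => if Nat.eqb e' e then step z x else 0
       | PV _ => 0
       end.

Lemma step_basis_continuous G s i e (f : R -> R) : (forall x, continuous f x) ->
  (forall z, In (PE e z) s -> f z = 0) ->
  (forall x, continuous (fun y => step_basis G s i e y * f y) x).
Proof.
  intros Hf Hz x. unfold step_basis. destruct (Nat.ltb i (nE G)).
  - apply cont_mult; auto. apply cont_const.
  - destruct (nth_in_or_default (i - nE G) s (PV 0)) as [Hin|E].
    + destruct (nth (i - nE G) s (PV 0)) as [e' z|v].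
      * destruct (Nat.eqb_spec e' e) as [->|]; [apply step_mult_continuous; auto|].
        apply cont_mult; auto. apply cont_const.
      * apply cont_mult; auto. apply cont_const.
    + rewrite E. apply cont_mult; auto. apply cont_const.
Qed.

Lemma step_basis_locally_constant G s i e x : ~ In x (flat_map (edge_part e) s) ->
  locally x (fun y => step_basis G s i e y = step_basis G s i e x).
Proof.
  intros Hn. unfold step_basis. destruct (Nat.ltb i (nE G)); [apply filter_forall; auto|].
  destruct (nth_in_or_default (i - nE G) s (PV 0)) as [Hin|E].
  - destruct (nth (i - nE G) s (PV 0)) as [e' z|v]; [|apply filter_forall; auto].
    destruct (Nat.eqb_spec e' e) as [->|]; [|apply filter_forall; auto].
    apply step_locally_constant. intros ->. apply Hn, in_edge_part; auto.
  - rewrite E. apply filter_forall; auto.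
Qed.

Definition step_fun (G : mgraph) (s : list gpoint) (n : nat) (x : nat -> R) (e : nat) (t : R) : R :=
  lsum (seq 0 n) (fun i => x i * step_basis G s i e t).

Lemma step_fun_continuous G s n x e (f : R -> R) : (forall t, continuous f t) ->
  (forall z, In (PE e z) s -> f z = 0) ->
  (forall t, continuous (fun y => step_fun G s n x e y * f y) t).
Proof.
  intros Hf Hz t. unfold step_fun.
  apply (continuous_ext (fun y => lsum (seq 0 n) (fun i => x i * (step_basis G s i e y * f y)))).
  { intros y. rewrite Rmult_comm, <- lsum_scal. apply lsum_ext. intros; ring. }
  induction (seq 0 n) as [|i l IH]; simpl; [apply cont_const|].
  apply cont_plus; auto. apply cont_mult; [apply cont_const|]. apply step_basis_continuous; auto.
Qed.

Lemma step_fun_locally_constant G s n x e t : ~ In t (flat_map (edge_part e) s) ->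
  locally t (fun y => step_fun G s n x e y = step_fun G s n x e t).
Proof.
  intros Hn. unfold step_fun. induction (seq 0 n) as [|i l IH]; simpl.
  - apply filter_forall; auto.
  - assert (X := step_basis_locally_constant G s i e t Hn).
    apply (filter_imp (fun y => step_basis G s i e y = step_basis G s i e t /\
       lsum l (fun i => x i * step_basis G s i e y) = lsum l (fun i => x i * step_basis G s i e t))).
    + intros y [-> ->]. auto.
    + apply filter_and; auto.
Qed.

Lemma eigenfunction_nowhere_zero G W lam F k : spectral G W lam F -> (1 <= k)%nat ->
  nowhere_zero G (F k).
Proof.
  intros HS Hk e He a b Ha Hab Hb.
  destruct (Hrel_eigen_data _ _ _ _ (sp_eigen _ _ _ _ HS k Hk)) as (d & dd & phi & HD).
  apply NNPP. intros Hno.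
  assert (H0 : forall x, a < x < b -> F k e x = 0).
  { intros x Hx. apply NNPP. intros Hn. apply Hno. exists x; auto. }
  set (m := (a + b) / 2). assert (Hm : a < m < b) by (unfold m; lra).
  apply (sp_simple _ _ _ _ HS k d dd phi e m Hk HD He); [lra|auto|].
  destruct HD as ((A1 & _) & _). destruct (A1 e He) as (a1 & _ & _).
  apply (zero_deriv_of_constant (F k e) a b m _ 0 Hm H0 (a1 m)).
Qed.

(* Evaluate just after the smallest point where a nonzero jump occurs. *)
Lemma step_fun_nonzero G s n x (f : gfun) : nowhere_zero G f -> NoDup s ->
  (forall e z, In (PE e z) s -> (e < nE G)%nat /\ 0 < z < len G e) ->
  (forall p, In p s -> exists e z, p = PE e z) ->
  n = (nE G + length s)%nat -> wf_graph G -> (exists j, (j < n)%nat /\ x j <> 0) ->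
  exists e t, (e < nE G)%nat /\ 0 <= t <= len G e /\ step_fun G s n x e t * f e t <> 0.
Proof.
  intros Hf Hd Hs Hp -> Hwf [j [Hj Hxj]].
  assert (Hedge : exists e, (e < nE G)%nat /\ (x e <> 0 \/ exists m z, (m < length s)%nat /\
     nth m s (PV 0) = PE e z /\ x (nE G + m)%nat <> 0)).
  { destruct (lt_dec j (nE G)) as [H|H]; [exists j; auto|].
    destruct (Hp (nth (j - nE G) s (PV 0))) as (e & z & E); [apply nth_In; lia|].
    exists e. split.
    - apply (Hs e z). rewrite <- E. apply nth_In; lia.
    - right. exists (j - nE G)%nat, z. split; [lia|]. split; auto.
      replace (nE G + (j - nE G))%nat with j by lia. auto. }
  destruct Hedge as [e [He Hne]]. destruct (Hwf e He) as [_ [_ Hl]].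
  assert (Hval : forall t, step_fun G s (nE G + length s) x e t = x e +
     lsum (seq 0 (length s)) (fun m => match nth m s (PV 0) with
        PE e' z => if Nat.eqb e' e then x (nE G + m)%nat * step z t else 0 | PV _ => 0 end)).
  { intros t. unfold step_fun. rewrite seq_app, lsum_app. f_equal.
    - rewrite (lsum_ext _ _ (fun i => if Nat.eqb i e then x i else 0)).
      + apply lsum_delta; auto.
      + intros i Hi. apply in_seq in Hi. unfold step_basis. destruct (Nat.ltb_spec i (nE G)); [|lia].
        destruct (Nat.eqb i e); ring.
    - simpl. replace (seq (nE G) (length s)) with (map (fun m => nE G + m)%nat (seq 0 (length s))).
      2:{ clear. generalize (nE G). intros a. revert a. induction (length s) as [|q IH]; intros a; auto. rewrite !seq_S, map_app, IH. reflexivity. }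
      rewrite lsum_map. apply lsum_ext. intros m _. unfold step_basis.
      destruct (Nat.ltb_spec (nE G + m) (nE G)); [lia|].
      replace (nE G + m - nE G)%nat with m by lia.
      destruct (nth m s (PV 0)) as [e' z|v]; [|ring]. destruct (Nat.eqb e' e); ring. }
  assert (Hint : exists b b' cst, 0 <= b /\ b < b' /\ b' <= len G e /\ cst <> 0 /\
     forall t, b < t < b' -> step_fun G s (nE G + length s) x e t = cst).
  { assert (Hnext : forall b, 0 <= b < len G e -> exists b', b < b' /\ b' <= len G e /\
        forall z, In (PE e z) s -> b < z -> b' <= z).
    { intros b Hb.
      set (big := fun z => if Rlt_dec b z then true else false).
      destruct (exists_min (len G e :: filter big (flat_map (edge_part e) s))) as [m [Hm1 Hm2]]; [congruence|].
      exists m. split; [|split].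
      - destruct Hm1 as [<-|Hm1]; [lra|]. apply filter_In in Hm1. destruct Hm1 as [_ Hm1].
        unfold big in Hm1. destruct (Rlt_dec b m); [auto|discriminate].
      - apply Hm2. left; auto.
      - intros z Hz Hbz. apply Hm2. right. apply filter_In. split; [apply in_edge_part; auto|].
        unfold big. destruct (Rlt_dec b z); auto. }
    destruct (Req_dec (x e) 0) as [E0|E0].
    - destruct Hne as [Hne|(m0 & z0 & Hm0 & En & Hx0)]; [contradiction|].
      set (jump := fun m => match nth m s (PV 0) with PE e' z => if Nat.eqb e' e then
          (if Req_EM_T (x (nE G + m)%nat) 0 then nil else z :: nil) else nil | PV _ => nil end).
      assert (Hjump : forall z, In z (flat_map jump (seq 0 (length s))) <-> exists m, (m < length s)%nat /\
         nth m s (PV 0) = PE e z /\ x (nE G + m)%nat <> 0).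
      { intros z. rewrite in_flat_map. split.
        - intros [m [Hm Hz]]. apply in_seq in Hm. unfold jump in Hz.
          destruct (nth m s (PV 0)) as [e' z'|v] eqn:E; [|destruct Hz].
          destruct (Nat.eqb_spec e' e) as [->|]; [|destruct Hz].
          destruct (Req_EM_T (x (nE G + m)%nat) 0); [destruct Hz|]. destruct Hz as [->|[]].
          exists m. split; [lia|auto].
        - intros (m & Hm & E & Hx). exists m. split; [apply in_seq; lia|]. unfold jump. rewrite E.
          rewrite Nat.eqb_refl. destruct (Req_EM_T (x (nE G + m)%nat) 0); [contradiction|]. left; auto. }
      destruct (exists_min (flat_map jump (seq 0 (length s)))) as [b [Hb1 Hb2]].
      { intros E. assert (X : In z0 (flat_map jump (seq 0 (length s)))) by (apply Hjump; exists m0; auto).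
        rewrite E in X. destruct X. }
      apply Hjump in Hb1. destruct Hb1 as (m & Hm & Em & Hxm).
      assert (Hinb : In (PE e b) s) by (rewrite <- Em; apply nth_In; auto).
      destruct (Hs e b Hinb) as [_ Hbl].
      destruct (Hnext b ltac:(lra)) as [b' [H1 [H2 H3]]].
      exists b, b', (x (nE G + m)%nat). split; [lra|]. split; auto. split; auto. split; auto.
      intros t Ht. rewrite Hval, E0.
      rewrite (lsum_ext _ _ (fun i => if Nat.eqb i m then x (nE G + i)%nat else 0)).
      + rewrite (lsum_delta (length s) m (fun i => x (nE G + i)%nat)) by auto. ring.
      + intros i Hi. apply in_seq in Hi. destruct (Nat.eqb_spec i m) as [->|Him].
        * rewrite Em, Nat.eqb_refl. unfold step. destruct (Rlt_dec b t); [ring|lra].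
        * destruct (nth i s (PV 0)) as [e' z|v] eqn:Ei; auto.
          destruct (Nat.eqb_spec e' e) as [->|]; auto.
          destruct (Req_dec (x (nE G + i)%nat) 0) as [->|Hxi]; [ring|].
          assert (Hbz : b <= z) by (apply Hb2, Hjump; exists i; split; [lia|auto]).
          assert (Hne' : b <> z).
          { intros E. apply Him. apply (NoDup_nth s (PV 0)); auto; [lia|]. rewrite Ei, Em, E; auto. }
          assert (Hinz : In (PE e z) s) by (rewrite <- Ei; apply nth_In; lia).
          assert (b' <= z) by (apply H3; auto; lra).
          unfold step. destruct (Rlt_dec z t); [lra|ring].
    - destruct (Hnext 0 ltac:(lra)) as [b' [H1 [H2 H3]]].
      exists 0, b', (x e). split; [lra|]. split; auto. split; auto. split; auto.
      intros t Ht. rewrite Hval. rewrite lsum_zero; [ring|].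
      intros i Hi. apply in_seq in Hi.
      destruct (nth i s (PV 0)) as [e' z|v] eqn:Ei; auto. destruct (Nat.eqb_spec e' e) as [->|]; auto.
      assert (Hinz : In (PE e z) s) by (rewrite <- Ei; apply nth_In; lia).
      destruct (Hs e z Hinz) as [_ Hz]. assert (b' <= z) by (apply H3; auto; lra).
      unfold step. destruct (Rlt_dec z t); [lra|ring]. }
  destruct Hint as (b & b' & cst & H1 & H2 & H3 & H4 & H5).
  destruct (Hf e He b b' H1 H2 H3) as [t [Ht Hft]].
  exists e, t. split; auto. split; [lra|]. rewrite H5 by auto.
  apply Rmult_integral_contrapositive; auto.
Qed.

Definition end_point (G : mgraph) (p : nat * bool) : R := Defs.pos G (fst p) (snd p).

(** [deg v - 1] conditions that give the step function one value at all ends meeting in [v].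
    Multiplying [F k] by it then preserves both continuity and Kirchhoff's condition at [v]. *)
Definition continuity_rows (G : mgraph) (s : list gpoint) (v : nat) : list (nat -> R) :=
  match vends G v with
  | nil => nil
  | p0 :: r => map (fun p i => step_basis G s i (fst p) (end_point G p)
                             - step_basis G s i (fst p0) (end_point G p0)) r
  end.

(** Counts the continuity conditions: [2 |E| - |V|]. *)
Lemma vertex_count_identity G : wf_graph G -> (forall v, (v < nV G)%nat -> (1 <= deg G v)%nat) ->
  (list_sum (map (fun v => deg G v - 1)%nat (seq 0 (nV G))) + nV G = 2 * nE G)%nat.
Proof.
  intros Hwf Hd. rewrite <- (double_count G Hwf).
  assert (H : forall n, (n <= nV G)%nat ->
    (list_sum (map (fun v => deg G v - 1)%nat (seq 0 n)) + n = list_sum (map (deg G) (seq 0 n)))%nat).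
  { induction n as [|n IH]; intros Hn; auto.
    rewrite seq_S, !map_app, !list_sum_app. simpl. specialize (IH ltac:(lia)).
    specialize (Hd n ltac:(lia)). lia. }
  apply H; auto.
Qed.

(** With more than [k - 1 + beta] zeros, the [|E| + length s] coefficients of step functions
    outnumber the [2 |E| - |V|] continuity conditions and [k] orthogonality conditions, so a
    suitable nonzero [h] exists. The product [g = h F k] need not be differentiable at the jumps, so
    its Rayleigh quotient is compared through the resolvent, by way of [v]. *)
Lemma nodal_upper_bound G W lam F k s : spectral G W lam F -> (1 <= k)%nat -> NoDup s ->
  (forall p, In p s -> is_zero G (F k) p) ->
  (Z.of_nat (length s) <= Z.of_nat k - 1 + betti G)%Z.
Proof.
  intros HS Hk Hd Hs.
  assert (Hwf := sp_wf _ _ _ _ HS).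
  destruct (Z_le_gt_dec (Z.of_nat (length s)) (Z.of_nat k - 1 + betti G)) as [|Hgt]; auto. exfalso.
  assert (CF : forall j, (1 <= j)%nat -> econt G (F j)) by (intros; eapply spectral_econt; eauto).
  assert (Hpe : forall p, In p s -> exists e z, p = PE e z).
  { intros [e z|v] Hp; [exists e, z; auto|]. exfalso.
    destruct (Hs _ Hp) as (_ & H2 & e & b & He & Hb & H0).
    apply (sp_inner _ _ _ _ HS k e b); auto. rewrite Hb; auto. }
  assert (Hpz : forall e z, In (PE e z) s -> (e < nE G)%nat /\ 0 < z < len G e /\ F k e z = 0)
    by (intros e z Hp; apply (Hs _ Hp)).
  destruct (Hrel_eigen_data _ _ _ _ (sp_eigen _ _ _ _ HS k Hk)) as (d & dd & phi & HD).
  assert (HD' := HD). destruct HD' as [Dk Ek].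
  set (n := (nE G + length s)%nat).
  set (Hf := fun i e t => step_basis G s i e t * F k e t).
  assert (CHf : forall i, econt G (Hf i)).
  { intros i e He. apply step_basis_continuous; [apply CF; auto|]. intros z Hz. apply Hpz; auto. }
  set (rows := flat_map (continuity_rows G s) (seq 0 (nV G)) ++
     map (fun j i => L2_inner G (Hf i) (F j)) (seq 1 k)).
  assert (Hrows : (length rows < n)%nat).
  { unfold rows. rewrite length_app, length_map, length_seq, length_flat_map.
    assert (X := vertex_count_identity G Hwf (sp_deg _ _ _ _ HS)).
    rewrite (map_ext _ (fun v => deg G v - 1)%nat).
    - unfold n, betti in *. lia.
    - intros v. rewrite <- vends_length. unfold continuity_rows.
      destruct (vends G v); simpl; auto. rewrite length_map. lia. }
  destruct (homogeneous_system (length rows) n (fun i j => nth i rows (fun _ => 0) j)) as [x [Hx0 Hx]]; auto.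
  assert (Hrow : forall r, In r rows -> lsum (seq 0 n) (fun i => r i * x i) = 0).
  { intros r Hr. destruct (In_nth rows r (fun _ => 0) Hr) as [i [Hi <-]]. apply Hx; auto. }
  set (h := step_fun G s n x). set (g := fun e t => h e t * F k e t).
  assert (Eg : forall e t, g e t = lsum (seq 0 n) (fun i => x i * Hf i e t)).
  { intros e t. unfold g, h, step_fun, Hf. rewrite Rmult_comm, <- lsum_scal. apply lsum_ext. intros; ring. }
  assert (Cg : econt G g).
  { intros e He. apply step_fun_continuous; [apply CF; auto|]. intros z Hz. apply Hpz; auto. }
  assert (Hgo : forall j, (1 <= j <= k)%nat -> L2_inner G g (F j) = 0).
  { intros j Hj. rewrite (L2_ext G g (fun e t => lsum (seq 0 n) (fun i => x i * Hf i e t)) (F j) (F j)); auto.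
    rewrite L2_lsum_l; auto; [|apply CF; lia].
    rewrite <- (Hrow (fun i => L2_inner G (Hf i) (F j))).
    - apply lsum_ext. intros; ring.
    - apply in_app_iff. right. apply in_map_iff. exists j. split; auto. apply in_seq; lia. }
  assert (Pg : 0 < L2_inner G g g).
  { destruct (step_fun_nonzero G s n x (F k)) as (e & t & He & Ht & Hn); auto.
    - apply (eigenfunction_nowhere_zero G W lam F k HS Hk).
    - intros e z Hz. destruct (Hpz e z Hz) as (A & B & _). auto.
    - apply (L2_pos G g e t); auto. }
  (* The common value of [h] at the ends meeting in [v]; it permits [flux_zero] with the weights
     [eta * phi] and [eta^2 * phi]. *)
  set (eta := fun v => match vends G v with nil => 0 | p :: _ => h (fst p) (end_point G p) end).
  assert (Heta : forall e b, (e < nE G)%nat -> h e (Defs.pos G e b) = eta (vertex_of G e b)).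
  { intros e b He. set (v := vertex_of G e b).
    assert (Hin : In (e, b) (vends G v)) by (apply in_vends; auto).
    assert (Hv : (v < nV G)%nat).
    { destruct (Hwf e He) as [H1 [H2 _]]. unfold v. destruct b; auto. }
    assert (Hr : forall r, In r (continuity_rows G s v) -> lsum (seq 0 n) (fun i => r i * x i) = 0).
    { intros r Hr. apply Hrow. apply in_app_iff. left. apply in_flat_map. exists v. split; auto.
      apply in_seq; lia. }
    unfold continuity_rows in Hr. unfold eta.
    destruct (vends G v) as [|p0 r]; [destruct Hin|].
    destruct Hin as [->|Hin]; [reflexivity|].
    specialize (Hr _ (in_map _ _ _ Hin)). cbv beta in Hr.
    change (fst (e, b)) with e in Hr. rewrite (lsum_ext _ _ (fun i => x i * step_basis G s i e (end_point G (e, b))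
        + (-1) * (x i * step_basis G s i (fst p0) (end_point G p0)))) in Hr by (intros; ring).
    rewrite lsum_plus, lsum_scal in Hr. unfold h, step_fun. change (end_point G (e, b)) with (Defs.pos G e b) in Hr. lra. }
  destruct (econt_bounded G W Hwf (sp_cont _ _ _ _ HS)) as [KW [HKW HW]].
  set (c := Rmin (- KW) (lam 1%nat) - 1).
  assert (Hc1 : c < lam 1%nat) by (unfold c; assert (X := Rmin_r (- KW) (lam 1%nat)); lra).
  assert (HcW : forall e t, (e < nE G)%nat -> 0 <= t <= len G e -> c <= W e t).
  { intros e t He Ht. specialize (HW e t He Ht). assert (X := Rmin_l (- KW) (lam 1%nat)).
    unfold c. unfold Rabs in HW. destruct Rcase_abs; lra. }
  assert (Hck : c < lam k).
  { destruct (Nat.eq_dec k 1) as [->|]; auto.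
    assert (lam 1%nat < lam k) by (apply (sp_incr _ _ _ _ HS); lia). lra. }
  destruct (resolvent_bounded G W lam F k c HS Hk ltac:(lra)) as [C0 [HC0 HR]].
  destruct (HR g Cg Hgo) as [v [Hv _]].
  assert (Hv' := Hv). destruct Hv' as (dv & ddv & psi & Dv & Ev).
  (* The resolvent eigenvalue belonging to [lam k]: were [g] an eigenfunction, [v] would be [t g].
     The inequality below expresses that the energy of [v - t g] is nonnegative. *)
  set (t := / (lam k - c)).
  set (Xi := fun e y => v e y * dv e y - 2 * t * (h e y * F k e y) * dv e y
       + t * t * (h e y * F k e y * (h e y * d e y))).
  assert (Hineq : forall e, (e < nE G)%nat -> Xi e 0 - Xi e (len G e)
    <= t * RInt (fun y => (lam k - c) * (v e y * (h e y * F k e y)) - h e y * F k e y * (h e y * F k e y)) 0 (len G e)).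
  { intros e He. destruct (Hwf e He) as [_ [_ Hl]].
    apply (broken_inequality (W e) (F k e) (d e) (dd e) (v e) (dv e) (ddv e) (h e) (lam k) c (len G e)
      (flat_map (edge_part e) s)); auto.
    - apply Dk; auto.
    - apply Dv; auto.
    - apply Cg; auto.
    - intros y.
      assert (X : forall y, continuous (fun y => h e y * (F k e y * d e y)) y).
      { apply step_fun_continuous.
        - intros u. apply cont_mult; [apply CF; auto|]. apply (smooth2_continuous (F k e) (d e) (dd e)). apply Dk; auto.
        - intros z Hz. destruct (Hpz e z Hz) as (_ & _ & ->). ring. }
      apply (continuous_ext (fun y => h e y * (h e y * (F k e y * d e y)))); [intros; simpl; ring|].
      apply step_fun_continuous; auto.
      intros z Hz. destruct (Hpz e z Hz) as (_ & _ & ->). ring.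
    - intros y _ Hn. apply step_fun_locally_constant; auto.
    - intros y Hy. rewrite Ev by auto. unfold g. ring. }
  assert (Hflux : lsum (seq 0 (nE G)) (fun e => Xi e 0 - Xi e (len G e)) = 0).
  { assert (P1 : forall v, deg G v = 1%nat -> phi v = 0) by apply Dk.
    assert (P2 : forall v, deg G v = 1%nat -> psi v = 0) by apply Dv.
    assert (F1 := flux_zero G v dv ddv psi psi Hwf Dv P2).
    assert (F2 := flux_zero G v dv ddv psi (fun w => eta w * phi w) Hwf Dv
       ltac:(intros w Hw; cbv beta; rewrite P1 by auto; ring)).
    assert (F3 := flux_zero G (F k) d dd phi (fun w => eta w * eta w * phi w) Hwf Dk
       ltac:(intros w Hw; cbv beta; rewrite P1 by auto; ring)).
    rewrite (lsum_ext _ _ (fun e => (psi (src G e) * dv e 0 - psi (tgt G e) * dv e (len G e))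
      + ((- (2 * t)) * (eta (src G e) * phi (src G e) * dv e 0 - eta (tgt G e) * phi (tgt G e) * dv e (len G e))
      + (t * t) * (eta (src G e) * eta (src G e) * phi (src G e) * d e 0
                  - eta (tgt G e) * eta (tgt G e) * phi (tgt G e) * d e (len G e))))).
    - rewrite !lsum_plus, !lsum_scal, F1, F2, F3. ring.
    - intros e He. apply in_seq in He. destruct Dk as (_ & D2 & _). destruct Dv as (_ & V2 & _).
      assert (a0 := D2 e false ltac:(lia)). assert (a1 := D2 e true ltac:(lia)).
      assert (b0 := V2 e false ltac:(lia)). assert (b1 := V2 e true ltac:(lia)).
      assert (c0 := Heta e false ltac:(lia)). assert (c1 := Heta e true ltac:(lia)).
      unfold Defs.pos, vertex_of in *. unfold Xi. rewrite a0, a1, b0, b1, c0, c1. ring. }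
  assert (Hle : L2_inner G g g <= (lam k - c) * L2_inner G g v).
  { assert (X : 0 <= lsum (seq 0 (nE G)) (fun e => t * RInt (fun y => (lam k - c) * (v e y * (h e y * F k e y)) - h e y * F k e y * (h e y * F k e y)) 0 (len G e))).
    { apply Rle_trans with (lsum (seq 0 (nE G)) (fun e => Xi e 0 - Xi e (len G e))); [rewrite Hflux; apply Rle_refl|].
      apply lsum_le. intros e He. apply in_seq in He. apply Hineq; lia. }
    rewrite lsum_scal in X.
    assert (Ht : 0 < t) by (apply Rinv_0_lt_compat; lra).
    assert (Y : lsum (seq 0 (nE G)) (fun e => RInt (fun y => (lam k - c) * (v e y * (h e y * F k e y)) - h e y * F k e y * (h e y * F k e y)) 0 (len G e))
      = (lam k - c) * L2_inner G v g + (-1) * L2_inner G g g).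
    { unfold L2_inner. change (@sumR) with (@lsum nat). rewrite <- !lsum_scal, <- lsum_plus.
      apply lsum_ext. intros e He. apply in_seq in He. assert (He' : (e < nE G)%nat) by lia.
      assert (cv : forall y, continuous (v e) y) by (apply (Hrel_econt _ _ _ _ Hv); auto).
      assert (cg := Cg e He').
      assert (c1 : forall y, continuous (fun y => v e y * g e y) y) by (intros; apply cont_mult; auto).
      assert (c2 : forall y, continuous (fun y => g e y * g e y) y) by (intros; apply cont_mult; auto).
      replace ((lam k - c) * RInt (fun y => v e y * g e y) 0 (len G e))
        with (RInt (fun _ => 0) 0 (len G e) + (lam k - c) * RInt (fun y => v e y * g e y) 0 (len G e)).
      - rewrite <- (RInt_linear (fun _ => 0) (fun y => v e y * g e y)) by (auto; intros; apply cont_const).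
        rewrite <- RInt_linear; auto.
        + apply RInt_eq. intros y _.
          change ((lam k - c) * (v e y * (h e y * F k e y)) - h e y * F k e y * (h e y * F k e y)
            = 0 + (lam k - c) * (v e y * (h e y * F k e y)) + -1 * (h e y * F k e y * (h e y * F k e y))). ring.
        + intros y. apply cont_plus; [apply cont_const|]. apply cont_mult; auto. apply cont_const.
      - rewrite (RInt_const (V := R_CompleteNormedModule)). unfold scal; simpl; unfold mult; simpl. ring. }
    rewrite Y, (L2_sym G v g) in X by auto. nra. }
  exact (spectral_gap G W lam F k c g v HS Hk Hc1 Cg Hgo Pg Hv Hle).
Qed.

(** * The flow of linear combinations of eigenfunctions *)

Lemma excess_nonneg G v : 0 <= excess G v.
Proof.
  unfold excess. destruct (Nat.leb_spec 2 (deg G v)) as [H|]; [|lra].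
  apply le_INR in H. simpl in H. lra.
Qed.

(** With degree 0 excluded, [excess G v] is [deg v - 2], plus 1 at a boundary vertex; the sum is
    [2 |E| - 2 |V| + |V_b|]. *)
Lemma total_excess G : wf_graph G -> (forall v, (v < nV G)%nat -> (1 <= deg G v)%nat) ->
  lsum (seq 0 (nV G)) (excess G) = IZR (Z.of_nat (num_boundary G) + 2 * betti G - 2).
Proof.
  intros Hwf Hd.
  rewrite (lsum_ext _ _ (fun v => lsum (vends G v) (fun _ => 1) + ((-2) + if Nat.eqb (deg G v) 1 then 1 else 0))).
  - rewrite !lsum_plus, (sum_over_vertices G (fun _ => 1) Hwf).
    rewrite (lsum_const (seq 0 (nE G))), (lsum_const (seq 0 (nV G))), !length_seq.
    rewrite <- lsum_filter, lsum_const. unfold betti, num_boundary.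
    rewrite minus_IZR, plus_IZR, mult_IZR, plus_IZR, minus_IZR, <- !INR_IZR_INZ. ring.
  - intros v Hv. apply in_seq in Hv. specialize (Hd v ltac:(lia)).
    rewrite lsum_const, vends_length. unfold excess.
    destruct (Nat.leb_spec 2 (deg G v)) as [H|H].
    + destruct (Nat.eqb_spec (deg G v) 1); [lia|ring].
    + replace (deg G v) with 1%nat by lia. simpl. ring.
Qed.

(** The threshold comes from [1 + t * d <= exp (t * d)]. *)
Lemma exp_decay A d e : 0 < d -> 0 < e ->
  exists T, forall t, T <= t -> Rabs (A * exp (- t * d)) <= e.
Proof.
  intros Hd He. exists (Rabs A / (e * d)). intros t Ht.
  assert (HA := Rabs_pos A). assert (Hed : 0 < e * d) by (apply Rmult_lt_0_compat; auto).
  rewrite Rabs_mult, (Rabs_right (exp _)) by (apply Rle_ge, Rlt_le, exp_pos).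
  replace (- t * d) with (- (t * d)) by ring. rewrite exp_Ropp.
  assert (HX : 1 + t * d <= exp (t * d)) by apply exp_ineq1_le.
  assert (HY : Rabs A <= e * (t * d)).
  { apply Rmult_le_compat_r with (r := e * d) in Ht; [|lra].
    replace (Rabs A / (e * d) * (e * d)) with (Rabs A) in Ht by (field; lra). lra. }
  apply Rmult_le_reg_r with (exp (t * d)); [apply exp_pos|].
  rewrite Rmult_assoc, Rinv_l by (apply Rgt_not_eq, exp_pos).
  assert (e * (t * d) <= e * exp (t * d)) by (apply Rmult_le_compat_l; lra). lra.
Qed.

Lemma exp_decay_family (M : nat) (A d : nat -> R) (P : nat -> Prop) e : 0 < e ->
  (forall i, (i < M)%nat -> P i -> 0 < d i) ->
  exists T, forall t i, T <= t -> (i < M)%nat -> P i -> Rabs (A i * exp (- t * d i)) <= e.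
Proof.
  intros He. induction M as [|M IH]; intros Hd.
  - exists 0. intros; lia.
  - destruct IH as [T1 H1]; [intros; apply Hd; auto|].
    destruct (classic (P M)) as [HP|HP].
    + destruct (exp_decay (A M) (d M) e (Hd M (le_n _) HP) He) as [T2 H2].
      exists (Rmax T1 T2). assert (X := Rmax_l T1 T2). assert (Y := Rmax_r T1 T2).
      intros t i Ht Hi HPi. destruct (Nat.eq_dec i M) as [->|]; [apply H2; lra|apply H1; auto; [lra|lia]].
    + exists T1. intros t i Ht Hi HPi. destruct (Nat.eq_dec i M) as [->|]; [contradiction|].
      apply H1; auto; lia.
Qed.

Lemma has_zeros_eigen_bound G W lam F k phi r : spectral G W lam F -> (1 <= k)%nat ->
  vertex_values G (F k) phi -> has_zeros G (F k) phi r ->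
  r <= IZR (Z.of_nat k - 1 + betti G).
Proof.
  intros HS Hk Hv Hr. destruct (has_zeros_to_list G (F k) phi r Hv Hr) as (s & H1 & H2 & H3).
  eapply Rle_trans; [exact H3|]. rewrite INR_IZR_INZ. apply IZR_le.
  apply (nodal_upper_bound G W lam F k s); auto.
Qed.

(** All zeros of an eigenfunction are simple and none lies at an inner vertex, so
    [zero_count_stable] applies on each edge; [D] is the smallest of finitely many edge
    tolerances. *)
Lemma zero_count_near_eigenfunction G W lam F (M : nat) (kk : nat -> nat) p : spectral G W lam F ->
  (forall i, (i < M)%nat -> (1 <= kk i)%nat) -> (p < M)%nat ->
  exists D, 0 < D /\ forall c : nat -> R, c p = 1 ->
    (forall i, (i < M)%nat -> i <> p -> Rabs (c i) <= D) ->
    forall e, (e < nE G)%nat ->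
      (forall n, nz (F (kk p) e) 0 (len G e) n <->
         nz (fun x => lsum (seq 0 M) (fun i => c i * F (kk i) e x)) 0 (len G e) n) /\
      (forall b, (2 <= deg G (vertex_of G e b))%nat ->
         lsum (seq 0 M) (fun i => c i * F (kk i) e (Defs.pos G e b)) <> 0).
Proof.
  intros HS Hkk Hp. assert (Hwf := sp_wf _ _ _ _ HS).
  destruct (spectral_choice _ _ _ _ HS) as (d & dd & phi & HD).
  assert (CF : forall i, (i < M)%nat -> econt G (F (kk i)))
    by (intros i Hi; apply (spectral_econt _ _ _ _ _ HS); auto).
  assert (Cd : forall i, (i < M)%nat -> econt G (d (kk i))).
  { intros i Hi e He. destruct (HD (kk i) (Hkk i Hi)) as ((A1 & _) & _).
    apply (smooth2_continuous _ _ _ (A1 e He)). }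
  destruct (family_bounded G (fun i => F (kk i)) M Hwf CF) as [B1 [P1 Q1]].
  destruct (family_bounded G (fun i => d (kk i)) M Hwf Cd) as [B2 [P2 Q2]].
  set (B := INR M * (B1 + B2) + 1).
  assert (HM := pos_INR M).
  assert (HB : 0 < B) by (unfold B; assert (0 <= INR M * (B1 + B2)) by (apply Rmult_le_pos; lra); lra).
  assert (Hclose : forall (c : nat -> R) D (u : nat -> gfun) Bu, 0 <= D -> 0 <= Bu -> Bu <= B1 + B2 -> c p = 1 ->
     (forall i, (i < M)%nat -> i <> p -> Rabs (c i) <= D) ->
     (forall i e x, (i < M)%nat -> (e < nE G)%nat -> 0 <= x <= len G e -> Rabs (u i e x) <= Bu) ->
     forall e x, (e < nE G)%nat -> 0 <= x <= len G e ->
       Rabs (lsum (seq 0 M) (fun i => c i * u i e x) - u p e x) <= D * B).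
  { intros c D u Bu HD0 HBu0 HBu Hcp Hc Hu e x He Hx.
    replace (lsum (seq 0 M) (fun i => c i * u i e x) - u p e x)
      with (lsum (seq 0 M) (fun i => if Nat.eqb i p then 0 else c i * u i e x)).
    - eapply Rle_trans; [apply lsum_abs|].
      apply Rle_trans with (lsum (seq 0 M) (fun _ => D * Bu)).
      + apply lsum_le. intros i Hi. apply in_seq in Hi. destruct (Nat.eqb_spec i p) as [->|Hip].
        * rewrite Rabs_R0. apply Rmult_le_pos; auto.
        * rewrite Rabs_mult. apply Rmult_le_compat; try apply Rabs_pos; [apply Hc|apply Hu]; auto; lia.
      + rewrite lsum_const, length_seq. unfold B.
        replace (INR M * (D * Bu)) with (D * (INR M * Bu)) by ring.
        apply Rmult_le_compat_l; auto.
        assert (INR M * Bu <= INR M * (B1 + B2)) by (apply Rmult_le_compat_l; lra). lra.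
    - rewrite <- (Rmult_1_l (u p e x)), <- Hcp.
      rewrite <- (lsum_delta M p (fun i => c i * u i e x) Hp).
      replace (lsum (seq 0 M) (fun i => c i * u i e x) - lsum (seq 0 M) (fun i => if Nat.eqb i p then c i * u i e x else 0))
        with (lsum (seq 0 M) (fun i => c i * u i e x) + (-1) * lsum (seq 0 M) (fun i => if Nat.eqb i p then c i * u i e x else 0)) by ring.
      rewrite <- lsum_scal, <- lsum_plus. apply lsum_ext. intros i _. destruct (Nat.eqb i p); ring. }
  assert (Hedge : forall e, (e < nE G)%nat -> exists D, 0 < D /\ forall c : nat -> R, c p = 1 ->
    (forall i, (i < M)%nat -> i <> p -> Rabs (c i) <= D) ->
      (forall n, nz (F (kk p) e) 0 (len G e) n <->
         nz (fun x => lsum (seq 0 M) (fun i => c i * F (kk i) e x)) 0 (len G e) n) /\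
      (forall b, (2 <= deg G (vertex_of G e b))%nat ->
         lsum (seq 0 M) (fun i => c i * F (kk i) e (Defs.pos G e b)) <> 0)).
  { intros e He. destruct (Hwf e He) as [_ [_ Hl]].
    assert (Hpp := HD (kk p) (Hkk p Hp)). assert (Hpp' := Hpp). destruct Hpp' as ((A1 & A2 & A3 & _) & _).
    destruct (A1 e He) as (a1 & a2 & a3).
    destruct (zero_count_stable (F (kk p) e) (d (kk p) e) (len G e) Hl a1) as [e0 [He0 Hst]].
    { apply (Cd p Hp); auto. }
    { intros x Hx. apply (sp_simple _ _ _ _ HS (kk p) _ _ _ e x (Hkk p Hp) Hpp He Hx). }
    (* The default 1 asks for nothing where [F (kk p)] vanishes: by genericity such an end is a
       boundary vertex, and there the whole combination vanishes. *)
    set (eta := fun b => if Req_EM_T (F (kk p) e (Defs.pos G e b)) 0 then 1 else Rabs (F (kk p) e (Defs.pos G e b))).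
    assert (Heta : forall b, 0 < eta b).
    { intros b. unfold eta. destruct (Req_EM_T (F (kk p) e (Defs.pos G e b)) 0); [lra|apply Rabs_pos_lt; auto]. }
    set (m := Rmin e0 (Rmin (eta false / 2) (eta true / 2))).
    assert (Hm : 0 < m).
    { unfold m. assert (X := Heta false). assert (Y := Heta true). repeat apply Rmin_case; lra. }
    assert (Hm1 : m <= e0) by apply Rmin_l.
    assert (Hm2 : forall b, m <= eta b / 2).
    { intros b. eapply Rle_trans; [apply Rmin_r|]. destruct b; [apply Rmin_r|apply Rmin_l]. }
    exists (m / B). split; [apply Rdiv_lt_0_compat; auto|]. intros c Hcp Hc.
    assert (HDB : m / B * B = m) by (field; lra).
    assert (HD0 : 0 <= m / B) by (apply Rlt_le, Rdiv_lt_0_compat; auto).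
    assert (K1 := Hclose c (m / B) (fun i => F (kk i)) B1 HD0 P1 ltac:(lra) Hcp Hc Q1).
    assert (K2 := Hclose c (m / B) (fun i => d (kk i)) B2 HD0 P2 ltac:(lra) Hcp Hc Q2).
    rewrite HDB in K1, K2.
    assert (Hend : forall b, F (kk p) e (Defs.pos G e b) = 0 ->
              lsum (seq 0 M) (fun i => c i * F (kk i) e (Defs.pos G e b)) = 0).
    { intros b E. assert (Hdg := deg_pos_of_end G e b He).
      destruct (le_lt_dec 2 (deg G (vertex_of G e b))) as [H2|H2].
      - exfalso. apply (sp_inner _ _ _ _ HS (kk p) e b (Hkk p Hp) He H2 E).
      - apply lsum_zero. intros i Hi. apply in_seq in Hi.
        destruct (HD (kk i) (Hkk i ltac:(lia))) as ((_ & C2 & C3 & _) & _).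
        rewrite C2, C3 by (auto; lia). ring. }
    split.
    - apply (Hst _ (fun x => lsum (seq 0 M) (fun i => c i * d (kk i) e x))).
      + assert (HB' : forall i, In i (seq 0 M) -> forall x, is_derive (F (kk i) e) x (d (kk i) e x)).
        { intros i Hi x. apply in_seq in Hi. destruct (HD (kk i) (Hkk i ltac:(lia))) as ((C1 & _) & _).
          apply C1; auto. }
        clear - HB'. induction (seq 0 M) as [|i l IH]; intros x; simpl; [apply deriv_const|].
        apply deriv_plus; [apply deriv_scal, HB'; left; auto|]. apply IH. intros; apply HB'; right; auto.
      + intros x Hx. specialize (K1 e x He Hx). specialize (K2 e x He Hx). split; lra.
      + exact (Hend false).
      + exact (Hend true).
    - intros b Hb H0.
      assert (Hn := sp_inner _ _ _ _ HS (kk p) e b (Hkk p Hp) He Hb).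
      assert (Hx : 0 <= Defs.pos G e b <= len G e) by (destruct b; simpl; lra).
      specialize (K1 e _ He Hx). rewrite H0, Rminus_0_l, Rabs_Ropp in K1.
      specialize (Hm2 b). unfold eta in Hm2.
      destruct (Req_EM_T (F (kk p) e (Defs.pos G e b)) 0); [contradiction|].
      assert (0 < Rabs (F (kk p) e (Defs.pos G e b))) by (apply Rabs_pos_lt; auto). lra. }
  assert (Hall : forall N, (N <= nE G)%nat -> exists D, 0 < D /\ forall c : nat -> R, c p = 1 ->
    (forall i, (i < M)%nat -> i <> p -> Rabs (c i) <= D) -> forall e, (e < N)%nat ->
      (forall n, nz (F (kk p) e) 0 (len G e) n <->
         nz (fun x => lsum (seq 0 M) (fun i => c i * F (kk i) e x)) 0 (len G e) n) /\
      (forall b, (2 <= deg G (vertex_of G e b))%nat ->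
         lsum (seq 0 M) (fun i => c i * F (kk i) e (Defs.pos G e b)) <> 0)).
  { induction N as [|N IH]; intros HN; [exists 1; split; [lra|intros; lia]|].
    destruct IH as [D1 [HD1 H1]]; [lia|]. destruct (Hedge N ltac:(lia)) as [D2 [HD2 H2]].
    exists (Rmin D1 D2). split; [apply Rmin_case; auto|].
    assert (X := Rmin_l D1 D2). assert (Y := Rmin_r D1 D2).
    intros c Hcp Hc e He. destruct (Nat.eq_dec e N) as [->|].
    - apply H2; auto. intros i Hi Hip. specialize (Hc i Hi Hip). lra.
    - apply H1; auto; [|lia]. intros i Hi Hip. specialize (Hc i Hi Hip). lra. }
  apply (Hall (nE G)); auto.
Qed.

Lemma nz_scal (g : R -> R) c a b n : c <> 0 -> (nz (fun x => c * g x) a b n <-> nz g a b n).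
Proof.
  intros Hc. revert a. induction n as [|n IH]; intros a; [tauto|]. simpl. split.
  - intros [x [Hx [E N]]]. exists x. split; auto. split; [|apply IH; auto].
    apply Rmult_integral in E. tauto.
  - intros [x [Hx [E N]]]. exists x. split; auto. split; [rewrite E; ring|apply IH; auto].
Qed.

Section Flow.

Variables (G : mgraph) (W : gfun) (lam : nat -> R) (F d dd : nat -> gfun) (phi : nat -> nat -> R).
Variables (M' : nat) (kk : nat -> nat) (a : nat -> R) (c : R).

Let M := S M'.

Hypothesis HS : spectral G W lam F.
Hypothesis HD : forall k, (1 <= k)%nat -> eigen_data G W (lam k) (F k) (d k) (dd k) (phi k).
Hypothesis Hkk : forall i, (i < M)%nat -> (1 <= kk i)%nat.
Hypothesis Hincr : forall i j, (i < j)%nat -> (j < M)%nat -> (kk i < kk j)%nat.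
Hypothesis Ha : forall i, (i < M)%nat -> a i <> 0.
Hypothesis Hc : c < lam 1%nat.
Hypothesis HcW : forall e x, (e < nE G)%nat -> 0 <= x <= len G e -> c < W e x.

(** [exp (- t * s i)] is the power [(lam (kk i) - c)^(- t)] for real [t]; distinct eigenvalues give
    distinct exponents. *)
Let s (i : nat) : R := ln (lam (kk i) - c).

(* [flow t] solves (H - c) (flow (t + 1)) = flow t; it interpolates between multiples of
   [F (kk M')] as t -> -oo and of [F (kk 0)] as t -> +oo. *)
Definition flow (t : R) : gfun :=
  fun e x => lsum (seq 0 M) (fun i => a i * exp (- t * s i) * F (kk i) e x).
Definition flow_d (t : R) : gfun :=
  fun e x => lsum (seq 0 M) (fun i => a i * exp (- t * s i) * d (kk i) e x).
Definition flow_dd (t : R) : gfun :=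
  fun e x => lsum (seq 0 M) (fun i => a i * exp (- t * s i) * dd (kk i) e x).
Definition flow_phi (t : R) (v : nat) : R := expsum M (fun i => a i * phi (kk i) v) s t.

Lemma mu_pos i : (i < M)%nat -> 0 < lam (kk i) - c.
Proof.
  intros Hi. specialize (Hkk i Hi).
  destruct (Nat.eq_dec (kk i) 1) as [->|]; [lra|].
  assert (lam 1%nat < lam (kk i)) by (apply (sp_incr _ _ _ _ HS); lia). lra.
Qed.

Lemma s_incr i j : (i < j)%nat -> (j < M)%nat -> s i < s j.
Proof.
  intros Hij Hj. unfold s. apply ln_increasing; [apply mu_pos; lia|].
  assert (lam (kk i) < lam (kk j)); [|lra].
  apply (sp_incr _ _ _ _ HS); auto. apply Hkk; lia.
Qed.

Lemma flow_dom t : in_dom G (flow t) (flow_d t) (flow_dd t) (flow_phi t).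
Proof.
  replace (flow_phi t) with (fun v => lsum (seq 0 M) (fun i => a i * exp (- t * s i) * phi (kk i) v)).
  - apply (in_dom_lsum G (fun i => F (kk i)) (fun i => d (kk i)) (fun i => dd (kk i)) (fun i => phi (kk i))
      (fun i => a i * exp (- t * s i))).
    intros i Hi. apply in_seq in Hi. apply HD. apply Hkk. lia.
  - apply FunctionalExtensionality.functional_extensionality. intros v.
    apply lsum_ext. intros; ring.
Qed.

Lemma flow_eq t e x : (e < nE G)%nat -> 0 <= x <= len G e ->
  0 < W e x - c /\ flow_dd (t + 1) e x = (W e x - c) * flow (t + 1) e x - flow t e x.
Proof.
  intros He Hx. split; [specialize (HcW e x He Hx); lra|].
  unfold flow, flow_dd.
  replace ((W e x - c) * lsum (seq 0 M) (fun i => a i * exp (- (t + 1) * s i) * F (kk i) e x) -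
     lsum (seq 0 M) (fun i => a i * exp (- t * s i) * F (kk i) e x))
  with ((W e x - c) * lsum (seq 0 M) (fun i => a i * exp (- (t + 1) * s i) * F (kk i) e x) +
     (-1) * lsum (seq 0 M) (fun i => a i * exp (- t * s i) * F (kk i) e x)) by ring.
  rewrite <- !lsum_scal, <- lsum_plus. apply lsum_ext. intros i Hi. apply in_seq in Hi.
  assert (Hi' : (i < M)%nat) by lia.
  destruct (HD (kk i) (Hkk i Hi')) as [_ E]. rewrite E by auto.
  assert (P := mu_pos i Hi').
  replace (- t * s i) with (- (t + 1) * s i + s i) by ring. rewrite exp_plus.
  unfold s at 4. rewrite exp_ln by auto. ring.
Qed.

Lemma flow_values t : vertex_values G (flow t) (flow_phi t).
Proof. intros e b He. apply (flow_dom t); auto. Qed.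

(** Nonvanishing passes from time [t] to [t + 1] but not back, which is why it is established at a
    very negative time. *)
Lemma flow_nowhere_zero t J : nowhere_zero G (flow t) -> nowhere_zero G (flow (t + INR J)).
Proof.
  intros H0. induction J as [|J IH].
  - simpl. rewrite Rplus_0_r. auto.
  - rewrite S_INR, <- Rplus_assoc.
    apply (nowhere_zero_step G W c (flow (t + INR J + 1)) _ _ _ (flow (t + INR J)) (sp_wf _ _ _ _ HS)
      (flow_dom (t + INR J + 1))); auto.
    intros e x He Hx. apply flow_eq; auto.
Qed.

(** Genericity enters here: at an inner vertex no coefficient [a i * phi (kk i) v] vanishes. *)
Lemma flow_phi_zeros v A B n : (2 <= deg G v)%nat -> nz (fun t => flow_phi t v) A B n -> (n <= M')%nat.
Proof.
  intros Hv N. apply (expsum_zeros M' (fun i => a i * phi (kk i) v) s n A B); auto.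
  - intros i Hi. apply Rmult_integral_contrapositive. split; [apply Ha; auto|].
    destruct (HD (kk i) (Hkk i Hi)) as [Dk _].
    apply (vertex_value_nonzero G W lam F (kk i) _ _ _ v HS (Hkk i Hi) Dk Hv).
  - intros i j Hi Hj Hij. destruct (Nat.lt_gt_cases i j) as [H _]. destruct (H Hij) as [Hlt|Hlt].
    + assert (X := s_incr i j Hlt Hj). lra.
    + assert (X := s_incr j i Hlt Hi). lra.
Qed.

(** The losses at an inner vertex over all [J] steps together correspond to distinct zeros of one
    exponential sum, so they number at most [M'] whatever [J] is. *)
Lemma flow_zero_count t J r : nowhere_zero G (flow t) ->
  has_zeros G (flow (t + INR J)) (flow_phi (t + INR J)) r ->
  has_zeros G (flow t) (flow_phi t) (r - INR M' * lsum (seq 0 (nV G)) (excess G)).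
Proof.
  intros HN Hr.
  assert (X := zero_count_chain G W c (fun j => flow (t + INR j)) (fun j => flow_d (t + INR j))
    (fun j => flow_dd (t + INR j)) (fun j => flow_phi (t + INR j)) (sp_wf _ _ _ _ HS)).
  cbv beta in X. change (INR 0) with 0 in X. rewrite Rplus_0_r in X.
  assert (Y := X (fun j => flow_dom (t + INR j))). clear X.
  assert (Z := Y ltac:(intros j e x He Hx; rewrite S_INR, <- Rplus_assoc; apply flow_eq; auto) HN J r Hr).
  destruct Z as [cnt [H1 H2]]. exists cnt. split; auto.
  eapply Rle_trans; [|exact H2]. apply Rplus_le_compat_l, Ropp_le_contravar.
  rewrite <- lsum_scal. apply lsum_le. intros v _.
  destruct (le_lt_dec 2 (deg G v)) as [Hv|Hv].
  - apply Rmult_le_compat_r; [apply excess_nonneg|].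
    destruct (loss_zeros (fun t => flow_phi t v) t J) as [m [Hm N]].
    { intros u. eapply deriv_continuous. apply expsum_deriv. }
    cbv beta in Hm. rewrite <- Hm. apply le_INR. apply (flow_phi_zeros v _ _ m Hv N).
  - unfold excess. destruct (Nat.leb_spec 2 (deg G v)); [lia|]. lra.
Qed.

(** Divided by the coefficient of its [p]-th term, the flow is [F (kk p)] plus terms decaying like
    [exp (- t * (sg * (s i - s p)))]. The sign [sg] is 1 for [t -> +oo] and -1 for [t -> -oo]. *)
Lemma flow_near_dominant (sg : R) p : (p < M)%nat ->
  (forall i, (i < M)%nat -> i <> p -> 0 < sg * (s i - s p)) ->
  exists T, forall t, T <= t ->
    (forall e n, (e < nE G)%nat ->
       (nz (F (kk p) e) 0 (len G e) n <-> nz (flow (sg * t) e) 0 (len G e) n)) /\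
    (forall v, vzero G (flow_phi (sg * t)) v = 0).
Proof.
  intros Hp Hs.
  destruct (zero_count_near_eigenfunction G W lam F M kk p HS Hkk Hp) as [D [HD0 HDc]].
  destruct (exp_decay_family M (fun i => a i / a p) (fun i => sg * (s i - s p)) (fun i => i <> p) D HD0 Hs)
    as [T HT].
  exists T. intros t Ht.
  set (cf := fun i => a i / a p * exp (- t * (sg * (s i - s p)))).
  assert (Hap := Ha p Hp).
  assert (Hcp : cf p = 1).
  { unfold cf. replace (- t * (sg * (s p - s p))) with 0 by ring. rewrite exp_0. field. auto. }
  assert (Hcf : forall i, (i < M)%nat -> i <> p -> Rabs (cf i) <= D) by (intros; apply HT; auto).
  set (kap := a p * exp (- (sg * t) * s p)).
  assert (Hkap : kap <> 0).
  { apply Rmult_integral_contrapositive. split; auto. apply Rgt_not_eq, exp_pos. }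
  assert (Efl : forall e x, flow (sg * t) e x = kap * lsum (seq 0 M) (fun i => cf i * F (kk i) e x)).
  { intros e x. unfold flow. rewrite <- lsum_scal. apply lsum_ext. intros i _. unfold kap, cf.
    replace (- (sg * t) * s i) with (- (sg * t) * s p + - t * (sg * (s i - s p))) by ring.
    rewrite exp_plus. field. auto. }
  split.
  - intros e n He. destruct (HDc cf Hcp Hcf e He) as [Hn _]. rewrite (Hn n).
    rewrite <- (nz_scal _ kap) by auto.
    split; apply nz_ext; intros; rewrite Efl; auto.
  - intros v. unfold vzero. destruct (Nat.leb_spec 2 (deg G v)) as [Hv|]; auto.
    destruct (Req_EM_T (flow_phi (sg * t) v) 0) as [E|]; auto. exfalso.
    assert (Hl := vends_length G v). destruct (vends G v) as [|[e b] l] eqn:Ev; [simpl in Hl; lia|].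
    assert (Hin : In (e, b) (vends G v)) by (rewrite Ev; left; auto).
    apply in_vends in Hin. destruct Hin as [He Hb].
    destruct (HDc cf Hcp Hcf e He) as [_ Hn]. rewrite <- Hb in Hv, E. apply (Hn b Hv).
    rewrite <- (flow_values (sg * t) e b He), Efl in E.
    apply Rmult_integral in E. destruct E; [contradiction|auto].
Qed.

Lemma archimedean_nat (T : R) : exists J : nat, T <= INR J.
Proof.
  destruct (archimed T) as [H _]. destruct (Z_le_gt_dec 0 (up T)) as [Hz|Hz].
  - exists (Z.to_nat (up T)). rewrite INR_IZR_INZ, Z2Nat.id by auto. lra.
  - exists 0%nat. simpl. assert (IZR (up T) <= 0) by (apply (IZR_le _ 0); lia). lra.
Qed.

(** If the flow vanished on an interval, it would have arbitrarily many zeros there; these would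
    pass to [F (kk M')] and contradict its nodal upper bound. *)
Lemma flow_from_minus_infinity : exists J : nat,
  nowhere_zero G (flow (- INR J)) /\
  forall r, has_zeros G (flow (- INR J)) (flow_phi (- INR J)) r ->
    r <= IZR (Z.of_nat (kk M') - 1 + betti G).
Proof.
  destruct (flow_near_dominant (-1) M' (le_n _)) as [T HT].
  { intros i Hi Hn. unfold M in *. assert (s i < s M') by (apply s_incr; unfold M; lia). lra. }
  destruct (archimedean_nat T) as [J HJ]. exists J.
  destruct (HT (INR J) HJ) as [H1 H2]. replace (-1 * INR J) with (- INR J) in * by ring.
  assert (HkM : (1 <= kk M')%nat) by (apply Hkk; unfold M; lia).
  assert (Hval : vertex_values G (F (kk M')) (phi (kk M'))).
  { destruct (HD (kk M') HkM) as ((_ & A2 & _) & _). exact A2. }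
  assert (Hv0 : forall (p : nat -> R) v, 0 <= vzero G p v).
  { intros p v. unfold vzero. destruct (Nat.leb 2 (deg G v)); [destruct (Req_EM_T (p v) 0)|]; lra. }
  split.
  - intros e He a0 b0 Ha0 Hab Hb0. apply NNPP. intros Hno.
    assert (Hz : forall x, a0 < x < b0 -> flow (- INR J) e x = 0).
    { intros x Hx. apply NNPP. intros Hn. apply Hno. exists x; auto. }
    assert (Hmany : forall n a1, a0 <= a1 -> a1 < b0 -> nz (flow (- INR J) e) a1 b0 n).
    { induction n as [|n IH]; intros a1 Ha1 Hb1; [exact I|].
      exists ((a1 + b0) / 2). split; [lra|]. split; [apply Hz; lra|]. apply IH; lra. }
    destruct (archimedean_nat (IZR (Z.of_nat (kk M') - 1 + betti G) + 1)) as [n Hn].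
    assert (Hnz : nz (F (kk M') e) 0 (len G e) n).
    { apply H1; auto. apply (nz_weaken _ n n a0 b0); auto. apply Hmany; lra. }
    assert (Hh : has_zeros G (F (kk M')) (phi (kk M')) (INR n)).
    { exists (fun e' => if Nat.eqb e' e then n else 0%nat). split.
      - intros e' He'. destruct (Nat.eqb_spec e' e) as [->|]; auto. exact I.
      - rewrite (lsum_ext _ (fun e' => INR (if Nat.eqb e' e then n else 0%nat)) (fun e' => if Nat.eqb e' e then INR n else 0))
          by (intros i _; destruct (Nat.eqb i e); auto).
        rewrite (lsum_delta (nE G) e (fun _ => INR n)) by auto.
        assert (0 <= lsum (seq 0 (nV G)) (vzero G (phi (kk M')))) by (apply lsum_nonneg; auto). lra. }
    assert (X := has_zeros_eigen_bound G W lam F (kk M') _ _ HS HkM Hval Hh). lra.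
  - intros r [cnt [C1 C2]].
    apply (has_zeros_eigen_bound G W lam F (kk M') (phi (kk M')) r HS HkM Hval).
    exists cnt. split; [intros e He; apply H1; auto|].
    rewrite (lsum_zero _ (vzero G (flow_phi (- INR J)))) in C2 by auto.
    assert (0 <= lsum (seq 0 (nV G)) (vzero G (phi (kk M')))) by (apply lsum_nonneg; auto). lra.
Qed.

Lemma flow_to_plus_infinity : exists J : nat,
  has_zeros G (flow (INR J)) (flow_phi (INR J)) (INR (kk 0%nat) - 1).
Proof.
  assert (H0 : (0 < M)%nat) by (unfold M; lia).
  destruct (flow_near_dominant 1 0 H0) as [T HT].
  { intros i Hi Hn. assert (s 0 < s i) by (apply s_incr; auto; lia). lra. }
  destruct (archimedean_nat T) as [J HJ]. exists J.
  destruct (HT (INR J) HJ) as [H1 H2]. replace (1 * INR J) with (INR J) in * by ring.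
  destruct (nodal_lower_bound G W lam F (kk 0%nat) HS (Hkk 0%nat H0)) as (l & L1 & L2 & L3).
  destruct (HD (kk 0%nat) (Hkk 0%nat H0)) as [Dk _].
  destruct (has_zeros_of_list G (F (kk 0%nat)) (phi (kk 0%nat)) l) as [cnt [C1 C2]]; auto.
  { destruct Dk as (_ & A2 & _). exact A2. }
  exists cnt. split; [intros e He; apply H1; auto|].
  apply le_INR in L3. rewrite S_INR in L3.
  rewrite (lsum_zero _ (vzero G (flow_phi (INR J)))) by auto.
  rewrite (lsum_zero _ (vzero G (phi (kk 0%nat)))) in C2.
  - lra.
  - intros v _. unfold vzero. destruct (Nat.leb_spec 2 (deg G v)) as [Hv|]; auto.
    destruct (Req_EM_T (phi (kk 0%nat) v) 0) as [E|]; auto. exfalso.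
    apply (vertex_value_nonzero G W lam F (kk 0%nat) _ _ _ v HS (Hkk 0%nat H0) Dk Hv E).
Qed.

(** The same monotonicity is used twice: from a late time down to 0 for the lower bound, and from 0
    down to an early time for the upper one. *)
Lemma flow_zero_bounds :
  has_zeros G (flow 0) (flow_phi 0) (INR (kk 0%nat) - 1 - INR M' * lsum (seq 0 (nV G)) (excess G)) /\
  forall r, has_zeros G (flow 0) (flow_phi 0) r ->
    r <= IZR (Z.of_nat (kk M') - 1 + betti G) + INR M' * lsum (seq 0 (nV G)) (excess G).
Proof.
  destruct flow_from_minus_infinity as [J [HN HU]].
  destruct flow_to_plus_infinity as [J' HL].
  split.
  - apply (flow_zero_count 0 J').
    + replace 0 with (- INR J + INR J) by ring. apply flow_nowhere_zero; auto.
    + rewrite Rplus_0_l. auto.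
  - intros r Hr. assert (X := flow_zero_count (- INR J) J r HN).
    replace (- INR J + INR J) with 0 in X by ring. specialize (X Hr). apply HU in X. lra.
Qed.

End Flow.

Lemma is_zero_ext G u w : wf_graph G ->
  (forall e x, (e < nE G)%nat -> 0 <= x <= len G e -> u e x = w e x) ->
  forall p, is_zero G u p -> is_zero G w p.
Proof.
  intros Hwf E [e x|v]; simpl.
  - intros (He & Hx & H0). rewrite <- E by (auto; lra). auto.
  - intros (Hv & Hd & e & b & He & Hb & H0). split; auto. split; auto. exists e, b.
    split; auto. split; auto. rewrite <- E; auto.
    destruct (Hwf e He) as [_ [_ Hl]]. destruct b; simpl; lra.
Qed.

Theorem theorem1 (G : mgraph) (W : gfun) (lam : nat -> R) (f : nat -> gfun)
    (M : nat) (k : nat -> nat) (a : nat -> R) :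
  wf_graph G -> connected G -> potential_C1 G W -> generic G W ->
  eigen_sequence G W lam f ->
  (1 <= M)%nat ->
  (forall i, (1 <= i <= M)%nat -> (1 <= k i)%nat) ->
  (forall i j, (1 <= i)%nat -> (i < j)%nat -> (j <= M)%nat -> (k i < k j)%nat) ->
  (forall i, (1 <= i <= M)%nat -> a i <> 0) ->
  exists n : nat,
    num_zeros G (fun e x => sumR (seq 1 M) (fun i => a i * f (k i) e x)) n /\
    (Z.of_nat (k 1%nat) - 1 - (Z.of_nat M - 1) * (Z.of_nat (num_boundary G) + 2 * betti G - 2)
       <= Z.of_nat n)%Z /\
    (Z.of_nat n <= Z.of_nat (k M) - 1 + betti G
       + (Z.of_nat M - 1) * (Z.of_nat (num_boundary G) + 2 * betti G - 2))%Z.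
Proof.
  intros Hwf Hconn HW Hg Hseq HM Hk Hincr Ha.
  destruct (spectral_of_sequence G W lam f Hwf Hconn HW Hg Hseq) as (W' & F & HS & HF).
  destruct (spectral_choice _ _ _ _ HS) as (d & dd & phi & HD).
  destruct M as [|M']; [lia|].
  destruct (econt_bounded G W' Hwf (sp_cont _ _ _ _ HS)) as [KW [HKW HWb]].
  (* Below [W'] for the maximum principle, and below the spectrum so that the logarithms in the flow
     are of positive numbers. *)
  set (c := Rmin (- KW) (lam 1%nat) - 1).
  assert (Hc : c < lam 1%nat) by (unfold c; assert (X := Rmin_r (- KW) (lam 1%nat)); lra).
  assert (HcW : forall e x, (e < nE G)%nat -> 0 <= x <= len G e -> c < W' e x).
  { intros e x He Hx. specialize (HWb e x He Hx). assert (X := Rmin_l (- KW) (lam 1%nat)).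
    unfold c. unfold Rabs in HWb. destruct Rcase_abs; lra. }
  set (kk := fun i => k (S i)). set (a' := fun i => a (S i)).
  set (U := flow lam F M' kk a' c 0).
  destruct (flow_zero_bounds G W' lam F d dd phi M' kk a' c HS HD) as [HL HU]; auto.
  { intros i Hi. apply Hk; lia. }
  { intros i j Hij Hj. apply Hincr; lia. }
  { intros i Hi. apply Ha; lia. }
  fold U in HL, HU.
  assert (HUv : vertex_values G U (flow_phi lam phi M' kk a' c 0)).
  { apply (flow_values G W' lam F d dd phi M' kk a' c HD). intros i Hi. apply Hk; lia. }
  rewrite (total_excess G Hwf (sp_deg _ _ _ _ HS)) in HL, HU.
  set (Ex := (Z.of_nat (num_boundary G) + 2 * betti G - 2)%Z) in *.
  assert (EU : forall e x, (e < nE G)%nat -> 0 <= x <= len G e ->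
     U e x = sumR (seq 1 (S M')) (fun i => a i * f (k i) e x)).
  { intros e x He Hx. unfold U, flow. change (@sumR) with (@lsum nat).
    rewrite <- seq_shift, lsum_map. apply lsum_ext. intros i Hi. apply in_seq in Hi.
    (* At time 0 all exponential factors are 1, and the flow is the given combination. *)
    replace (- 0 * ln (lam (kk i) - c)) with 0 by ring. rewrite exp_0.
    unfold a', kk. rewrite HF by (auto; apply Hk; lia). ring. }
  assert (HR : INR M' = IZR (Z.of_nat (S M') - 1)).
  { rewrite INR_IZR_INZ. f_equal. lia. }
  assert (Hbound : forall s, NoDup s -> (forall p, In p s -> is_zero G U p) ->
     (Z.of_nat (length s) <= Z.of_nat (k (S M')) - 1 + betti G + (Z.of_nat (S M') - 1) * Ex)%Z).
  { intros s Hd Hs. assert (X := HU _ (has_zeros_of_list G U _ s HUv Hd Hs)).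
    rewrite HR, <- mult_IZR, <- plus_IZR, INR_IZR_INZ in X. apply le_IZR in X. exact X. }
  (* The upper bound holds for every list of zeros, so it also proves that there are finitely
     many. *)
  destruct (complete_list (is_zero G U)
     (Z.to_nat (Z.of_nat (k (S M')) - 1 + betti G + (Z.of_nat (S M') - 1) * Ex))) as [s [Hd Hs]].
  { intros s Hd Hs. specialize (Hbound s Hd Hs). lia. }
  exists (length s). split; [|split].
  - exists s. split; auto. split; auto. intros p. rewrite Hs. split.
    + apply (is_zero_ext G U); auto.
    + apply is_zero_ext; auto. intros; symmetry; auto.
  - destruct (has_zeros_to_list G U _ _ HUv HL) as (s' & Hd' & Hs' & Hl).
    assert (Hlen : (length s' <= length s)%nat).
    { apply NoDup_incl_length; auto. intros p Hp. apply Hs; auto. }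
    rewrite HR, <- mult_IZR, !INR_IZR_INZ in Hl.
    replace (IZR (Z.of_nat (kk 0%nat)) - 1) with (IZR (Z.of_nat (kk 0%nat) - 1)) in Hl
      by (rewrite minus_IZR; auto).
    rewrite <- minus_IZR in Hl. apply le_IZR in Hl. unfold kk in Hl. lia.
  - apply Hbound; auto. intros p Hp. apply Hs; auto.
Qed.
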